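(* Let $f_l < f_r$ be real numbers and let $\Omega := \mathbb{R}\times(f_l,f_r) \subset \bar D := \mathbb{R}\times\mathbb{R}$. For $L>0$ put $\bar D_L := [0,L)\times\mathbb{R}$ and $\Omega_L := [0,L)\times(f_l,f_r)$. Then the following hold. (1) For each $a>0$ and $L>0$ there is a unique $\boldsymbol{s} \in H^1((\mathbb{R}/L\mathbb{Z})\times\mathbb{R})^2$ such that $$a\int_{\bar D_L}\nabla\boldsymbol{s}:\nabla\boldsymbol{u}+\int_{\bar D_L\setminus\Omega_L}\boldsymbol{s}\cdot\boldsymbol{u}=\int_{\Omega_L}\operatorname{div}\boldsymbol{u}\qquad\forall\,\boldsymbol{u}\in H^1((\mathbb{R}/L\mathbb{Z})\times\mathbb{R})^2.$$ (2) The solution is of the form $\boldsymbol{s}(x,y)=(0,S(y))$, where $S\in H^1(\mathbb{R})$ is the unique solution of the one-dimensional problem $$a\int_{-\infty}^{+\infty}S'u'+\left(\int_{-\infty}^{+\infty}-\int_{f_l}^{f_r}\right)S u=\int_{f_l}^{f_r}u'\qquad\forall\,u\in H^1(\mathbb{R}).$$ (3) The divergence $\operatorname{div}\boldsymbol{s}$ is constant in $\Omega$. (4) The PDE-based thickness $T^a_{\bar D,\Omega}:=\frac{2}{\sqrt a\,\operatorname{div}\boldsymbol{s}}$ converges to the thickness $\bar T_\Omega=f_r-f_l$ on $\Omega$ as $a\to0$. (5) Moreover, $T^a_{\bar D,\Omega}=\bar T_\Omega+2\sqrt a$ for all $a>0$.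
   Context: For a domain $\Omega\subset\mathbb{R}^N$, the (local) thickness is $\bar T_\Omega(\boldsymbol{x}):=\sup\{\text{diameter of the closed ball } B\mid \boldsymbol{x}\in B\subset\Omega\}$ for $\boldsymbol{x}\in\Omega$; for the band $\Omega=\mathbb{R}\times(f_l,f_r)$ it is the constant $f_r-f_l$. $H^1((\mathbb{R}/L\mathbb{Z})\times\mathbb{R})$ denotes the space of functions on $\mathbb{R}\times\mathbb{R}$ that are $L$-periodic in the $x$ direction, locally $H^1$, and whose restriction to the unit region $\bar D_L$ is $H^1$ (square integrable together with its first weak derivatives); $H^1(\cdot)^2$ denotes vector fields with both components in that space. $\nabla\boldsymbol{s}:\nabla\boldsymbol{u}=\sum_{i,j}s^i_{x_j}u^i_{x_j}$ is the Frobenius inner product. *)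

(* Defs.v *)
From HB Require Import structures.
From mathcomp Require Import all_boot all_order all_algebra.
From mathcomp Require Import all_classical all_reals all_analysis.

Set Implicit Arguments.
Unset Strict Implicit.
Unset Printing Implicit Defensive.

Import Order.TTheory GRing.Theory Num.Theory.
Import numFieldNormedType.Exports.

Local Open Scope classical_set_scope.
Local Open Scope ring_scope.

(* Functions are representatives: elements of L^2 and H^1 are Borel measurable
   functions, and identities between them are understood almost everywhere. *)

Notation leb1 R := (@lebesgue_measure R) (only parsing).

Notation leb2 R :=
  (@lebesgue_measure R \x @lebesgue_measure R)%E (only parsing).

Section TestFunctions.
Context {R : realType} {V : normedModType R}.

(* C^oo: every iterated directional derivative is (Frechet) differentiable. *)
Definition smooth (phi : V -> R) :=
  forall (vs : seq V) (p : V),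
    differentiable (foldr (fun v f => 'D_v f) phi vs) p.

Definition test_function (phi : V -> R) :=
  smooth phi /\ compact (closure [set p | phi p != 0]).

End TestFunctions.

Section OneDimension.
Context {R : realType}.
Implicit Types u g : R -> R.

Definition is_weak_derivative1 u g :=
  [/\ locally_integrable setT u, locally_integrable setT g &
      forall phi : R -> R, test_function phi ->
        \int[leb1 R]_y (u y * 'D_1 phi y) = - \int[leb1 R]_y (g y * phi y)].

(* The weak derivative is unique up to null sets; this picks one
   representative (and a dummy value if there is none). *)
Definition wderiv1 u : R -> R := get [set g | is_weak_derivative1 u g].

Definition H1_line u :=
  u \in Lfun (leb1 R) 2%:E /\
  exists2 g, is_weak_derivative1 u g & g \in Lfun (leb1 R) 2%:E.

End OneDimension.

Section TwoDimensions.
Context {R : realType}.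
Implicit Types (u g : R * R -> R) (s t : R * R -> R * R) (D : set (R * R)).

Definition L2_on D u := u \_ D \in Lfun (leb2 R) 2%:E.

Definition L2_loc u := forall K : set (R * R), compact K -> L2_on K u.

Definition L1_loc u :=
  forall K : set (R * R), compact K -> u \_ K \in Lfun (leb2 R) 1%:E.

Definition dir_x : R * R := (1, 0).
Definition dir_y : R * R := (0, 1).

Definition is_weak_derivative (v : R * R) u g :=
  [/\ L1_loc u, L1_loc g &
      forall phi : R * R -> R, test_function phi ->
        \int[leb2 R]_p (u p * 'D_v phi p) = - \int[leb2 R]_p (g p * phi p)].

Definition wderiv (v : R * R) u : R * R -> R :=
  get [set g | is_weak_derivative v u g].

Definition unit_region (L : R) : set (R * R) := `[0, L[ `*` setT.

Definition x_periodic (L : R) u :=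
  {ae (leb2 R), forall p : R * R, u (p.1 + L, p.2) = u p}.

Definition H1_per (L : R) u :=
  [/\ x_periodic L u, L2_loc u, L2_on (unit_region L) u &
      forall v, v \in [:: dir_x; dir_y] ->
        exists g, [/\ is_weak_derivative v u g, L2_loc g &
                      L2_on (unit_region L) g]].

Definition H1_per_vec (L : R) s := H1_per L (fst \o s) /\ H1_per L (snd \o s).

Definition frobenius_grad s t (p : R * R) : R :=
  wderiv dir_x (fst \o s) p * wderiv dir_x (fst \o t) p +
  wderiv dir_y (fst \o s) p * wderiv dir_y (fst \o t) p +
  wderiv dir_x (snd \o s) p * wderiv dir_x (snd \o t) p +
  wderiv dir_y (snd \o s) p * wderiv dir_y (snd \o t) p.

Definition dot (p q : R * R) : R := p.1 * q.1 + p.2 * q.2.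

Definition divergence s (p : R * R) : R :=
  wderiv dir_x (fst \o s) p + wderiv dir_y (snd \o s) p.

(* Euclidean balls: the norm of the library on R * R is the sup norm. *)
Definition closed_disc (c : R * R) (r : R) : set (R * R) :=
  [set q | (q.1 - c.1) ^+ 2 + (q.2 - c.2) ^+ 2 <= r ^+ 2].

Definition thickness D (p : R * R) : \bar R :=
  ereal_sup [set d | exists c r, [/\ 0 < r, closed_disc c r p,
                       closed_disc c r `<=` D & d = (2 * r)%:E]].

Definition pde_thickness (a : R) s (p : R * R) : R :=
  2 / (Num.sqrt a * divergence s p).

End TwoDimensions.

Section Band.
Context {R : realType}.
Variables (fl fr : R).

Definition band : set (R * R) := setT `*` `]fl, fr[.

Definition band_cell (L : R) : set (R * R) := `[0, L[ `*` `]fl, fr[.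

Definition solves_pde (a L : R) (s : R * R -> R * R) :=
  H1_per_vec L s /\
  forall u : R * R -> R * R, H1_per_vec L u ->
    a * \int[leb2 R]_(p in unit_region L) frobenius_grad s u p +
    \int[leb2 R]_(p in unit_region L `\` band_cell L) dot (s p) (u p) =
    \int[leb2 R]_(p in band_cell L) divergence u p.

Definition solves_ode (a : R) (S : R -> R) :=
  H1_line S /\
  forall u : R -> R, H1_line u ->
    a * \int[leb1 R]_y (wderiv1 S y * wderiv1 u y) +
    (\int[leb1 R]_y (S y * u y) - \int[leb1 R]_(y in `]fl, fr[) (S y * u y)) =
    \int[leb1 R]_(y in `]fl, fr[) wderiv1 u y.

End Band.

(* Main.v *)
(* Off the band the one-dimensional solution satisfies a S'' = S, hence decays
   like exp (- dist / sqrt a); on the band it is affine.  Its slope there is fixed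
   by the continuity of a S' - 1_band across the edges, which gives
   S' = 2 / (sqrt a (2 sqrt a + fr - fl)) and so the thickness formula.  That S
   solves the weak problem follows by testing the weak derivative of u against
   the weight exp (- dist / sqrt a): the flux a S' - 1_band is a multiple of this
   weight, whose derivative is the same multiple of S 1_outside.  Uniqueness: the
   difference D of two solutions, tested against itself, has zero gradient on a
   period and vanishes outside the band, hence vanishes.
   The line and the plane are treated at once through a measurable coordinate
   y : T -> R on a measure space: integrating an x-strip of the plane against y
   gives a one-dimensional weak derivative with respect to y.  The x-derivative
   of a test field contributes nothing, by periodicity. *)
Require Import Defs.
From HB Require Import structures.
From mathcomp Require Import all_boot all_order all_algebra.
From mathcomp Require Import all_classical all_reals all_analysis.
From mathcomp Require Import measurable_realfun ring lra.

Set Implicit Arguments.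
Unset Strict Implicit.
Unset Printing Implicit Defensive.

Import Order.TTheory GRing.Theory Num.Theory.
Import numFieldNormedType.Exports.

Local Open Scope classical_set_scope.
Local Open Scope ring_scope.

(** The weights that the argument wants to test against are not test functions: they have kinks at
    the edges, exponential tails, and a sharp cut-off to one period in x. No continuous
    representative, trace or density theorem is used instead. Kinks are handled by smooth functions
    converging pointwise together with their derivatives, under locally uniform bounds; tails by a
    dilated cut-off whose derivative tends to zero; the sharp x-strip by a Dynkin argument that
    turns the factor chi(x) of a product test function into an indicator. The slope comes from
    matching the flux a S' - 1_band = kappa exp(- dist / sqrt a): inside the band kappa = a slope -
    1, outside kappa = - sqrt a slope (fr - fl) / 2, and equating the two determines the slope. The
    equation has no zero-order term on the band, so the energy controls only the gradient there. A
    function with zero derivative that vanishes outside a bounded slab is shown to vanish by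
    multiplying it with y and with the ramps (y - p)^+, whose derivatives are 1 and the indicator of
    y > p. *)

Lemma scale_mulE (R : realType) (a b : R) : a *: b = a * b.
Proof. by []. Qed.

(** * Smooth functions of one variable and a smooth step *)

Section SmoothFunctions.
Context {R : realType}.
Implicit Types f g : R -> R.

(** A counted form of smoothness on the line, so that closure properties go by induction on [n];
    [test1P] links it to the iterated directional derivatives of [smooth]. *)
Fixpoint Cn (n : nat) f : Prop :=
  if n is n'.+1 then (forall x : R, derivable f x 1) /\ Cn n' (derive1 f) else True.

Definition Cinf f := forall n, Cn n f.

Lemma CnS n f g : (forall x : R, is_derive x 1 f (g x)) -> Cn n g -> Cn n.+1 f.
Proof.
move=> fg Cg; split=> [x|]; first exact: (@ex_derive _ _ _ _ _ _ _ (fg x)).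
suff -> : (derive1 f) = g by [].
by apply/funext => x; rewrite derive1E; exact: (@derive_val _ _ _ _ _ _ _ (fg x)).
Qed.

Lemma CnW n f : Cn n.+1 f -> Cn n f.
Proof.
elim: n f => [//|n IH] f [df Cf]; split => //; exact: IH.
Qed.

Lemma Cn_derive n f (x : R) : Cn n.+1 f -> is_derive x 1 f ((derive1 f) x).
Proof. by move=> [df _]; rewrite derive1E; exact: DeriveDef. Qed.

Lemma Cinf_derivable f (x : R) : Cinf f -> derivable f x 1.
Proof. by move=> /(_ 1%N)[]. Qed.

Lemma Cinf_is_derive f (x : R) : Cinf f -> is_derive x 1 f ((derive1 f) x).
Proof. by move=> /(_ 1%N) /Cn_derive; apply. Qed.

Lemma Cinf_derive1 f : Cinf f -> Cinf (derive1 f).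
Proof. by move=> Cf n; case: (Cf n.+1). Qed.

Lemma Cinf_continuous f : Cinf f -> continuous f.
Proof.
by move=> Cf x; apply/differentiable_continuous/derivable1_diffP/Cinf_derivable.
Qed.

Lemma Cn_cst n (c : R) : Cn n (cst c).
Proof.
elim: n c => [//|n IH] c; apply: (@CnS n (cst c) (cst 0)) => //.
Qed.

Lemma Cn_id n : Cn n (@id R).
Proof.
case: n => [//|n]; apply: (@CnS n id (cst 1)); last exact: Cn_cst.
Qed.

Lemma CnD n f g : Cn n f -> Cn n g -> Cn n (fun x => f x + g x).
Proof.
elim: n f g => [//|n IH] f g Cf Cg.
apply: (@CnS n _ (fun x => (derive1 f) x + (derive1 g) x)).
  move=> x; have := Cn_derive x Cf; have := Cn_derive x Cg.
  by move=> *; exact: is_deriveD.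
by apply: IH; [case: Cf|case: Cg].
Qed.

Lemma CnM n f g : Cn n f -> Cn n g -> Cn n (fun x => f x * g x).
Proof.
elim: n f g => [//|n IH] f g Cf Cg.
apply: (@CnS n _ (fun x => f x * (derive1 g) x + g x * (derive1 f) x)).
  move=> x; have := Cn_derive x Cf; have := Cn_derive x Cg.
  by move=> *; exact: is_deriveM.
by apply: CnD; apply: IH; [exact: CnW|case: Cg|exact: CnW|case: Cf].
Qed.

Lemma CnV n f : (forall x, f x != 0) -> Cn n f -> Cn n (fun x => (f x)^-1).
Proof.
move=> f0; elim: n => [//|n IH] Cf.
apply: (@CnS n _ (fun x => (-1 * (f x)^-1 * (f x)^-1) * (derive1 f) x)).
  move=> x; have := Cn_derive x Cf => df.
  by apply: (is_derive_eq (is_deriveV (f0 x) df)); rewrite -exprVn scale_mulE; ring.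
have CV : Cn n (fun x => (f x)^-1) by apply: IH; exact: CnW.
apply: CnM; last by case: Cf.
by apply: CnM => //; apply: CnM => //; exact: Cn_cst.
Qed.

Lemma Cn_comp n f g : Cn n f -> Cn n g -> Cn n (f \o g).
Proof.
elim: n f g => [//|n IH] f g Cf Cg.
apply: (@CnS n _ (fun x => (derive1 g) x * ((derive1 f) (g x)))).
  move=> x; have dg := Cn_derive x Cg; have df := Cn_derive (g x) Cf.
  by apply: (is_derive_eq (@is_derive1_comp R f g x _ _ df dg)); rewrite mulrC.
by apply: CnM; [case: Cg|apply: (IH (derive1 f)); [case: Cf|exact: CnW]].
Qed.

Lemma Cn_exp n : Cn n (@expR R).
Proof.
elim: n => [//|n IH]; apply: (@CnS n _ expR) => // x; exact: is_derive_expR.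
Qed.

Lemma Cinf_cst (c : R) : Cinf (cst c). Proof. by move=> n; exact: Cn_cst. Qed.
Lemma Cinf_id : Cinf (@id R). Proof. by move=> n; exact: Cn_id. Qed.
Lemma CinfD f g : Cinf f -> Cinf g -> Cinf (fun x => f x + g x).
Proof. by move=> Cf Cg n; exact: CnD. Qed.
Lemma CinfM f g : Cinf f -> Cinf g -> Cinf (fun x => f x * g x).
Proof. by move=> Cf Cg n; exact: CnM. Qed.
Lemma CinfV f : (forall x, f x != 0) -> Cinf f -> Cinf (fun x => (f x)^-1).
Proof. by move=> f0 Cf n; exact: CnV. Qed.
Lemma Cinf_comp f g : Cinf f -> Cinf g -> Cinf (f \o g).
Proof. by move=> Cf Cg n; exact: Cn_comp. Qed.
Lemma Cinf_exp : Cinf (@expR R). Proof. by move=> n; exact: Cn_exp. Qed.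
Lemma Cinf_affine (a b : R) : Cinf (fun x => a * x + b).
Proof.
apply: (@CinfD (fun x => a * x) (cst b)); last exact: Cinf_cst.
by apply: (@CinfM (cst a) id); [exact: Cinf_cst|exact: Cinf_id].
Qed.

Lemma Cinf_comp_affine f (a b : R) : Cinf f -> Cinf (fun x => f (a * x + b)).
Proof. by move=> Cf; apply: Cinf_comp => //; exact: Cinf_affine. Qed.

Lemma derive1M f g x : Cinf f -> Cinf g ->
  derive1 (fun x => f x * g x) x = f x * derive1 g x + g x * derive1 f x.
Proof.
move=> Cf Cg; rewrite derive1E; have := Cinf_is_derive x Cf; have := Cinf_is_derive x Cg.
by move=> dg df; rewrite (@derive_val _ _ _ _ _ _ _ (is_deriveM df dg)).
Qed.

Lemma derive1_comp_Cinf f g x : Cinf f -> Cinf g ->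
  derive1 (f \o g) x = derive1 f (g x) * derive1 g x.
Proof.
move=> Cf Cg; have df := Cinf_is_derive (g x) Cf; have dg := Cinf_is_derive x Cg.
by rewrite derive1E (@derive_val _ _ _ _ _ _ _ (is_derive1_comp df dg)).
Qed.

Lemma derive1_comp_affine f (a b x : R) : Cinf f ->
  derive1 (fun x => f (a * x + b)) x = a * derive1 f (a * x + b).
Proof.
move=> Cf; rewrite (@derive1_comp_Cinf f (fun x => a * x + b)) //; last exact: Cinf_affine.
rewrite mulrC; congr (_ * _).
have H : is_derive x 1 (fun x => a * x + b) (a *: 1 + 0).
  have Hx := is_derive_id x (1 : R).
  exact: (is_deriveD (is_deriveZ a Hx) (is_derive_cst b x 1)).
by rewrite derive1E (@derive_val _ _ _ _ _ _ _ H) addr0 scale_mulE mulr1.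
Qed.

Lemma near_cst_derive1 f (c x : R) : (\near x, f x = c) -> derive1 f x = 0.
Proof.
move=> fc; rewrite derive1E (@near_eq_derive R R R f (cst c) x 1 fc).
by rewrite derive_cst.
Qed.

Lemma flat_is_derive0 f (C : R) : f 0 = 0 -> (forall t, `|f t| <= C * t ^+ 2) ->
  is_derive (0 : R) (1 : R) f 0.
Proof.
move=> f0 fC.
have H : (fun h : R => h^-1 *: (f (h *: 1 + 0) - f 0)) @ 0^' --> (0 : R).
  apply/cvgrPdist_le => e e0; near=> h.
  rewrite sub0r normrN f0 subr0 !scale_mulE mulr1 addr0 normrM normfV.
  have h0 : 0 < `|h| by rewrite normr_gt0; near: h; exact: nbhs_dnbhs_neq.
  rewrite ler_pdivrMl//; apply: (le_trans (fC h)).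
  rewrite -real_normK ?num_real// expr2 mulrA [leRHS]mulrC ler_pM2r//.
  apply: (@le_trans _ _ ((`|C| + 1) * `|h|)).
    by rewrite ler_pM2r// (le_trans (ler_norm _))// lerDl.
  rewrite -ler_pdivlMl ?ltr_pwDr//.
  near: h; apply: dnbhs0_le; rewrite mulr_gt0// invr_gt0 ltr_pwDr//.
by apply: DeriveDef; [apply/cvg_ex; exists 0|exact/cvg_lim].
Unshelve. all: by end_near. Qed.

(** For [k = 0] this is the classical exp(-1/x), extended by zero. The powers of 1/x are carried
    because differentiating [flat k] produces [flat k.+2] and [flat k.+1], so smoothness is an
    induction over the whole family. *)
Definition flat (k : nat) (x : R) : R :=
  if 0 < x then x^-1 ^+ k * expR (- x^-1) else 0.

Lemma flat_ge0 k x : 0 <= flat k x.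
Proof.
rewrite /flat; case: ifPn => // x0; rewrite mulr_ge0 ?expR_ge0//.
by rewrite exprn_ge0// invr_ge0 ltW.
Qed.

(** With z = 1/x, the exponential series gives z^(k+2) <= (k+2)! exp z, and z^(k+2) x^2 = z^k. The
    factor x^2 is what makes the difference quotient at the origin tend to zero. *)
Lemma flat_le k x : `|flat k x| <= (k.+2)`!%:R * x ^+ 2.
Proof.
rewrite ger0_norm ?flat_ge0// /flat; case: ifPn => x0; last first.
  by rewrite mulr_ge0// sqr_ge0.
rewrite expRN ler_pdivrMr ?expR_gt0//.
have := @expR_ge1Dxn R x^-1 k.+1; rewrite invr_ge0 (ltW x0) => /(_ isT) H.
have {}H : x^-1 ^+ k.+2 <= (k.+2)`!%:R * expR x^-1.
  rewrite -ler_pdivrMl ?ltr0n ?fact_gt0// mulrC (le_trans _ H)//.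
  by rewrite lerDr ler01.
rewrite mulrAC; apply: le_trans (_ : x^-1 ^+ k.+2 * x ^+ 2 <= _); last first.
  by rewrite ler_wpM2r// sqr_ge0.
by rewrite -addn2 exprD -mulrA -exprMn mulVf ?gt_eqF// expr1n mulr1.
Qed.

Lemma is_derive_flat k (x : R) :
  is_derive x 1 (flat k) (flat k.+2 x - k%:R * flat k.+1 x).
Proof.
have [x0|x0|->] := ltrgt0P x.
- apply: (@near_eq_is_derive R R R (fun y => y^-1 ^+ k * expR (- y^-1))).
    by near=> y; rewrite /flat ifT//; near: y; exact: lt_nbhsr.
  have xn0 : x != 0 by rewrite gt_eqF.
  have dV : is_derive x 1 (fun y : R => y^-1) (- x^-2).
    by apply: (is_derive_eq (is_deriveV xn0 (is_derive_id x 1))); rewrite scale_mulE mulr1.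
  have dN : is_derive x 1 (fun y : R => - y^-1) (x^-2).
    by apply: (is_derive_eq (is_deriveN dV)); rewrite opprK.
  have := is_deriveX k dV; rewrite exprfctE => dX.
  have dE := @is_derive1_comp R expR (fun y => - y^-1) x _ _ (is_derive_expR (- x^-1)) dN.
  apply: (is_derive_eq (is_deriveM dX dE)).
  rewrite /flat x0 !scale_mulE /= -!exprVn; move: (x^-1) (expR _) => z e.
  case: k {dX} => [|k] /=; rewrite !exprS ?expr0; last by move: (k.+1%:R) => K; ring.
  by rewrite mulr0n; ring.
- apply: (@near_eq_is_derive R R R (cst 0)).
    near=> y; rewrite /flat ifF//; apply/negbTE; rewrite -leNgt ltW//.
    by near: y; exact: lt_nbhsl.
  by apply: is_derive_eq; rewrite /flat !ifF ?mulr0 ?subr0// ltNge (ltW x0).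
- have f0 : flat k 0 = 0 by rewrite /flat ltxx.
  by apply: (is_derive_eq (flat_is_derive0 f0 (flat_le k))); rewrite /flat ltxx mulr0 subr0.
Unshelve. all: by end_near. Qed.

Lemma Cinf_flat k : Cinf (flat k).
Proof.
move=> n; elim: n k => [//|n IH] k.
apply: (@CnS n _ (fun x => flat k.+2 x + (- k%:R) * flat k.+1 x)).
  by move=> x; apply: (is_derive_eq (is_derive_flat k x)); rewrite mulNr.
by apply: CnD => //; apply: (@CnM n (cst _)) => //; exact: Cn_cst.
Qed.

(** A smooth step, 0 for x <= 0 and 1 for x >= 1. The cut-offs and smoothed indicators used later
    are built from its affine rescalings. The denominator is positive because x or 1 - x is. *)
Definition sstep (x : R) : R := flat 0 x / (flat 0 x + flat 0 (- 1 * x + 1)).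

Lemma flat_gt0 k x : 0 < x -> 0 < flat k x.
Proof. by move=> x0; rewrite /flat x0 mulr_gt0 ?expR_gt0 ?exprn_gt0 ?invr_gt0. Qed.

Lemma flat0 k x : x <= 0 -> flat k x = 0.
Proof. by rewrite /flat leNgt => /negbTE ->. Qed.

Lemma sstep_den x : 0 < flat 0 x + flat 0 (- 1 * x + 1).
Proof.
have [x0|x0] := ltP 0 x; first by rewrite ltr_pwDl ?flat_gt0// flat_ge0.
by rewrite ltr_pwDr ?flat_ge0// flat_gt0//; lra.
Qed.

Lemma Cinf_sstep : Cinf sstep.
Proof.
have Cd : Cinf (fun x => flat 0 x + flat 0 (- 1 * x + 1)).
  apply: CinfD; first exact: Cinf_flat.
  exact/Cinf_comp_affine/Cinf_flat.
apply: CinfM; first exact: Cinf_flat.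
by apply: CinfV => // x; rewrite gt_eqF// sstep_den.
Qed.

Lemma sstep_ge0 x : 0 <= sstep x.
Proof. by rewrite divr_ge0 ?flat_ge0// ltW// sstep_den. Qed.

Lemma sstep_le1 x : sstep x <= 1.
Proof. by rewrite ler_pdivrMr ?sstep_den// mul1r lerDl flat_ge0. Qed.

Lemma sstep0 x : x <= 0 -> sstep x = 0.
Proof. by move=> x0; rewrite /sstep flat0// mul0r. Qed.

Lemma sstep1 x : 1 <= x -> sstep x = 1.
Proof.
move=> x1; rewrite /sstep (@flat0 _ (- 1 * x + 1)) ?addr0 ?divff//; last lra.
by rewrite gt_eqF// flat_gt0//; lra.
Qed.

Lemma derive_sstep0 x : x < 0 -> derive1 sstep x = 0.
Proof.
move=> x0; apply: (@near_cst_derive1 _ 0); near=> y; apply: sstep0.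
by rewrite ltW//; near: y; exact: lt_nbhsl.
Unshelve. all: by end_near. Qed.

Lemma derive_sstep1 x : 1 < x -> derive1 sstep x = 0.
Proof.
move=> x0; apply: (@near_cst_derive1 _ 1); near=> y; apply: sstep1.
by rewrite ltW//; near: y; exact: lt_nbhsr.
Unshelve. all: by end_near. Qed.

Lemma Cinf_bounded f (a b : R) : Cinf f ->
  exists C, forall x, a <= x <= b -> `|f x| <= C.
Proof.
move=> Cf; have [ab|ba] := leP a b; last first.
  by exists 0 => x /andP[ax xb]; have := lt_le_trans ba (le_trans ax xb); rewrite ltxx.
have cf : {within `[a, b], continuous (fun x => `|f x|)}.
  apply: continuous_subspaceT => x.
  by apply: (@continuous_comp _ _ _ f (fun y => `|y|)); [exact: Cinf_continuous|exact: norm_continuous].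
have [c _ H] := EVT_max ab cf.
by exists `|f c| => x xab; apply: H; rewrite in_itv.
Qed.

Lemma derive_sstep_bounded : exists C, forall x, `|derive1 sstep x| <= C.
Proof.
have [C HC] := @Cinf_bounded _ 0 1 (Cinf_derive1 Cinf_sstep).
have C0 : 0 <= C by apply: le_trans (HC 0 _); rewrite // lexx ler01.
exists C => x; have [x0|x0] := ltP x 0; first by rewrite derive_sstep0// normr0.
have [x1|x1] := ltP 1 x; first by rewrite derive_sstep1// normr0.
by rewrite HC// x0.
Qed.

End SmoothFunctions.

(** * Test functions on the line and on the plane *)

Section TestFunctions.
Context {R : realType}.
Implicit Types f g phi chi : R -> R.

(** On the line ['D_v h] is [v] times the ordinary derivative, so folding directional derivatives
    never leaves [Cinf]. *)
Lemma smooth_of_Cinf f : Cinf f -> smooth f.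
Proof.
move=> Cf vs p; apply/derivable1_diffP/Cinf_derivable.
elim: vs => [//|v vs IH] /=.
set h := foldr _ _ _ in IH *.
suff -> : 'D_v h = (fun x => v * derive1 h x).
  by apply: (@CinfM _ (cst v)); [exact: Cinf_cst|exact: Cinf_derive1].
apply/funext => x.
have dh : differentiable h x by apply/derivable1_diffP/Cinf_derivable.
by rewrite deriveE // derive1E' // -[in LHS](mulr1 v) -[v * 1]scale_mulE linearZ.
Qed.

Lemma smoothD (V : normedModType R) (phi : V -> R) v : smooth phi -> smooth ('D_v phi).
Proof. by move=> sphi vs p; have := sphi (rcons vs v) p; rewrite foldr_rcons. Qed.

Lemma Cinf_of_smooth f : smooth f -> Cinf f.
Proof.
move=> sf n; elim: n f sf => [//|n IH] f sf; split.
  by move=> x; apply/derivable1_diffP; exact: (sf [::] x).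
have -> : derive1 f = 'D_1 f by apply/funext => x; rewrite derive1E.
exact/IH/smoothD.
Qed.

(** The working form of [test_function] on the line: compact support becomes vanishing beyond some
    radius, which is easier to produce and to use. *)
Definition test1 phi := Cinf phi /\ exists M : R, forall x, M <= `|x| -> phi x = 0.

Lemma closed_ball_compact (M : R) : compact [set x : R | `|x| <= M].
Proof.
have -> : [set x : R | `|x| <= M] = `[- M, M]%classic.
  by apply/seteqP; split=> x /=; rewrite in_itv/= ler_norml.
exact: segment_compact.
Qed.

Lemma compact_support_bounded (V : normedModType R) (phi : V -> R) :
  compact (closure [set p | phi p != 0]) ->
  exists M : R, forall p, M <= `|p| -> phi p = 0.
Proof.
move=> /compact_bounded[M [_ HM]].
exists (`|M| + 2) => p pM; apply/eqP; apply: contraPT pM => phi0.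
apply/negP; rewrite -ltNge.
have := HM (`|M| + 1) _ p (@subset_closure _ [set p | phi p != 0] p phi0).
rewrite (le_lt_trans (ler_norm _)) ?ltrDl// => /(_ isT) H.
by rewrite (le_lt_trans H)// ltrD2l ltr1n.
Qed.

Lemma test1P phi : test_function phi <-> test1 phi.
Proof.
split=> [[sphi /compact_support_bounded]|[Cphi [M HM]]].
  by split=> //; exact: Cinf_of_smooth.
split; first exact: smooth_of_Cinf.
apply: (subclosed_compact _ (@closed_ball_compact M)); first exact: closed_closure.
rewrite [X in _ `<=` X](iffLR (closure_id _)).
  apply: closureS => x /= phi0; rewrite leNgt; apply: contra phi0 => Mx.
  by apply/eqP/HM/ltW.
by apply: compact_closed => //; exact: closed_ball_compact.
Qed.

Lemma test1_derive phi : test1 phi -> test1 (derive1 phi).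
Proof.
move=> [Cphi [M HM]]; split; first exact: Cinf_derive1.
exists (M + 1) => x Mx; apply: (@near_cst_derive1 _ _ 0).
have Mx' : M < `|x| by lra.
near=> y; apply: HM; rewrite ltW//; near: y.
exact: (cvgr_gt _ (@norm_continuous _ _ x)).
Unshelve. all: by end_near. Qed.

Lemma test1_bounded phi : test1 phi -> exists C, forall x, `|phi x| <= C.
Proof.
move=> [Cphi [M HM]]; have [C HC] := Cinf_bounded (- M) M Cphi.
exists `|C| => x; have [xM|/ltW xM] := leP M `|x|; first by rewrite HM// normr0.
by rewrite (le_trans (HC _ _)) ?ler_norm// -ler_norml.
Qed.

Lemma test1M f phi : Cinf f -> test1 phi -> test1 (fun x => f x * phi x).
Proof.
move=> Cf [Cphi [M HM]]; split; first exact: CinfM.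
by exists M => x Mx; rewrite HM// mulr0.
Qed.

(** Products alone are not stable under directional derivatives, since the Leibniz rule yields a
    sum. Closing under sums and scalars makes the smoothness of a product an induction on the list
    of directions. *)
Inductive tensor : (R * R -> R) -> Prop :=
| Tensor f g : Cinf f -> Cinf g -> tensor (fun p => f p.1 * g p.2)
| TensorD u v : tensor u -> tensor v -> tensor (fun p => u p + v p)
| TensorZ (c : R) u : tensor u -> tensor (fun p => c * u p).

Lemma differentiable_fst (p : R * R) : differentiable (fst : R * R -> R) p.
Proof. by apply: linear_differentiable => x; exact: cvg_fst. Qed.

Lemma differentiable_snd (p : R * R) : differentiable (snd : R * R -> R) p.
Proof. by apply: linear_differentiable => x; exact: cvg_snd. Qed.

Lemma differentiable_tens f g (p : R * R) : Cinf f -> Cinf g ->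
  differentiable (fun p : R * R => f p.1 * g p.2) p.
Proof.
move=> Cf Cg; apply: (@differentiableM _ _ (f \o fst) (g \o snd)).
  apply: differentiable_comp; first exact: differentiable_fst.
  exact/derivable1_diffP/Cinf_derivable.
apply: differentiable_comp; first exact: differentiable_snd.
exact/derivable1_diffP/Cinf_derivable.
Qed.

Lemma is_derive_fst f (v p : R * R) : Cinf f ->
  is_derive p v (fun p : R * R => f p.1) (derive1 f p.1 * v.1).
Proof.
move=> Cf.
have df : differentiable f p.1 by exact/derivable1_diffP/Cinf_derivable.
have d1 := differentiable_fst p.
have dc : differentiable (f \o fst) p by exact: differentiable_comp.
apply: DeriveDef; first exact: diff_derivable.
rewrite (@deriveE _ _ _ (f \o fst)) // diff_comp // /= diff1E //.
rewrite [X in X *: _](_ : _ = v.1) ?scale_mulE 1?mulrC //.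
by rewrite diff_lin // => x; exact: cvg_fst.
Qed.

Lemma is_derive_snd f (v p : R * R) : Cinf f ->
  is_derive p v (fun p : R * R => f p.2) (derive1 f p.2 * v.2).
Proof.
move=> Cf.
have df : differentiable f p.2 by exact/derivable1_diffP/Cinf_derivable.
have d1 := differentiable_snd p.
have dc : differentiable (f \o snd) p by exact: differentiable_comp.
apply: DeriveDef; first exact: diff_derivable.
rewrite (@deriveE _ _ _ (f \o snd)) // diff_comp // /= diff1E //.
rewrite [X in X *: _](_ : _ = v.2) ?scale_mulE 1?mulrC //.
by rewrite diff_lin // => x; exact: cvg_snd.
Qed.

Lemma derive_tens f g (v : R * R) : Cinf f -> Cinf g ->
  'D_v (fun p : R * R => f p.1 * g p.2) =
  (fun p => v.1 * (derive1 f p.1 * g p.2) + v.2 * (f p.1 * derive1 g p.2)).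
Proof.
move=> Cf Cg; apply/funext => p.
have := is_deriveM (is_derive_fst v p Cf) (is_derive_snd v p Cg) => H.
rewrite (@derive_val _ _ _ _ _ _ _ H) !scale_mulE; ring.
Qed.

Lemma derive_tensE f g (v p : R * R) : Cinf f -> Cinf g ->
  'D_v (fun p : R * R => f p.1 * g p.2) p =
  v.1 * (derive1 f p.1 * g p.2) + v.2 * (f p.1 * derive1 g p.2).
Proof. by move=> Cf Cg; rewrite -[LHS]/(('D_v _) p) derive_tens. Qed.

Lemma tensor_smooth u : tensor u -> smooth u.
Proof.
have tensor_diff w p : tensor w -> differentiable w p.
  elim=> [f g Cf Cg|w1 w2 _ d1 _ d2|c w' _ d].
  - exact: differentiable_tens.
  - exact: (differentiableD d1 d2).
  - exact: (differentiableZ c d).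
move=> tu vs p; apply: (tensor_diff _ _); elim: vs => [//|v vs /=].
elim=> [f g Cf Cg|w1 w2 t1 d1 t2 d2|c w' t d].
- rewrite derive_tens//; apply: TensorD; apply: TensorZ; apply: Tensor => //.
    exact: Cinf_derive1.
  exact: Cinf_derive1.
- rewrite (_ : 'D_v _ = fun p => 'D_v w1 p + 'D_v w2 p); first exact: TensorD.
  by apply/funext => q; apply: deriveD; apply: diff_derivable; exact: (tensor_diff _ _).
- rewrite (_ : 'D_v _ = fun p => c * 'D_v w' p); first exact: TensorZ.
  by apply/funext => q; apply: deriveZ; apply: diff_derivable; exact: (tensor_diff _ _).
Qed.

Lemma test_tens chi phi : test1 chi -> test1 phi ->
  test_function (fun p : R * R => chi p.1 * phi p.2).
Proof.
move=> [Cc [M HM]] [Cp [N HN]]; split; first exact/tensor_smooth/Tensor.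
have cK : compact ([set x : R | `|x| <= M] `*` [set x : R | `|x| <= N]).
  by apply: compact_setX; exact: closed_ball_compact.
apply: (subclosed_compact _ cK); first exact: closed_closure.
rewrite [X in _ `<=` X](iffLR (closure_id _)).
  apply: closureS => -[x y] /=; rewrite mulf_eq0 negb_or => /andP[c0 p0].
  split; rewrite /= leNgt.
    by apply: contra c0 => Mx; apply/eqP/HM/ltW.
  by apply: contra p0 => Mx; apply/eqP/HN/ltW.
by apply: compact_closed => //; exact: norm_hausdorff.
Qed.

Variable psi : R * R -> R.
Hypothesis tpsi : test_function psi.

Lemma test_support : exists M : R,
  forall p, M <= `|p.1| \/ M <= `|p.2| -> psi p = 0.
Proof.
have [M HM] := compact_support_bounded tpsi.2; exists M => p Mp; apply: HM.
by rewrite prod_normE le_max; apply/orP.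
Qed.

(** The weak formulation on the plane quantifies over arbitrary test functions, not only products;
    to treat them by Fubini, slices must be test functions on the line. Moving along [dir_y] keeps x
    fixed, so the two difference quotients coincide. *)
Lemma test_slice_y x : test1 (fun y => psi (x, y)) /\
  derive1 (fun y => psi (x, y)) = (fun y => 'D_dir_y psi (x, y)).
Proof.
have dE (phi : R * R -> R) y :
    (fun h : R => h^-1 *: ((fun y => phi (x, y)) (h *: 1 + y) - phi (x, y))) =
    (fun h : R => h^-1 *: (phi (h *: dir_y + (x, y)) - phi (x, y))).
  apply/funext => h; congr (_ *: (phi _ - _)).
  by rewrite -[h *: dir_y + _]/(h * 0 + x, h * 1 + y) mulr0 add0r.
have D (phi : R * R -> R) : derive1 (fun y => phi (x, y)) = (fun y => 'D_dir_y phi (x, y)).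
  apply/funext => y; rewrite derive1E /derive.
  by rewrite -[X in lim (X @ _) = _]/(fun h : R => h^-1 *: ((fun y => phi (x, y)) (h *: 1 + y) - phi (x, y))) dE.
split; last exact: D.
split; last first.
  by have [M HM] := test_support; exists M => y My; apply: HM; right.
have := tpsi.1; move: (psi) => phi + n; elim: n phi => [//|n IH] phi sphi.
split; last by rewrite D; exact: (IH _ (smoothD dir_y sphi)).
move=> y; have := diff_derivable (v := dir_y) (sphi [::] (x, y)).
by rewrite /derivable /= -dE.
Qed.

Lemma test_slice_x y : test1 (fun x => psi (x, y)) /\
  derive1 (fun x => psi (x, y)) = (fun x => 'D_dir_x psi (x, y)).
Proof.
have dE (phi : R * R -> R) x :
    (fun h : R => h^-1 *: ((fun x => phi (x, y)) (h *: 1 + x) - phi (x, y))) =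
    (fun h : R => h^-1 *: (phi (h *: dir_x + (x, y)) - phi (x, y))).
  apply/funext => h; congr (_ *: (phi _ - _)).
  by rewrite -[h *: dir_x + _]/(h * 1 + x, h * 0 + y) mulr0 add0r.
have D (phi : R * R -> R) : derive1 (fun x => phi (x, y)) = (fun x => 'D_dir_x phi (x, y)).
  apply/funext => x; rewrite derive1E /derive.
  by rewrite -[X in lim (X @ _) = _]/(fun h : R => h^-1 *: ((fun x => phi (x, y)) (h *: 1 + x) - phi (x, y))) dE.
split; last exact: D.
split; last first.
  by have [M HM] := test_support; exists M => x My; apply: HM; left.
have := tpsi.1; move: (psi) => phi + n; elim: n phi => [//|n IH] phi sphi.
split; last by rewrite D; exact: (IH _ (smoothD dir_x sphi)).
move=> x; have := diff_derivable (v := dir_x) (sphi [::] (x, y)).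
by rewrite /derivable /= -dE.
Qed.

(** Off the closed support, [psi] is zero on a neighbourhood, hence so is its directional derivative
    at that point: the support can only shrink. *)
Lemma test_deriveD v : test_function ('D_v psi).
Proof.
split; first exact: smoothD tpsi.1.
apply: (subclosed_compact _ tpsi.2); first exact: closed_closure.
rewrite [X in _ `<=` X](iffLR (closure_id _)); last exact: closed_closure.
apply: closureS => p /= Dp; apply: contrapT => np.
have : \near p, psi p = cst 0 p.
  have : nbhs p (~` closure [set p | psi p != 0]).
    by apply: open_nbhs_nbhs; split=> //; exact/closed_openC/closed_closure.
  apply: filterS => q nq; apply/eqP; apply: contra_notT nq => q0.
  exact: (@subset_closure _ [set p | psi p != 0]).
by move=> /near_eq_derive H; move: Dp; rewrite H derive_cst eqxx.
Qed.

Lemma test_continuous : continuous psi.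
Proof. by move=> p; apply: differentiable_continuous; exact: (tpsi.1 [::] p). Qed.

Lemma test_bounded : exists C, forall p, `|psi p| <= C.
Proof.
have [M HM] := test_support.
have cK : compact ([set x : R | `|x| <= M] `*` [set x : R | `|x| <= M]).
  by apply: compact_setX; exact: closed_ball_compact.
have /compact_bounded[C [_ HC]] := continuous_compact (continuous_subspaceT test_continuous) cK.
exists (`|C| + 1) => p.
have C1 : C < `|C| + 1 by rewrite (le_lt_trans (ler_norm _)) ?ltrDl.
have [p1|p1] := leP M `|p.1|; first by rewrite HM ?normr0 ?addr_ge0//; left.
have [p2|p2] := leP M `|p.2|; first by rewrite HM ?normr0 ?addr_ge0//; right.
by apply: (HC _ C1); exists p => //; split=> /=; exact: ltW.
Qed.

End TestFunctions.

(** * Integration tools: domination, limits, a Dynkin argument *)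

Section IntegralTools.
Context d (T : measurableType d) (R : realType) (mu : {measure set T -> \bar R}).
Implicit Types f g u w : T -> R.

Lemma Rintegral_indic (A : set T) f :
  \int[mu]_(t in A) f t = \int[mu]_t (f t * \1_A t).
Proof. by rewrite Rintegral_mkcond patch_indic. Qed.

Lemma integrable_bound f g : measurable_fun setT f ->
  mu.-integrable setT (EFin \o g) -> (forall t, `|f t| <= `|g t|) ->
  mu.-integrable setT (EFin \o f).
Proof.
move=> mf ig fg; apply: le_integrable ig => //; first exact/measurable_EFinP.
by move=> t _ /=; rewrite lee_fin.
Qed.

Lemma integrable_scale (c : R) f : mu.-integrable setT (EFin \o f) ->
  mu.-integrable setT (EFin \o (fun t => c * f t)).
Proof.
by move=> fi; apply: eq_integrable (integrableZl measurableT c fi).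
Qed.

Lemma integrable_mul_bounded f w : measurable_fun setT w ->
  (exists C, forall t, `|w t| <= C) ->
  mu.-integrable setT (EFin \o f) ->
  mu.-integrable setT (EFin \o (fun t => f t * w t)).
Proof.
move=> mw [C HC] fi.
apply: (@integrable_bound _ (fun t => C * f t)); last 2 first.
- exact: integrable_scale.
- move=> t; rewrite !normrM mulrC ler_wpM2r//.
  by rewrite (le_trans (HC t))// ler_norm.
- apply: measurable_funM => //; apply/measurable_EFinP.
  exact: measurable_int fi.
Qed.

Lemma integrable_indic_mul f (A : set T) : measurable A ->
  mu.-integrable setT (EFin \o f) ->
  mu.-integrable setT (EFin \o (fun t => f t * \1_A t)).
Proof.
move=> mA; apply: integrable_mul_bounded; first exact: measurable_indic.
by exists 1 => t; rewrite indicE; case: (_ \in _); rewrite ?normr1 ?normr0.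
Qed.

Lemma Rintegral_dominated (f_ : nat -> T -> R) f g :
  (forall n, measurable_fun setT (f_ n)) ->
  (forall t, f_ ^~ t @ \oo --> f t) ->
  mu.-integrable setT (EFin \o g) ->
  (forall n t, `|f_ n t| <= g t) ->
  (fun n => \int[mu]_t f_ n t) @ \oo --> \int[mu]_t f t.
Proof.
move=> mf_ f_f ig fg.
have mf : measurable_fun setT f by apply: measurable_fun_cvg mf_ _ => t _; exact: f_f.
have [|||||fi _ H] := @dominated_convergence _ T R mu setT measurableT
   (fun n => EFin \o f_ n) (EFin \o f) (EFin \o g).
- by move=> n; exact/measurable_EFinP.
- exact/measurable_EFinP.
- by apply: aeW => t _; apply/cvg_EFin; [exact: nearW|exact: f_f].
- exact: ig.
- by apply: aeW => t n _ /=; rewrite lee_fin.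
apply/fine_cvg; rewrite /= fineK; last exact: integrable_fin_num.
exact: H.
Qed.

(** The shape of the limit arguments below: an identity known for smooth weights, written as an
    integral equal to zero, passes to a dominated pointwise limit. *)
Lemma Rintegral_lim0 (f_ : nat -> T -> R) f g :
  (forall n, measurable_fun setT (f_ n)) ->
  (forall t, f_ ^~ t @ \oo --> f t) ->
  mu.-integrable setT (EFin \o g) ->
  (forall n t, `|f_ n t| <= g t) ->
  (forall n, \int[mu]_t f_ n t = 0) -> \int[mu]_t f t = 0.
Proof.
move=> mf_ f_f ig fg I0; have := Rintegral_dominated mf_ f_f ig fg.
rewrite (_ : (fun n => _) = cst 0); last by apply/funext => n; exact: I0.
by move/cvg_lim => <- //; rewrite lim_cst.
Qed.

Lemma ae_eq_Rintegral f g : measurable_fun setT f -> measurable_fun setT g ->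
  ae_eq mu setT f g -> \int[mu]_t f t = \int[mu]_t g t.
Proof.
move=> mf mg fg; rewrite /Rintegral; congr fine; apply: ae_eq_integral => //.
- exact/measurable_EFinP.
- exact/measurable_EFinP.
- by apply: filterS fg => t /= H _; rewrite H.
Qed.

Lemma Rintegral_indicU f (A : set T) : measurable A ->
  mu.-integrable setT (EFin \o f) ->
  \int[mu]_t f t = \int[mu]_t (f t * \1_A t) + \int[mu]_t (f t * \1_(~` A) t).
Proof.
move=> mA fi; rewrite -RintegralD//; last 2 first.
- exact: integrable_indic_mul.
- by apply: integrable_indic_mul => //; exact: measurableC.
apply: eq_Rintegral => t _; rewrite -mulrDr !indicE.
by rewrite in_setC; case: (_ \in _); rewrite ?addr0 ?add0r mulr1.
Qed.

End IntegralTools.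

Section Dynkin.
Context d (T : measurableType d) (R : realType) (mu : {measure set T -> \bar R}).
Context d' (T' : measurableType d').

(** The sets [A] with zero integral form a lambda-system. The zero total integral supplies the whole
    space, which [G] need not contain; the map [h] lets the same statement serve a coordinate and
    the identity. *)
Lemma integral_dynkin (G : set (set T')) (h : T -> T') (f : T -> R) :
  measurable = <<s G >> -> setI_closed G ->
  measurable_fun setT h -> mu.-integrable setT (EFin \o f) ->
  \int[mu]_t f t = 0 ->
  (forall A, G A -> \int[mu]_t (f t * \1_A (h t)) = 0) ->
  forall A, measurable A -> \int[mu]_t (f t * \1_A (h t)) = 0.
Proof.
move=> GE GI mh fi f0 fG.
have hE A : (fun t => f t * \1_A (h t)) = (fun t => f t * \1_(h @^-1` A) t).
  by apply/funext => t; rewrite !indicE; congr (_ * (_ : bool)%:R); apply/idP/idP; rewrite !inE.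
have mhA A : measurable A -> measurable (h @^-1` A).
  by move=> mA; rewrite -[X in measurable X]setTI; exact: mh.
move=> A mA; have : <<s G >> A by rewrite -GE.
move: A {mA}; apply: (dynkin_induction GE GI) => //.
- rewrite -[RHS]f0; apply: eq_Rintegral => t _.
  by rewrite indicE in_setT mulr1.
- move=> S mS; rewrite !hE => fS; have := Rintegral_indicU (mhA _ mS) fi.
  by rewrite f0 fS add0r preimage_setC.
- move=> F mF tF FP; rewrite hE -Rintegral_indic /Rintegral preimage_bigcup.
  (* Countable additivity is taken in the extended reals. Each piece is finite because [f] is
     integrable, so a zero real part does mean a zero integral. *)
  rewrite integral_bigcup//.
  + rewrite eseries0// => k _ _.
    have := FP k; rewrite hE -Rintegral_indic /Rintegral => H.
    rewrite -[LHS]fineK ?H//; apply: integrable_fin_num; first exact: mhA.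
    by apply: integrableS fi => //; exact: mhA.
  + by move=> i j _ _ [t [/= Fi Fj]]; apply: tF => //; exists (h t).
  + by move=> k; exact: mhA.
  + apply: integrableS fi => //; apply: bigcupT_measurable => k; exact: mhA.
Qed.

End Dynkin.

(** * Functions integrable on slabs, and the du Bois-Reymond lemma along a coordinate *)

Section Slabs.
Context d (T : measurableType d) (R : realType) (mu : {measure set T -> \bar R}).
Variable y : T -> R.
Hypothesis my : measurable_fun setT y.
Implicit Types u w g : T -> R.

(** Integrability is asked only where the coordinate [y] is bounded: for [y] the identity this is
    local integrability, and for a projection of the plane it fits functions already cut off in the
    other variable. *)
Definition slab_integrable u := measurable_fun setT u /\
  forall M : R, mu.-integrable setT (EFin \o (fun t => u t * \1_[set z | `|z| <= M] (y t))).

Lemma measurable_comp1 (F : R -> R) : measurable_fun setT F ->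
  measurable_fun setT (fun t => F (y t)).
Proof. by move=> mF; apply: measurableT_comp. Qed.

Lemma Cinf_measurable (F : R -> R) : Cinf F -> measurable_fun setT F.
Proof. by move=> CF; apply: continuous_measurable_fun; exact: Cinf_continuous. Qed.

Lemma slab_mul u w : slab_integrable u -> measurable_fun setT w ->
  (exists C, forall t, `|w t| <= C) ->
  (exists M, forall t, M <= `|y t| -> w t = 0) ->
  mu.-integrable setT (EFin \o (fun t => u t * w t)).
Proof.
move=> [mu_ iu] mw wC [M HM].
have := integrable_mul_bounded mw wC (iu M); apply: eq_integrable => // t _ /=.
congr EFin; rewrite indicE; have [ty|ty] := leP `|y t| M.
  by rewrite mem_set// mulr1.
by rewrite HM ?mulr0//; exact: ltW.
Qed.

Lemma slab_mul_test u (phi : R -> R) : slab_integrable u -> test1 phi ->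
  mu.-integrable setT (EFin \o (fun t => u t * phi (y t))).
Proof.
move=> su tphi; apply: slab_mul => //.
- by apply: measurable_comp1; apply: Cinf_measurable; case: tphi.
- by have [C HC] := test1_bounded tphi; exists C.
- by case: tphi => _ [M HM]; exists M => t; exact: HM.
Qed.

(** The step is still 0 at the origin, so the limit is the indicator of the open half-line. *)
Lemma sstep_cvg (x : R) : (fun n : nat => sstep (n%:R * x)) @ \oo --> (\1_`]0, +oo[%classic x : R).
Proof.
rewrite indicE; have [x0|x0] := ltP 0 x.
  rewrite mem_set /= ?in_itv/= ?andbT//; apply: cvg_near_cst; near=> n.
  apply: sstep1; rewrite -ler_pdivrMr// div1r; near: n; exact: nbhs_infty_ger.
rewrite memNset /= ?in_itv/= ?andbT; last by apply/negP; rewrite -leNgt.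
by apply: cvg_near_cst; apply: nearW => n; apply: sstep0; rewrite mulr_ge0_le0.
Unshelve. all: by end_near. Qed.

(** A rising step at [a] times a falling step at [b], tending to the indicator of the open interval.
    The affine form of the arguments is the one that [Cinf_comp_affine] accepts. *)
Definition window (a b : R) (n : nat) (x : R) :=
  sstep (n%:R * x + - (n%:R * a)) * sstep (- n%:R * x + n%:R * b).

Lemma windowE a b n x : window a b n x = sstep (n%:R * (x - a)) * sstep (n%:R * (b - x)).
Proof. by rewrite /window; congr (sstep _ * sstep _); ring. Qed.

Lemma window_support a b n x : `|a| + `|b| <= `|x| -> window a b n.+1 x = 0.
Proof.
move=> Hx; rewrite windowE.
have [xa|xa] := leP x a.
  by rewrite sstep0 ?mul0r// mulr_ge0_le0// subr_le0.
rewrite [X in _ * X]sstep0 ?mulr0// mulr_ge0_le0// subr_le0 leNgt; apply/negP => xb.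
move: Hx; rewrite leNgt => /negP; apply; rewrite ltr_norml.
have := ler_norm b; have := ler_norm (- a); have := normr_ge0 a; have := normr_ge0 b.
by rewrite normrN => *; apply/andP; split; lra.
Qed.

Lemma window_test a b n : test1 (window a b n.+1).
Proof.
split; last by exists (`|a| + `|b|) => x; exact: window_support.
by apply: CinfM; apply: Cinf_comp_affine; exact: Cinf_sstep.
Qed.

Lemma window_ge0 a b n x : 0 <= window a b n x.
Proof. by rewrite mulr_ge0// sstep_ge0. Qed.

Lemma window_le1 a b n x : window a b n x <= 1.
Proof. by rewrite mulr_ile1 ?sstep_ge0 ?sstep_le1. Qed.

Lemma window_cvg a b x : window a b ^~ x @ \oo --> (\1_(`]a, b[%classic) x : R).
Proof.
have -> : \1_(`]a, b[%classic) x = \1_(`]0, +oo[%classic) (x - a) * \1_(`]0, +oo[%classic) (b - x) :> R.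
  rewrite !indicE /= -natrM mulnb; congr ((_ : bool)%:R).
  by apply/idP/andP; rewrite !inE /= !in_itv/= !andbT !subr_gt0 => /andP.
rewrite (_ : window a b ^~ x = fun n => sstep (n%:R * (x - a)) * sstep (n%:R * (b - x))).
  by apply: cvgM; exact: sstep_cvg.
by apply/funext => n; exact: windowE.
Qed.

(** Windows replace test functions by indicators of open intervals, and the Dynkin argument reaches
    all bounded Borel sets. *)
Lemma slab_dubois_reymond u : slab_integrable u ->
  (forall phi, test1 phi -> \int[mu]_t (u t * phi (y t)) = 0) ->
  forall B : set R, measurable B -> (exists M, B `<=` `]-M, M[%classic) ->
  \int[mu]_t (u t * \1_B (y t)) = 0.
Proof.
move=> su u0 B mB [M BM].
have itv0 a b : \int[mu]_t (u t * \1_(`]a, b[%classic) (y t)) = 0.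
  pose K := `|a| + `|b|.
  apply: (@Rintegral_lim0 _ _ _ mu (fun n t => u t * window a b n.+1 (y t)) _
    (fun t => `|u t * \1_[set z | `|z| <= K] (y t)|)).
  - move=> n; apply: measurable_funM; first exact: su.1.
    by apply: measurable_comp1; apply: Cinf_measurable; case: (window_test a b n).
  - move=> t; apply: cvgM; first exact: cvg_cst.
    by have := window_cvg (a := a) (b := b) (x := y t); rewrite -cvg_shiftS.
  - exact: integrable_norm (su.2 K).
  - move=> n t; rewrite normrM [leRHS]normrM indicE; have [tK|/ltW tK] := leP `|y t| K.
      rewrite mem_set// normr1 ler_wpM2l// ger0_norm ?window_ge0//.
      exact: window_le1.
    by rewrite window_support// normr0 mulr0 mulr_ge0.
  - by move=> n; apply: u0; exact: window_test.
(* [u] itself need not be integrable over the whole space; truncating to a slab that contains the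
   range of interest makes the Dynkin argument applicable and changes nothing against [B]. *)
pose f t := u t * \1_(`]-M, M[%classic) (y t).
have fi : mu.-integrable setT (EFin \o f).
  apply: slab_mul => //.
  - by apply: measurable_comp1; exact: measurable_indic.
  - by exists 1 => t; rewrite indicE; case: (_ \in _); rewrite ?normr1 ?normr0.
  - exists M => t; rewrite indicE; case: (boolP (_ \in _)) => //.
    by rewrite inE /= in_itv/= -ltr_norml ltNge => /negbTE ->.
have -> : (fun t => u t * \1_B (y t)) = (fun t => f t * \1_B (y t)).
  apply/funext => t; rewrite /f -mulrA !indicE; case: (boolP (y t \in B)) => yB.
    by rewrite mem_set ?mulr1//; apply: BM; exact: set_mem.
  by rewrite !mulr0.
have GE : @measurable _ R = <<s @RGenOInfty.G R >> by exact: RGenOInfty.measurableE.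
apply: (integral_dynkin GE) => //.
- move=> _ _ [a ->] [b ->]; exists (Num.max a b).
  by apply/seteqP; split => x /=; rewrite !in_itv/= !andbT gt_max => /andP.
- exact: itv0.
(* A half-line meets the truncating interval in the open interval from [Num.max a (- M)] to [M],
   which was treated above. *)
- move=> _ [a ->]; rewrite -(itv0 (Num.max a (- M)) M).
  apply: eq_Rintegral => t _; rewrite /f -mulrA; congr (_ * _).
  rewrite !indicE -natrM mulnb; congr ((_ : bool)%:R).
  apply/andP/idP; rewrite !inE /= !in_itv/= !andbT gt_max.
    by move=> [/andP[-> ->] ->].
  by move=> /andP[/andP[-> ->] ->].
Qed.

End Slabs.

(** * Weights with kinks as limits of smooth functions *)

Section Approximation.
Context {R : realType}.
Implicit Types F G f g : R -> R.

(* [F] is a limit of smooth functions whose derivatives converge to [f], with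
   bounds that allow dominated convergence on bounded sets; it is the class of
   weights by which the identities below can be multiplied. *)
Definition approximable F f := exists F_ : nat -> R -> R,
  [/\ forall n, Cinf (F_ n),
      forall x, F_ ^~ x @ \oo --> F x,
      forall x, (fun n => derive1 (F_ n) x) @ \oo --> f x &
      forall M, exists C, forall n x, `|x| <= M ->
        `|F_ n x| <= C /\ `|derive1 (F_ n) x| <= C].

Lemma approximable_Cinf F : Cinf F -> approximable F (derive1 F).
Proof.
move=> CF; exists (fun=> F); split=> //; try by move=> x; exact: cvg_cst.
move=> M; have [C1 H1] := Cinf_bounded (- M) M CF.
have [C2 H2] := Cinf_bounded (- M) M (Cinf_derive1 CF).
exists (Num.max C1 C2) => n x; rewrite ler_norml => xM.
by split; rewrite le_max (H1, H2) ?orbT.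
Qed.

Lemma approximableD F f G g : approximable F f -> approximable G g ->
  approximable (fun x => F x + G x) (fun x => f x + g x).
Proof.
move=> [F_ [CF FF Ff FM]] [G_ [CG GG Gg GM]].
have dE n x : derive1 (fun x => F_ n x + G_ n x) x = derive1 (F_ n) x + derive1 (G_ n) x.
  have dF := Cinf_is_derive x (CF n); have dG := Cinf_is_derive x (CG n).
  by rewrite derive1E (@derive_val _ _ _ _ _ _ _ (is_deriveD dF dG)).
exists (fun n x => F_ n x + G_ n x); split.
- by move=> n; exact: CinfD.
- by move=> x; apply: cvgD; [exact: FF|exact: GG].
- move=> x; rewrite (_ : (fun n => _) = fun n => derive1 (F_ n) x + derive1 (G_ n) x).
    by apply: cvgD; [exact: Ff|exact: Gg].
  by apply/funext => n; exact: dE.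
- move=> M; have [C1 H1] := FM M; have [C2 H2] := GM M.
  exists (C1 + C2) => n x xM; rewrite dE.
  have [? ?] := H1 n x xM; have [? ?] := H2 n x xM.
  by split; rewrite (le_trans (ler_normD _ _))// lerD.
Qed.

Lemma approximableM F f G g : approximable F f -> approximable G g ->
  approximable (fun x => F x * G x) (fun x => F x * g x + G x * f x).
Proof.
move=> [F_ [CF FF Ff FM]] [G_ [CG GG Gg GM]].
exists (fun n x => F_ n x * G_ n x); split.
- by move=> n; exact: CinfM.
- by move=> x; apply: cvgM; [exact: FF|exact: GG].
- move=> x; rewrite (_ : (fun n => _) = fun n => F_ n x * derive1 (G_ n) x + G_ n x * derive1 (F_ n) x).
    by apply: cvgD; apply: cvgM; [exact: FF|exact: Gg|exact: GG|exact: Ff].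
  by apply/funext => n; exact: derive1M.
- move=> M; have [C1 H1] := FM M; have [C2 H2] := GM M.
  exists (C1 * C2 + C2 * C1) => n x xM; rewrite derive1M//.
  have [F1 F2] := H1 n x xM; have [G1 G2] := H2 n x xM.
  have C10 : 0 <= C1 by apply: le_trans F1.
  have C20 : 0 <= C2 by apply: le_trans G1.
  split; last first.
    by rewrite (le_trans (ler_normD _ _))// !normrM lerD// ler_pM.
  by rewrite normrM (@le_trans _ _ (C1 * C2)) ?ler_pM// lerDl mulr_ge0.
Qed.

(** On a bounded set the values of all [F_ n] lie in one interval [-C, C], on which [psi] and its
    derivative are bounded; this gives the uniform bounds. *)
Lemma approximable_comp psi F f : Cinf psi -> approximable F f ->
  approximable (fun x => psi (F x)) (fun x => derive1 psi (F x) * f x).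
Proof.
move=> Cp [F_ [CF FF Ff FM]]; exists (fun n => psi \o F_ n); split.
- by move=> n; exact: Cinf_comp.
- by move=> x; exact: (@continuous_cvg nat R R \oo _ (F_ ^~ x) psi (F x) (Cinf_continuous Cp (x:=F x)) (FF x)).
- move=> x; rewrite (_ : (fun n => _) = fun n => derive1 psi (F_ n x) * derive1 (F_ n) x).
    apply: cvgM; last exact: Ff.
    apply: (@continuous_cvg nat R R \oo _ (F_ ^~ x) (derive1 psi) (F x) _ (FF x)).
    exact/Cinf_continuous/Cinf_derive1.
  by apply/funext => n; exact: derive1_comp_Cinf.
- move=> M; have [C HC] := FM M.
  have [C1 H1] := Cinf_bounded (- C) C Cp.
  have [C2 H2] := Cinf_bounded (- C) C (Cinf_derive1 Cp).
  exists (Num.max C1 (C2 * C)) => n x xM; rewrite derive1_comp_Cinf//= normrM !le_max.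
  have [F1 F2] := HC n x xM; have := F1; rewrite ler_norml => F1'.
  by split; [rewrite H1|rewrite ler_pM ?orbT// H2].
Qed.

Lemma approximable_affine F f (a b : R) : approximable F f ->
  approximable (fun x => F (a * x + b)) (fun x => a * f (a * x + b)).
Proof.
move=> [F_ [CF FF Ff FM]]; exists (fun n x => F_ n (a * x + b)); split.
- by move=> n; exact: Cinf_comp_affine.
- by move=> x; exact: FF.
- move=> x; rewrite (_ : (fun n => _) = fun n => a * derive1 (F_ n) (a * x + b)).
    by apply: cvgM; [exact: cvg_cst|exact: Ff].
  by apply/funext => n; exact: derive1_comp_affine.
- move=> M; have [C HC] := FM (`|a| * M + `|b|).
  exists (Num.max C (`|a| * C)) => n x xM; rewrite derive1_comp_affine//.
  have [|F1 F2] := HC n (a * x + b).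
    by rewrite (le_trans (ler_normD _ _))// lerD2r normrM ler_wpM2l.
  by rewrite !le_max F1 normrM; split => //; rewrite ler_wpM2l ?orbT.
Qed.

(** The value 0 at the origin is dictated by the limit of the smooth steps; [ramp] is then the
    positive part. *)
Definition heaviside (x : R) : R := \1_`]0, +oo[%classic x.
Definition ramp (x : R) : R := x * heaviside x.

Lemma heaviside1 x : 0 < x -> heaviside x = 1.
Proof. by move=> x0; rewrite /heaviside indicE mem_set//= in_itv/= x0. Qed.

Lemma heaviside0 x : x <= 0 -> heaviside x = 0.
Proof.
by move=> x0; rewrite /heaviside indicE memNset//= in_itv/= andbT; apply/negP; rewrite -leNgt.
Qed.

(** The approximants are x sstep(n x). Their derivatives contain n x sstep'(n x), which stays
    bounded although n grows: sstep' vanishes unless 0 <= n x <= 1. For fixed x that term is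
    eventually zero, and at the origin it carries the factor x = 0. *)
Lemma approximable_ramp : approximable ramp heaviside.
Proof.
have [C HC] := @derive_sstep_bounded R.
have dE n (x : R) : derive1 (fun x : R => x * sstep (n%:R * x + 0)) x =
    x * (n%:R * derive1 sstep (n%:R * x + 0)) + sstep (n%:R * x + 0).
  rewrite (@derive1M _ id (fun x => sstep (n%:R * x + 0))).
  - rewrite derive1_comp_affine; last exact: Cinf_sstep.
    by rewrite derive1_id mulr1.
  - exact: Cinf_id.
  - exact/Cinf_comp_affine/Cinf_sstep.
exists (fun n x => x * sstep (n%:R * x + 0)); split.
- move=> n; apply: (@CinfM _ id); first exact: Cinf_id.
  exact/Cinf_comp_affine/Cinf_sstep.
- move=> x; apply: cvgM; first exact: cvg_cst.
  by rewrite (_ : (fun n => _) = fun n => sstep (n%:R * x)) ?addr0//;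
    [exact: sstep_cvg|apply/funext => n; rewrite addr0].
- move=> x; have [x0|x0] := ltP 0 x.
    rewrite heaviside1//; apply: cvg_near_cst; near=> n.
    rewrite dE addr0.
    have nx : 1 < n%:R * x.
      by rewrite -ltr_pdivrMr// div1r; near: n; exact: nbhs_infty_gtr.
    by rewrite derive_sstep1// sstep1 ?(ltW nx)// !mulr0 add0r.
  rewrite heaviside0//; apply: cvg_near_cst; near=> n.
  rewrite dE addr0 sstep0 ?addr0; last by rewrite mulr_ge0_le0.
  have [->|x1] := eqVneq x 0; first by rewrite mul0r.
  rewrite derive_sstep0 ?mulr0//.
  have n0 : 0 < n%:R :> R by near: n; exact: nbhs_infty_gtr.
  by rewrite pmulr_rlt0// lt_neqAle x1.
- move=> M; exists (`|M| + `|C| + 1) => n x xM; rewrite dE addr0.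
  have s1 : `|sstep (n%:R * x)| <= 1 by rewrite ger0_norm ?sstep_ge0 ?sstep_le1.
  split.
    rewrite normrM (@le_trans _ _ `|x|) ?ler_piMr//.
    by rewrite (le_trans xM)// -addrA (le_trans (ler_norm _))// lerDl addr_ge0.
  rewrite (le_trans (ler_normD _ _))// lerD//.
  apply: (@le_trans _ _ `|C|); last by rewrite lerDr.
  rewrite mulrA [x * _]mulrC normrM.
  have [nx|nx] := ltP (n%:R * x) 0; first by rewrite derive_sstep0// normr0 mulr0.
  have [nx1|nx1] := ltP 1 (n%:R * x); first by rewrite derive_sstep1// normr0 mulr0.
  rewrite -[leRHS]mul1r ler_pM//; first by rewrite ger0_norm.
  by rewrite (le_trans (HC _))// ler_norm.
Unshelve. all: by end_near. Qed.

Lemma approximable_measurable F f : approximable F f ->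
  measurable_fun setT F /\ measurable_fun setT f.
Proof.
move=> [F_ [CF FF Ff FM]]; split.
  apply: (@measurable_fun_cvg _ _ _ setT F_) => [n|x _]; last exact: FF.
  exact: Cinf_measurable.
apply: (@measurable_fun_cvg _ _ _ setT (fun n => derive1 (F_ n))) => [n|x _]; last exact: Ff.
by apply: Cinf_measurable; exact: Cinf_derive1.
Qed.

Lemma cvg_norm_le (u : nat -> R) (l C : R) : u @ \oo --> l ->
  (forall n, `|u n| <= C) -> `|l| <= C.
Proof.
move=> ul uC; have nl := cvg_norm (FF := eventually_filter) ul.
rewrite -(cvg_lim _ nl)//; apply: limr_le; first exact: cvgP nl.
exact: nearW.
Qed.

Lemma approximable_bounded F f : approximable F f ->
  forall M, exists C, forall x, `|x| <= M -> `|F x| <= C /\ `|f x| <= C.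
Proof.
move=> [F_ [CF FF Ff FM]] M; have [C HC] := FM M; exists C => x xM; split.
  by apply: (cvg_norm_le (FF x)) => n; case: (HC n x xM).
by apply: (cvg_norm_le (Ff x)) => n; case: (HC n x xM).
Qed.

End Approximation.

(** * Weak derivatives along a coordinate *)

Section SlabWeakDerivative.
Context d (T : measurableType d) (R : realType) (mu : {measure set T -> \bar R}).
Variable y : T -> R.
Hypothesis my : measurable_fun setT y.
Implicit Types u w g : T -> R.

(** One notion for three uses: the line ([y] the identity), x-strips of the plane ([y] the second
    projection) and horizontal strips ([y] the first projection). *)
Definition slab_weak_derivative u g :=
  [/\ slab_integrable mu y u, slab_integrable mu y g &
    forall phi, test1 phi ->
      \int[mu]_t (u t * derive1 phi (y t)) = - \int[mu]_t (g t * phi (y t))].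

Lemma ae_integrable u w : measurable_fun setT u -> ae_eq mu setT u w ->
  mu.-integrable setT (EFin \o w) -> mu.-integrable setT (EFin \o u).
Proof.
move=> m_u uw /integrableP[mw iw]; apply/integrableP; split; first exact/measurable_EFinP.
rewrite (@ae_eq_integral _ _ _ mu setT (fun t => `|(w t)%:E|%E))//.
- by apply: measurableT_comp => //; exact/measurable_EFinP.
- exact: measurableT_comp.
- by apply: filterS uw => t /= + _ => ->.
Qed.

Lemma slab_mul_locally_bounded (F : R -> R) u : measurable_fun setT F ->
  (forall M, exists C, forall x, `|x| <= M -> `|F x| <= C) ->
  slab_integrable mu y u -> slab_integrable mu y (fun t => F (y t) * u t).
Proof.
move=> mF FB [m_u iu]; split.
  by apply: measurable_funM => //; exact: measurable_comp1.
move=> M; have [C HC] := FB M.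
apply: (@integrable_bound _ _ _ _ _ (fun t => C * (u t * \1_[set z | `|z| <= M] (y t)))).
- apply: measurable_funM; first by apply: measurable_funM => //; exact: measurable_comp1.
  apply: measurable_comp1 => //; apply: measurable_indic.
  by rewrite (_ : [set z | _] = `[- M, M]%classic)//; apply/seteqP; split => x /=; rewrite in_itv/= ler_norml.
- exact: integrable_scale.
- move=> t; rewrite -mulrA normrM [leRHS]normrM indicE.
  have [yM|yM] := leP `|y t| M; last first.
    by rewrite memNset ?mulr0 ?normr0 ?mulr0//= => /le_lt_trans /(_ yM); rewrite ltxx.
  by rewrite ler_wpM2r// (le_trans (HC _ yM))// ler_norm.
Qed.

Lemma slabD u w : slab_integrable mu y u -> slab_integrable mu y w ->
  slab_integrable mu y (fun t => u t + w t).
Proof.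
move=> [m_u iu] [mw iw]; split; first exact: measurable_funD.
move=> M; have := integrableD measurableT (iu M) (iw M); apply: eq_integrable => // t _.
by rewrite /= -EFinD mulrDl.
Qed.

Lemma slab_mul_approximable F f u : approximable F f -> slab_integrable mu y u ->
  slab_integrable mu y (fun t => F (y t) * u t) /\
  slab_integrable mu y (fun t => f (y t) * u t).
Proof.
move=> FA su; have [mF mf] := approximable_measurable FA.
have FB := approximable_bounded FA.
by split; apply: slab_mul_locally_bounded => // M; have [C HC] := FB M;
  exists C => x xM; case: (HC x xM).
Qed.

(** For each smooth approximant, [F_ n * phi] is a genuine test function for [u]; the product rule
    for [F] is the limit of these identities. *)
Lemma slab_weak_derivative_mul F f u g : approximable F f ->
  slab_weak_derivative u g ->
  slab_weak_derivative (fun t => F (y t) * u t) (fun t => F (y t) * g t + f (y t) * u t).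
Proof.
move=> FA [su sg ug].
have [sFu sfu] := slab_mul_approximable FA su; have [sFg _] := slab_mul_approximable FA sg.
split => [//||phi tphi]; first exact: slabD.
have tphi' := test1_derive tphi.
have i1 := slab_mul_test my sFu tphi'; have i2 := slab_mul_test my sFg tphi.
have i3 := slab_mul_test my sfu tphi.
have i23 := integrableD measurableT i2 i3.
rewrite [X in _ = - X](eq_Rintegral mu (g := fun t => F (y t) * g t * phi (y t) + f (y t) * u t * phi (y t))); last first.
  by move=> t _; rewrite mulrDl.
apply/eqP; rewrite -addr_eq0 -RintegralD//.
have [F_ [CF FF Ff FM]] := FA.
have [Cphi [M HM]] := tphi; have [M' HM'] := tphi'.2.
(* One radius covers the supports of [phi] and of its derivative, so the bounds on the approximants
   are needed only there. *)
have [C HC] := FM (Num.max M M').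
apply/eqP.
(* The integrand of the weak identity for [F_ n * phi], with both sides collected: its integral is
   zero for each [n]. *)
pose h n t := u t * derive1 (fun x => F_ n x * phi x) (y t) + g t * (F_ n (y t) * phi (y t)).
have hE n t : h n t = u t * (F_ n (y t) * derive1 phi (y t) + phi (y t) * derive1 (F_ n) (y t)) +
  g t * (F_ n (y t) * phi (y t)) by rewrite /h derive1M.
pose G t := `|C * (u t * derive1 phi (y t))| + `|C * (u t * phi (y t))| + `|C * (g t * phi (y t))|.
apply: (@Rintegral_lim0 _ _ _ mu h _ G).
- move=> n; apply: measurable_funD; apply: measurable_funM.
  + exact: su.1.
  + apply: measurable_comp1 => //; apply: Cinf_measurable; apply: Cinf_derive1.
    exact: CinfM.
  + exact: sg.1.
  + apply: (@measurable_comp1 _ _ _ y my (fun x => F_ n x * phi x)).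
    by apply: Cinf_measurable; exact: CinfM.
- move=> t.
  rewrite (_ : h ^~ t = fun n => u t * (F_ n (y t) * derive1 phi (y t) + phi (y t) * derive1 (F_ n) (y t)) +
    g t * (F_ n (y t) * phi (y t))); last by apply/funext => n; exact: hE.
  rewrite [X in _ --> X](_ : _ = u t * (F (y t) * derive1 phi (y t) + phi (y t) * f (y t)) + g t * (F (y t) * phi (y t))); last by ring.
  apply: cvgD; apply: cvgM; [exact: cvg_cst| |exact: cvg_cst|].
    apply: cvgD; apply: cvgM; [exact: FF|exact: cvg_cst|exact: cvg_cst|exact: Ff].
  by apply: cvgM; [exact: FF|exact: cvg_cst].
- have j1 := integrable_norm (integrable_scale C (slab_mul_test my su tphi')).
  have j2 := integrable_norm (integrable_scale C (slab_mul_test my su tphi)).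
  have j3 := integrable_norm (integrable_scale C (slab_mul_test my sg tphi)).
  have := integrableD measurableT (integrableD measurableT j1 j2) j3.
  by apply: eq_integrable.
- move=> n t; rewrite hE /G.
  have [yM|yM] := leP `|y t| (Num.max M M'); last first.
    move: yM; rewrite gt_max => /andP[/ltW y1 /ltW y2].
    by rewrite (HM _ y1) (HM' _ y2) !(mulr0, mul0r, addr0) normr0.
  have [F1 F2] := HC n _ yM.
  rewrite (le_trans (ler_normD _ _))// lerD//.
    rewrite mulrDr (le_trans (ler_normD _ _))// lerD//.
      rewrite mulrCA normrM [leRHS]normrM ler_wpM2r//.
      by rewrite (le_trans F1)// ler_norm.
    rewrite mulrA mulrC normrM [leRHS]normrM ler_wpM2r//.
    by rewrite (le_trans F2)// ler_norm.
  rewrite mulrCA normrM [leRHS]normrM ler_wpM2r//.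
  by rewrite (le_trans F1)// ler_norm.
- move=> n.
  have tF : test1 (fun x => F_ n x * phi x) by exact: test1M.
  rewrite RintegralD//; last 2 first.
  + by apply: slab_mul_test => //; exact: test1_derive.
  + exact: slab_mul_test tF.
  by rewrite ug// addNr.
Qed.

(** Test against the dilated cut-off chi(y / (n+1)): it tends to 1, while its derivative carries the
    factor 1/(n+1) and disappears against the integrable [u]. No boundary term remains at
    infinity. *)
Lemma slab_weak_derivative_total u g : slab_weak_derivative u g ->
  mu.-integrable setT (EFin \o u) -> mu.-integrable setT (EFin \o g) ->
  \int[mu]_t g t = 0.
Proof.
move=> [su sg ug] iu ig.
(* This window equals 1 on [-1, 1]; only its value 1 at the origin is needed, since y / (n+1) tends
   to 0 pointwise. *)
pose chi := window (- 2 : R) 2 1.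
have tchi : test1 chi by exact: window_test.
have [C HC] := test1_bounded (test1_derive tchi).
pose phi n x := chi (n.+1%:R^-1 * x + 0).
have tphi n : test1 (phi n).
  split; first by apply: Cinf_comp_affine; case: tchi.
  have [_ [M HM]] := tchi; exists (n.+1%:R * M) => x Mx; apply: HM.
  by rewrite addr0 normrM ger0_norm// ler_pdivlMl.
have dphi n x : derive1 (phi n) x = n.+1%:R^-1 * derive1 chi (n.+1%:R^-1 * x + 0).
  by rewrite /phi derive1_comp_affine//; case: tchi.
have chi0 : chi 0 = 1 by rewrite /chi windowE !sstep1 ?mulr1//; lra.
pose h n t := u t * derive1 (phi n) (y t) + g t * phi n (y t).
pose G t := `|C * u t| + `|g t|.
have ninv : (fun n => n.+1%:R^-1 : R) @ \oo --> (0 : R) by exact: cvg_harmonic.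
apply: (@Rintegral_lim0 _ _ _ mu h _ G).
- move=> n; apply: measurable_funD; apply: measurable_funM.
  + exact: su.1.
  + apply: measurable_comp1 => //; apply: Cinf_measurable; apply: Cinf_derive1.
    by case: (tphi n).
  + exact: sg.1.
  + by apply: measurable_comp1 => //; apply: Cinf_measurable; case: (tphi n).
- move=> t.
  have c0 : (fun n => n.+1%:R^-1 * y t + 0) @ \oo --> (0 : R).
    have : (fun n => n.+1%:R^-1 * y t + 0) @ \oo --> (0 * y t + 0 : R).
      by apply: cvgD; [apply: cvgM; [exact: ninv|exact: cvg_cst]|exact: cvg_cst].
    by rewrite mul0r addr0.
  rewrite (_ : h ^~ t = fun n => u t * (n.+1%:R^-1 * derive1 chi (n.+1%:R^-1 * y t + 0)) + g t * phi n (y t)); last first.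
    by apply/funext => n; rewrite /h dphi.
  rewrite [X in _ --> X](_ : _ = u t * (0 * derive1 chi 0) + g t * chi 0); last first.
    by rewrite chi0 mul0r mulr0 add0r mulr1.
  apply: cvgD; apply: cvgM; [exact: cvg_cst| |exact: cvg_cst|].
    apply: cvgM => //.
    apply: (@continuous_cvg nat R R \oo _ _ (derive1 chi) 0 _ c0).
    by apply: Cinf_continuous; apply: Cinf_derive1; case: tchi.
  apply: (@continuous_cvg nat R R \oo _ _ chi 0 _ c0).
  by apply: Cinf_continuous; case: tchi.
- have := integrableD measurableT (integrable_norm (integrable_scale C iu)) (integrable_norm ig).
  by apply: eq_integrable.
- move=> n t; rewrite /h /G (le_trans (ler_normD _ _))// lerD//.
    rewrite mulrC normrM [leRHS]normrM ler_wpM2r//.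
    rewrite dphi normrM (@le_trans _ _ (1 * C)) ?ler_pM//.
      by rewrite ger0_norm// invf_le1// ler1n.
    by rewrite mul1r ler_norm.
  rewrite normrM ler_piMr// ger0_norm ?window_ge0//; exact: window_le1.
- move=> n; rewrite RintegralD//; last 2 first.
  + by apply: slab_mul_test => //; exact: test1_derive.
  + exact: slab_mul_test.
  by rewrite ug// addNr.
Qed.

(** As [g] is zero, the weak derivative of F(y) u is f(y) u almost everywhere, where [f] is the
    derivative of [F]; its total integral is therefore zero. Since [u] lives where [y] is bounded,
    unbounded weights [F] are allowed. *)
Lemma slab_weak_derivative_zero (a b : R) u g : slab_weak_derivative u g ->
  ae_eq mu setT g (cst 0) ->
  {ae mu, forall t, ~ `]a, b[%classic (y t) -> u t = 0} ->
  forall B : set R, measurable B -> \int[mu]_t (u t * \1_B (y t)) = 0.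
Proof.
move=> ugW g0 uout; have [su sg ug] := ugW.
pose M := `|a| + `|b|.
have bnd_int (w : R -> R) : measurable_fun setT w -> (forall M, exists C, forall x, `|x| <= M -> `|w x| <= C) ->
    mu.-integrable setT (EFin \o (fun t => w (y t) * u t)).
  move=> mw wB.
  have sw := slab_mul_locally_bounded mw wB su.
  apply: ae_integrable (sw.2 M); first exact: sw.1.
  apply: filterS uout => t /= ut _; rewrite indicE.
  have [yM|yM] := leP `|y t| M; first by rewrite mem_set// mulr1.
  rewrite ut ?mulr0 ?mul0r// in_itv/= => /andP[ya yb].
  move: yM; rewrite ltNge => /negP; apply; rewrite ler_norml /M.
  have := ler_norm b; have := ler_norm (- a); have := normr_ge0 a; have := normr_ge0 b.
  by rewrite normrN => *; apply/andP; split; lra.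
have main (F f : R -> R) : approximable F f -> \int[mu]_t (f (y t) * u t) = 0.
  move=> FA; have [mF mf] := approximable_measurable FA.
  have FB := approximable_bounded FA.
  have iFu : mu.-integrable setT (EFin \o (fun t => F (y t) * u t)).
    by apply: bnd_int => // N; have [C HC] := FB N; exists C => x /HC[].
  have ifu : mu.-integrable setT (EFin \o (fun t => f (y t) * u t)).
    by apply: bnd_int => // N; have [C HC] := FB N; exists C => x /HC[].
  have W := slab_weak_derivative_mul FA ugW.
  have E : ae_eq mu setT (fun t => F (y t) * g t + f (y t) * u t) (fun t => f (y t) * u t).
    by apply: filterS g0 => t /= + _ => ->//; rewrite mulr0 add0r.
  have [_ [mW _] _] := W.
  rewrite -(slab_weak_derivative_total W)//.
    apply: ae_eq_Rintegral => //; last by apply: filterS E => t /= + _ => ->.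
    by apply: measurable_funM; [exact: measurable_comp1|exact: su.1].
  exact: ae_integrable E ifu.
have iu : mu.-integrable setT (EFin \o u).
  have : mu.-integrable setT (EFin \o (fun t => cst 1 (y t) * u t)).
    by apply: bnd_int => // N; exists 1 => x _; rewrite normr1.
  by apply: eq_integrable => // t _ /=; rewrite mul1r.
have GE : @measurable _ R = <<s @RGenOInfty.G R >> by exact: RGenOInfty.measurableE.
apply: (integral_dynkin GE) => //.
- move=> _ _ [p ->] [q ->]; exists (Num.max p q).
  by apply/seteqP; split => x /=; rewrite !in_itv/= !andbT gt_max => /andP.
(* The weight [F] is the coordinate itself, with derivative 1: this is the total integral required
   by the Dynkin argument. *)
- rewrite -(main _ _ (approximable_Cinf (@Cinf_id R))).
  by apply: eq_Rintegral => t _; rewrite derive1_id mul1r.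
(* The weight is the ramp starting at [p], whose derivative is the indicator of the half-line beyond
   [p], a generator of the Borel sets. *)
- move=> _ [p ->]; rewrite -(main _ _ (approximable_affine 1 (- p) (@approximable_ramp R))).
  apply: eq_Rintegral => t _; rewrite !mul1r mulrC; congr (_ * _).
  rewrite /heaviside !indicE; congr ((_ : bool)%:R).
  by apply/idP/idP; rewrite !inE /= !in_itv/= !andbT subr_gt0.
Qed.

End SlabWeakDerivative.

(** * Square-integrable functions *)

Section SquareIntegrable.
Context d (T : measurableType d) (R : realType) (mu : {measure set T -> \bar R}).
Implicit Types u w : T -> R.

Lemma Lfun2P u : u \in Lfun mu 2%:E <->
  measurable_fun setT u /\ mu.-integrable setT (EFin \o (fun t => u t ^+ 2)).
Proof.
split=> [u2|[m_u iu]].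
  split; last exact: Lfun2_integrable_sqr.
  by move: u2; rewrite inE => /andP[/[!inE]].
rewrite inE; apply/andP; split; rewrite inE//=.
rewrite /finite_norm unlock poweR_lty//.
move/integrableP : iu => [_]; apply: le_lt_trans.
rewrite le_eqVlt; apply/orP; left; apply/eqP; apply: eq_integral => t _ /=.
by rewrite powR_mulrn// normrX.
Qed.

Lemma Lfun2_0 : (cst 0 : T -> R) \in Lfun mu 2%:E.
Proof.
apply/Lfun2P; split => //; have := @integrable0 _ _ R mu setT.
by apply: eq_integrable => // t _ /=; rewrite expr0n.
Qed.

Lemma Lfun2_measurable u : u \in Lfun mu 2%:E -> measurable_fun setT u.
Proof. by case/Lfun2P. Qed.

Lemma Lfun2_mul u w : u \in Lfun mu 2%:E -> w \in Lfun mu 2%:E ->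
  mu.-integrable setT (EFin \o (fun t => u t * w t)).
Proof. by move=> u2 w2; apply/Lfun1_integrable; exact: Lfun2_mul_Lfun1. Qed.

Lemma Lfun2_le u w : measurable_fun setT u -> (forall t, `|u t| <= `|w t|) ->
  w \in Lfun mu 2%:E -> u \in Lfun mu 2%:E.
Proof.
move=> m_u uw /Lfun2P[mw iw]; apply/Lfun2P; split => //.
apply: integrable_bound iw _; first exact: measurable_funX.
by move=> t; rewrite !normrX lerXn2r ?nnegrE.
Qed.

Lemma Lfun2_ae u w : measurable_fun setT u -> ae_eq mu setT u w ->
  w \in Lfun mu 2%:E -> u \in Lfun mu 2%:E.
Proof.
move=> m_u uw /Lfun2P[mw iw]; apply/Lfun2P; split => //.
apply: ae_integrable iw; first exact: measurable_funX.
by apply: filterS uw => t /= + _ => ->.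
Qed.

Lemma Lfun2B u w : u \in Lfun mu 2%:E -> w \in Lfun mu 2%:E ->
  (fun t => u t - w t) \in Lfun mu 2%:E.
Proof.
move=> /Lfun2P[m_u iu] /Lfun2P[mw iw]; apply/Lfun2P; split; first exact: measurable_funB.
apply: (@integrable_bound _ _ _ _ _ (fun t => 2 * (u t ^+ 2) + 2 * (w t ^+ 2))).
- by apply: measurable_funX; exact: measurable_funB.
- have := integrableD measurableT (integrable_scale 2 iu) (integrable_scale 2 iw).
  by apply: eq_integrable.
- move=> t; rewrite !ger0_norm ?sqr_ge0//; last first.
    by rewrite addr_ge0// mulr_ge0// sqr_ge0.
  by have := sqr_ge0 (u t + w t); nra.
Qed.

Lemma indic_integrable (A : set T) : measurable A -> (mu A < +oo)%E ->
  mu.-integrable setT (EFin \o (\1_A : T -> R)).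
Proof.
move=> mA fA; apply/integrableP; split.
  by apply/measurable_EFinP; exact: measurable_indic.
rewrite (eq_integral (fun t => (\1_A t)%:E)) ?integral_indic ?setIT//.
by move=> t _ /=; rewrite ger0_norm.
Qed.

(** Cauchy-Schwarz against the indicator of [A], which is square-integrable because [A] has finite
    measure. *)
Lemma Lfun1_of_Lfun2_finite (A : set T) u : measurable A -> (mu A < +oo)%E ->
  u \_ A \in Lfun mu 2%:E -> u \_ A \in Lfun mu 1%:E.
Proof.
move=> mA fA u2; apply/Lfun1_integrable.
have iA : mu.-integrable setT (EFin \o (fun t => (\1_A t : R) * \1_A t)).
  apply: eq_integrable (indic_integrable mA fA) => // t _ /=.
  by rewrite indicE; case: (_ \in _); rewrite ?mulr1 ?mulr0.
have A2 : \1_A \in Lfun mu 2%:E by apply/Lfun2P; split; [exact: measurable_indic|exact: iA].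
have := Lfun2_mul u2 A2; apply: eq_integrable => // t _ /=.
by congr EFin; rewrite patchE indicE; case: ifPn => tA; rewrite ?mulr1 ?mul0r.
Qed.

Lemma ae_eq0_indic u : mu.-integrable setT (EFin \o u) ->
  (forall E, measurable E -> \int[mu]_t (u t * \1_E t) = 0) ->
  ae_eq mu setT u (cst 0).
Proof.
move=> iu u0.
have H : ae_eq mu setT (EFin \o u) (cst 0%E).
  apply: integral_ae_eq => // E _ mE.
  rewrite integral0; have := u0 E mE; rewrite -Rintegral_indic /Rintegral => H.
  rewrite -[LHS]fineK ?H//; apply: integrable_fin_num => //.
  exact: integrableS iu.
by apply: filterS H => t /= + _ => /(_ I)[].
Qed.

End SquareIntegrable.

(** * Measurability and local integrability on the plane *)

Section Plane.
Context {R : realType}.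
Local Notation mu2 := (leb2 R).
Implicit Types u g w : R * R -> R.

(** The sigma-algebra here is generated by measurable rectangles; an open set belongs to it as the
    countable union of the rational boxes that it contains. *)
Lemma open_measurable2 (U : set (R * R)) : open U -> measurable U.
Proof.
move=> oU.
pose box (q : rat * rat * rat) : set (R * R) :=
  [set p | ratr q.1.1 - ratr q.2 < p.1 < ratr q.1.1 + ratr q.2 /\
           ratr q.1.2 - ratr q.2 < p.2 < ratr q.1.2 + ratr q.2].
have mbox q : measurable (box q).
  rewrite (_ : box q = `]ratr q.1.1 - ratr q.2, ratr q.1.1 + ratr q.2[ `*`
     `]ratr q.1.2 - ratr q.2, ratr q.1.2 + ratr q.2[)%classic; first exact: measurableX.
  by apply/seteqP; split=> p [] /= H1 H2; (split; move: H1 H2); rewrite /= !in_itv /=.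
rewrite (_ : U = \bigcup_q (if pselect (box q `<=` U) then box q else set0)).
  apply: countable_bigcupT_measurable => // q.
  by case: (pselect (box q `<=` U)) => H; [exact: mbox|exact: measurable0].
apply/seteqP; split=> [p Up|p [q _]]; last by case: (pselect (box q `<=` U)) => // H; exact: H.
have [e /= e0 He] : nbhs_ball p U by rewrite nbhs_ballE; exact: open_nbhs_nbhs.
(* A centre within [r] of [p] in each coordinate and a half-width r < e/4 keep the whole box within
   2 r < e of [p]. *)
have e4 : 0 < e / 4 by rewrite divr_gt0.
have [r] := rat_in_itvoo e4; rewrite in_itv/= => /andP[r0 re].
have [q1] := @rat_in_itvoo R (p.1 - ratr r) p.1 ltac:(by rewrite ltrBlDr ltrDl).
rewrite in_itv/= => /andP[q11 q12].
have [q2] := @rat_in_itvoo R (p.2 - ratr r) p.2 ltac:(by rewrite ltrBlDr ltrDl).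
rewrite in_itv/= => /andP[q21 q22].
exists (q1, q2, r) => //.
case: (pselect (box (q1, q2, r) `<=` U)) => [H|]; first by split => /=; apply/andP; split; lra.
case=> x [] /= /andP[x1 x2] /andP[x3 x4]; apply: He.
by split; rewrite /ball /= ltr_distl; apply/andP; split; lra.
Qed.

Lemma compact_measurable2 (K : set (R * R)) : compact K -> measurable K.
Proof.
move=> cK; rewrite -[K]setCK; apply: measurableC; apply: open_measurable2.
by apply: closed_openC; apply: compact_closed => //; exact: norm_hausdorff.
Qed.

Definition square (M : R) : set (R * R) :=
  [set z | `|z| <= M] `*` [set z | `|z| <= M].

Lemma square_compact M : compact (square M).
Proof. by apply: compact_setX; exact: closed_ball_compact. Qed.

Lemma measurable_ball1 (M : R) : measurable [set z : R | `|z| <= M].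
Proof. by apply: compact_measurable; exact: closed_ball_compact. Qed.

Lemma square_measurable M : measurable (square M).
Proof. by apply: compact_measurable2; exact: square_compact. Qed.

Lemma square_finite M : (mu2 (square M) < +oo)%E.
Proof.
rewrite /square product_measure1E; [|exact: measurable_ball1..].
have fM : (lebesgue_measure [set z : R | (`|z| <= M)%R] < +oo)%E.
  by apply: compact_finite_measure; exact: closed_ball_compact.
by rewrite lte_mul_pinfty// ge0_fin_numE.
Qed.

Lemma compact_subset_square (K : set (R * R)) : compact K -> exists M, K `<=` square M.
Proof.
move=> /compact_bounded[M [_ HM]]; exists (`|M| + 1) => p Kp.
have := HM (`|M| + 1) _ p Kp; rewrite (le_lt_trans (ler_norm _)) ?ltrDl// => /(_ isT) /=.
by rewrite prod_normE ge_max => /andP[].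
Qed.

Lemma indic_square M p : \1_(square M) p = \1_[set z | `|z| <= M] p.1 * \1_[set z | `|z| <= M] p.2 :> R.
Proof. by rewrite !indicE -natrM mulnb in_setX. Qed.

Definition loc2 u := measurable_fun setT u /\
  forall M, mu2.-integrable setT (EFin \o (fun p => u p * \1_(square M) p)).

Lemma square_exhaust p : exists N : nat, forall n, (N <= n)%N -> square n%:R p.
Proof.
have [N HN] : exists N : nat, Num.max `|p.1| `|p.2| <= N%:R.
  exists (Num.bound (Num.max `|p.1| `|p.2|)).
  by rewrite ltW// archi_boundP// le_max normr_ge0.
exists N => n Nn; move: HN; rewrite ge_max => /andP[H1 H2].
by split => /=; [apply: le_trans H1 _|apply: le_trans H2 _]; rewrite ler_nat.
Qed.

(** Squares exhaust the plane and every compact set lies in one, so they suffice for integrability.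
    Measurability of [u] on the whole plane is recovered as the pointwise limit of its
    truncations. *)
Lemma L1_loc2 u : L1_loc u <-> loc2 u.
Proof.
split=> [u1|[m_u iu] K cK]; last first.
  have [M KM] := compact_subset_square cK.
  have mK := compact_measurable2 cK.
  rewrite patch_indic; apply/Lfun1_integrable.
  apply: integrable_bound (iu M) _.
    by apply: measurable_funM => //; exact: measurable_indic.
  move=> p; rewrite normrM [leRHS]normrM ler_wpM2l// !indicE.
  case: (boolP (p \in K)) => [/set_mem /KM pK|_]; last by rewrite normr0.
  by rewrite mem_set.
have iu M : mu2.-integrable setT (EFin \o (fun p => u p * \1_(square M) p)).
  by rewrite -[X in EFin \o X]/(u \* \1_(square M)) -patch_indic; apply/Lfun1_integrable/u1; exact: square_compact.
split => //.
apply: (@measurable_fun_cvg _ _ _ setT (fun n p => u p * \1_(square n%:R) p)).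
  by move=> n; apply/measurable_EFinP; exact: measurable_int (iu _).
move=> p _; have [N HN] := square_exhaust p.
apply: cvg_near_cst; near=> n; rewrite indicE mem_set ?mulr1//; apply: HN.
by near: n; exact: nbhs_infty_ge.
Unshelve. all: by end_near. Qed.

Lemma loc2_mul u w : loc2 u -> measurable_fun setT w ->
  (exists C, forall p, `|w p| <= C) ->
  (exists M, forall p, M <= `|p.1| \/ M <= `|p.2| -> w p = 0) ->
  mu2.-integrable setT (EFin \o (fun p => u p * w p)).
Proof.
move=> [m_u iu] mw wC [M HM].
have := @integrable_mul_bounded _ _ _ mu2 _ w mw wC (iu M); apply: eq_integrable => // p _ /=.
congr EFin; rewrite indicE; case: (boolP (p \in square M)) => pM; first by rewrite mulr1.
rewrite HM ?mulr0//; apply: contrapT => /not_orP[p1 p2]; move: pM; rewrite notin_setE; apply.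
by split=> /=; rewrite ltW// ltNge; apply/negP.
Qed.

Lemma loc2_bounded_mul u w : loc2 u -> measurable_fun setT w ->
  (exists C, forall p, `|w p| <= C) -> loc2 (fun p => u p * w p).
Proof.
move=> [m_u iu] mw wC; split; first exact: measurable_funM.
move=> M; have := @integrable_mul_bounded _ _ _ mu2 _ w mw wC (iu M); apply: eq_integrable => // p _ /=.
by rewrite mulrAC.
Qed.

Lemma loc2D u w : loc2 u -> loc2 w -> loc2 (fun p => u p + w p).
Proof.
move=> [m_u iu] [mw iw]; split; first exact: measurable_funD.
move=> M; have := integrableD measurableT (iu M) (iw M); apply: eq_integrable => // t _.
by rewrite /= -EFinD mulrDl.
Qed.

Lemma loc2N u : loc2 u -> loc2 (fun p => - u p).
Proof.
move=> [m_u iu]; split; first exact: measurable_funN.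
by move=> M; have := integrableN (iu M); apply: eq_integrable => // t _; rewrite /= mulNr.
Qed.

Lemma loc2B u w : loc2 u -> loc2 w -> loc2 (fun p => u p - w p).
Proof. by move=> lu lw; apply: loc2D => //; exact: loc2N. Qed.

Lemma loc2_mul_test u phi : loc2 u -> test_function phi ->
  mu2.-integrable setT (EFin \o (fun p => u p * phi p)).
Proof.
move=> lu tphi; apply: loc2_mul => //.
- move=> _ B mB; rewrite setTI.
  have GE : @measurable _ R = <<s @RGenOpens.G R >> by exact: RGenOpens.measurableE.
  have : measurable_fun setT phi.
    apply: (@measurability _ _ _ _ setT phi (@RGenOpens.G R)) => //.
    move=> _ [_ [a [b ->]] <-]; rewrite setTI; apply: open_measurable2.
    by apply: open_comp => // p _; exact: test_continuous.
  by move=> /(_ measurableT B mB); rewrite setTI.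
- exact: test_bounded.
- exact: test_support.
Qed.

(** Cutting off in x leaves only the y-direction unbounded, which is the situation that
    [slab_integrable] describes. *)
Lemma slab_snd u (w : R -> R) : loc2 u -> measurable_fun setT w ->
  (exists C, forall x, `|w x| <= C) -> (exists M, forall x, M <= `|x| -> w x = 0) ->
  slab_integrable mu2 snd (fun p => u p * w p.1).
Proof.
move=> lu mw [C HC] [M HM]; split.
  by apply: measurable_funM; [exact: lu.1|exact: measurable_comp1].
move=> N.
have := @loc2_mul u (fun p => w p.1 * \1_[set z | `|z| <= N] p.2) lu.
rewrite (_ : (fun p => u p * _) = (fun t => u t * w t.1 * \1_[set z | `|z| <= N] t.2)); last first.
  by apply/funext => p; rewrite mulrA.
apply.
- apply: measurable_funM; first exact: measurable_comp1.
  by apply: measurable_comp1 => //; apply: measurable_indic; exact: measurable_ball1.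
- exists C => p; rewrite normrM (le_trans _ (HC p.1))// ler_piMr//.
  by rewrite indicE; case: (_ \in _); rewrite ?normr1 ?normr0.
- exists (Num.max M (N + 1)) => p; rewrite !ge_max => -[/andP[H _]|/andP[_ H]].
    by rewrite HM// mul0r.
  by rewrite indicE memNset ?mulr0//= => H'; have := le_trans H H'; lra.
Qed.

Lemma slab_fst u (w : R -> R) : loc2 u -> measurable_fun setT w ->
  (exists C, forall x, `|w x| <= C) -> (exists M, forall x, M <= `|x| -> w x = 0) ->
  slab_integrable mu2 fst (fun p => u p * w p.2).
Proof.
move=> lu mw [C HC] [M HM]; split.
  by apply: measurable_funM; [exact: lu.1|exact: measurable_comp1].
move=> N.
have := @loc2_mul u (fun p => w p.2 * \1_[set z | `|z| <= N] p.1) lu.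
rewrite (_ : (fun p => u p * _) = (fun t => u t * w t.2 * \1_[set z | `|z| <= N] t.1)); last first.
  by apply/funext => p; rewrite mulrA.
apply.
- apply: measurable_funM; first exact: measurable_comp1.
  by apply: measurable_comp1 => //; apply: measurable_indic; exact: measurable_ball1.
- exists C => p; rewrite normrM (le_trans _ (HC p.2))// ler_piMr//.
  by rewrite indicE; case: (_ \in _); rewrite ?normr1 ?normr0.
- exists (Num.max M (N + 1)) => p; rewrite !ge_max => -[/andP[_ H]|/andP[H _]].
    by rewrite indicE memNset ?mulr0//= => H'; have := le_trans H H'; lra.
  by rewrite HM// mul0r.
Qed.

End Plane.

(** * Uniqueness of weak derivatives on the plane, and strips *)

Section PlaneLemmas.
Context {R : realType}.
Local Notation mu2 := (leb2 R).
Implicit Types u g w : R * R -> R.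

Lemma indic_bounded_support (A : set R) (M : R) : A `<=` `]- M, M[%classic ->
  (exists C : R, forall x, `|\1_A x : R| <= C) /\ (exists N : R, forall x, N <= `|x| -> \1_A x = 0 :> R).
Proof.
move=> AM; split.
  by exists 1 => x; rewrite indicE; case: (_ \in _); rewrite ?normr1 ?normr0.
exists M => x Mx; rewrite indicE; case: (boolP (x \in A)) => // /set_mem /AM.
by rewrite /= in_itv/= -ltr_norml ltNge Mx.
Qed.

Lemma ae_eq0_squares u : measurable_fun setT u ->
  (forall n : nat, ae_eq mu2 setT (fun p => u p * \1_(square n%:R) p) (cst 0)) ->
  ae_eq mu2 setT u (cst 0).
Proof.
move=> m_u H; have := ae_foralln (mu := mu2) H; apply: filterS => p Hp _.
have [N HN] := square_exhaust p.
by have := Hp N I; rewrite indicE mem_set ?mulr1//; exact: HN.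
Qed.

(** Rectangles generate the product sigma-algebra. On each square [u] is integrable and the Dynkin
    argument gives all measurable sets; the squares then exhaust the plane. *)
Lemma ae_eq0_rectangles u : loc2 u ->
  (forall A B : set R, measurable A -> measurable B ->
    (exists M, A `<=` `]- M, M[%classic) -> (exists M, B `<=` `]- M, M[%classic) ->
    \int[mu2]_p (u p * \1_A p.1 * \1_B p.2) = 0) ->
  ae_eq mu2 setT u (cst 0).
Proof.
move=> lu u0; apply: ae_eq0_squares; first exact: lu.1.
move=> n; apply: ae_eq0_indic; first exact: lu.2.
pose G := [set A `*` B | A in @measurable _ R & B in @measurable _ R].
have GE : @measurable _ (R * R)%type = <<s G >> by exact: measurable_prod_measurableType.
have rect A B : measurable A -> measurable B ->
    \int[mu2]_p (u p * \1_(square n%:R) p * \1_(A `*` B) p) = 0.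
  move=> mA mB.
  have sub (D : set R) : exists M, D `&` [set z | `|z| <= n%:R] `<=` `]- M, M[%classic.
    exists (n%:R + 1) => z [_ /= zn]; rewrite in_itv/= -ltr_norml.
    by rewrite (le_lt_trans zn)// ltrDl.
  rewrite -(u0 (A `&` [set z | `|z| <= n%:R]) (B `&` [set z | `|z| <= n%:R]))//.
  - apply: eq_Rintegral => p _; rewrite -!mulrA; congr (_ * _).
    rewrite indic_square !indicE -!natrM !mulnb in_setX !in_setI.
    by rewrite andbACA; congr ((_ && _)%:R); exact: andbC.
  - by apply: measurableI => //; exact: measurable_ball1.
  - by apply: measurableI => //; exact: measurable_ball1.
move=> E mE.
apply: (@integral_dynkin _ _ R mu2 _ _ G id _ GE _ _ _ _ _ E mE) => //.
- move=> _ _ [A mA [B mB <-]] [A' mA' [B' mB' <-]].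
  exists (A `&` A'); first exact: measurableI.
  exists (B `&` B'); first exact: measurableI.
  by rewrite setXI.
- exact: lu.2.
- have := rect setT setT measurableT measurableT.
  rewrite setXTT => <-; apply: eq_Rintegral => p _.
  by rewrite [\1_setT p]indicE in_setT mulr1.
- by move=> _ [A mA [B mB <-]]; exact: rect.
Qed.

Lemma test_bounds (phi : R -> R) : test1 phi ->
  [/\ measurable_fun setT phi, exists C, forall x, `|phi x| <= C &
      exists M, forall x, M <= `|x| -> phi x = 0].
Proof.
move=> tphi; split; last by case: tphi.
  by apply: Cinf_measurable; case: tphi.
exact: test1_bounded.
Qed.

(** The one-variable du Bois-Reymond lemma is applied twice: with chi(x) frozen, phi(y) becomes an
    indicator of [B]; then, with that indicator frozen, chi(x) becomes an indicator of [A]. *)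
Lemma rectangles_of_tests u : loc2 u ->
  (forall chi phi, test1 chi -> test1 phi -> \int[mu2]_p (u p * chi p.1 * phi p.2) = 0) ->
  ae_eq mu2 setT u (cst 0).
Proof.
move=> lu u0; apply: ae_eq0_rectangles => // A B mA mB bA bB.
have [MB HB] := bB; have [MA HA] := bA.
have [B1 B2] := indic_bounded_support HB.
have step chi : test1 chi -> \int[mu2]_p (u p * \1_B p.2 * chi p.1) = 0.
  move=> tchi; have [mc c1 c2] := test_bounds tchi.
  rewrite -(@slab_dubois_reymond _ _ _ mu2 snd _ (fun p => u p * chi p.1) _ _ B mB bB).
  - by apply: eq_Rintegral => p _; rewrite mulrAC.
  - exact: measurable_snd.
  - exact: slab_snd.
  - by move=> phi tphi; exact: u0.
rewrite -(@slab_dubois_reymond _ _ _ mu2 fst _ (fun p => u p * \1_B p.2) _ _ A mA bA).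
- by apply: eq_Rintegral => p _; rewrite mulrAC.
- exact: measurable_fst.
- by apply: slab_fst => //; exact: measurable_indic.
- exact: step.
Qed.

Lemma dubois_reymond2 u : loc2 u ->
  (forall psi, test_function psi -> \int[mu2]_p (u p * psi p) = 0) ->
  ae_eq mu2 setT u (cst 0).
Proof.
move=> lu u0; apply: rectangles_of_tests => // chi phi tc tp.
rewrite -(u0 _ (test_tens tc tp)); apply: eq_Rintegral => p _.
by rewrite mulrA.
Qed.

Lemma is_weak_derivative_ae v u u' g g' : ae_eq mu2 setT u u' ->
  is_weak_derivative v u g -> is_weak_derivative v u' g' -> ae_eq mu2 setT g g'.
Proof.
move=> uu' [/L1_loc2 lu /L1_loc2 lg ug] [/L1_loc2 lu' /L1_loc2 lg' ug'].
have : ae_eq mu2 setT (fun p => g p - g' p) (cst 0).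
  apply: dubois_reymond2; first exact: loc2B.
  move=> psi tpsi; have tD := test_deriveD tpsi v.
  under eq_Rintegral do rewrite mulrBl.
  rewrite RintegralB//; [|exact: loc2_mul_test..].
  apply/eqP; rewrite subr_eq0; apply/eqP/oppr_inj.
  rewrite -ug// -ug'//; apply: ae_eq_Rintegral.
  - by apply/measurable_EFinP; exact: measurable_int (loc2_mul_test lu tD).
  - by apply/measurable_EFinP; exact: measurable_int (loc2_mul_test lu' tD).
  - by apply: filterS uu' => p /= + _ => ->.
by apply: filterS => p /= + _ => /(_ I)/eqP; rewrite subr_eq0 => /eqP.
Qed.

Lemma wderivP v u g : is_weak_derivative v u g -> is_weak_derivative v u (wderiv v u).
Proof. by move=> H; apply: (@getPex _ [set g | is_weak_derivative v u g]); exists g. Qed.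

(** [wderiv] is a choice with a dummy value, so that [u'] has some weak derivative must be supplied
    before the choice can be compared with [g]. *)
Lemma wderiv_ae v u u' g : ae_eq mu2 setT u' u -> is_weak_derivative v u g ->
  (exists h, is_weak_derivative v u' h) -> ae_eq mu2 setT (wderiv v u') g.
Proof. by move=> uu' ug [h /wderivP u'h]; exact: is_weak_derivative_ae uu' u'h ug. Qed.

(** The y-derivative of chi(x) phi(y) falls on phi only, so u phi' + g phi integrates to zero
    against every chi(x). The du Bois-Reymond lemma in x then allows the indicator of [A] in place
    of chi. *)
Lemma strip_y u g (A : set R) : is_weak_derivative dir_y u g -> measurable A ->
  (exists M, A `<=` `]- M, M[%classic) ->
  slab_weak_derivative mu2 snd (fun p => u p * \1_A p.1) (fun p => g p * \1_A p.1).
Proof.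
move=> [/L1_loc2 lu /L1_loc2 lg ug] mA [M AM].
have [A1 A2] := indic_bounded_support AM.
split; [by apply: slab_snd => //; exact: measurable_indic..|].
move=> phi tphi; have tphi' := test1_derive tphi.
have [m1 b1 s1] := test_bounds tphi; have [m2 b2 s2] := test_bounds tphi'.
have su := slab_fst lu m2 b2 s2; have sg := slab_fst lg m1 b1 s1.
have H := @slab_dubois_reymond _ _ _ mu2 fst measurable_fst
  (fun p => u p * derive1 phi p.2 + g p * phi p.2) (slabD su sg) _ A mA (ex_intro _ M AM).
have i1 : mu2.-integrable setT (EFin \o (fun p => u p * derive1 phi p.2 * \1_A p.1)).
  apply: (@slab_mul _ _ R mu2 fst _ (fun p => \1_A p.1) su).
  - by apply: measurable_comp1 => //; exact: measurable_indic.
  - by have [C HC] := A1; exists C.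
  - by have [N HN] := A2; exists N => p; exact: HN.
have i2 : mu2.-integrable setT (EFin \o (fun p => g p * phi p.2 * \1_A p.1)).
  apply: (@slab_mul _ _ R mu2 fst _ (fun p => \1_A p.1) sg).
  - by apply: measurable_comp1 => //; exact: measurable_indic.
  - by have [C HC] := A1; exists C.
  - by have [N HN] := A2; exists N => p; exact: HN.
apply/eqP; rewrite -addr_eq0.
under eq_Rintegral do rewrite mulrAC.
under [X in _ + X]eq_Rintegral do rewrite mulrAC.
rewrite -RintegralD; [|exact: measurableT|exact: i1|exact: i2].
apply/eqP; rewrite -[RHS]H.
  by apply: eq_Rintegral => p _; rewrite mulrDl.
move=> chi tchi; have [mc bc sc] := test_bounds tchi.
have tt := test_tens tchi tphi.
under eq_Rintegral do rewrite mulrDl.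
rewrite RintegralD//; [|exact: (@slab_mul_test _ _ R mu2 fst measurable_fst _ _ su tchi)|exact: (@slab_mul_test _ _ R mu2 fst measurable_fst _ _ sg tchi)].
have := ug _ tt; under eq_Rintegral do rewrite (derive_tensE dir_y _ tchi.1 tphi.1).
move=> E; apply/eqP; rewrite addr_eq0; apply/eqP.
rewrite (_ : \int[mu2]_p (u p * derive1 phi p.2 * chi p.1) =
  \int[mu2]_p (u p * (dir_y.1 * (derive1 chi p.1 * phi p.2) + dir_y.2 * (chi p.1 * derive1 phi p.2)))).
  rewrite E; congr (- _); apply: eq_Rintegral => p _; ring.
by apply: eq_Rintegral => p _; rewrite /dir_y /=; ring.
Qed.

Lemma strip_x u g (A : set R) : is_weak_derivative dir_x u g -> measurable A ->
  (exists M, A `<=` `]- M, M[%classic) ->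
  slab_weak_derivative mu2 fst (fun p => u p * \1_A p.2) (fun p => g p * \1_A p.2).
Proof.
move=> [/L1_loc2 lu /L1_loc2 lg ug] mA [M AM].
have [A1 A2] := indic_bounded_support AM.
split; [by apply: slab_fst => //; exact: measurable_indic..|].
move=> phi tphi; have tphi' := test1_derive tphi.
have [m1 b1 s1] := test_bounds tphi; have [m2 b2 s2] := test_bounds tphi'.
have su := slab_snd lu m2 b2 s2; have sg := slab_snd lg m1 b1 s1.
have H := @slab_dubois_reymond _ _ _ mu2 snd measurable_snd
  (fun p => u p * derive1 phi p.1 + g p * phi p.1) (slabD su sg) _ A mA (ex_intro _ M AM).
have i1 : mu2.-integrable setT (EFin \o (fun p => u p * derive1 phi p.1 * \1_A p.2)).
  apply: (@slab_mul _ _ R mu2 snd _ (fun p => \1_A p.2) su).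
  - by apply: measurable_comp1 => //; exact: measurable_indic.
  - by have [C HC] := A1; exists C.
  - by have [N HN] := A2; exists N => p; exact: HN.
have i2 : mu2.-integrable setT (EFin \o (fun p => g p * phi p.1 * \1_A p.2)).
  apply: (@slab_mul _ _ R mu2 snd _ (fun p => \1_A p.2) sg).
  - by apply: measurable_comp1 => //; exact: measurable_indic.
  - by have [C HC] := A1; exists C.
  - by have [N HN] := A2; exists N => p; exact: HN.
apply/eqP; rewrite -addr_eq0.
under eq_Rintegral do rewrite mulrAC.
under [X in _ + X]eq_Rintegral do rewrite mulrAC.
rewrite -RintegralD; [|exact: measurableT|exact: i1|exact: i2].
apply/eqP; rewrite -[RHS]H.
  by apply: eq_Rintegral => p _; rewrite mulrDl.
move=> chi tchi; have [mc bc sc] := test_bounds tchi.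
have tt := test_tens tphi tchi.
under eq_Rintegral do rewrite mulrDl.
rewrite RintegralD//; [|exact: (@slab_mul_test _ _ R mu2 snd measurable_snd _ _ su tchi)|exact: (@slab_mul_test _ _ R mu2 snd measurable_snd _ _ sg tchi)].
have := ug _ tt; under eq_Rintegral do rewrite (derive_tensE dir_x _ tphi.1 tchi.1).
move=> E; apply/eqP; rewrite addr_eq0; apply/eqP.
rewrite (_ : \int[mu2]_p (u p * derive1 phi p.1 * chi p.2) =
  \int[mu2]_p (u p * (dir_x.1 * (derive1 phi p.1 * chi p.2) + dir_x.2 * (phi p.1 * derive1 chi p.2)))).
  rewrite E; congr (- _); apply: eq_Rintegral => p _; ring.
by apply: eq_Rintegral => p _; rewrite /dir_x /=; ring.
Qed.

End PlaneLemmas.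

(** * Weak derivatives on the line *)

Section Line.
Context {R : realType}.
Local Notation mu1 := (leb1 R).
Implicit Types u g w : R -> R.

Lemma slab_id_locally_integrable u :
  locally_integrable setT u <-> slab_integrable mu1 id u.
Proof.
split=> [[m_u _ iu]|[m_u iu]].
  split => // M; have mM := @measurable_ball1 R M.
  have : mu1.-integrable [set z | `|z| <= M] (EFin \o u).
    apply/integrableP; split.
      by apply/measurable_EFinP; exact: measurable_funS m_u.
    by apply: iu => //; exact: closed_ball_compact.
  move=> H; have := (@integrable_mkcond _ _ R mu1 _ (EFin \o u) mM).1 H; apply: eq_integrable => // t _ /=.
  by rewrite /= patchE indicE; case: ifPn => _; rewrite ?mulr1 ?mulr0.
split => //; first exact: openT.
move=> K _ cK; have [M [_ HM]] := compact_bounded cK.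
have KM : K `<=` [set z | `|z| <= `|M| + 1].
  move=> x Kx; apply: (HM (`|M| + 1)) => //.
  by rewrite (le_lt_trans (ler_norm _)) ?ltrDl.
have mK := compact_measurable cK.
suff /integrableP[_] : mu1.-integrable K (EFin \o u) by [].
have : mu1.-integrable K (EFin \o (fun t => u t * \1_[set z | `|z| <= `|M| + 1] t)).
  by apply: integrableS (iu _).
apply: eq_integrable => // t /set_mem Kt /=; rewrite indicE mem_set ?mulr1//.
exact: KM.
Qed.

Lemma ae_eq0_line u : slab_integrable mu1 id u ->
  (forall B : set R, measurable B -> (exists M, B `<=` `]- M, M[%classic) ->
    \int[mu1]_t (u t * \1_B t) = 0) -> ae_eq mu1 setT u (cst 0).
Proof.
move=> su u0.
have H (n : nat) : ae_eq mu1 setT (fun t => u t * \1_[set z | `|z| <= n%:R] t) (cst 0).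
  apply: ae_eq0_indic; first exact: su.2.
  move=> E mE; rewrite -(u0 ([set z | `|z| <= n%:R] `&` E)).
  - apply: eq_Rintegral => t _; rewrite -mulrA; congr (_ * _).
    by rewrite !indicE in_setI -natrM mulnb.
  - by apply: measurableI => //; exact: measurable_ball1.
  - exists (n%:R + 1) => z [/= zn _]; rewrite in_itv/= -ltr_norml.
    by rewrite (le_lt_trans zn)// ltrDl.
have := ae_foralln (mu := mu1) H; apply: filterS => t Ht _.
have [N HN] : exists N : nat, `|t| <= N%:R.
  by exists (Num.bound `|t|); rewrite ltW// archi_boundP.
by have := Ht N I; rewrite indicE mem_set ?mulr1.
Qed.

(** This makes the line an instance of the slab setting, with the identity as coordinate. *)
Lemma is_weak_derivative1_slab u g : is_weak_derivative1 u g <->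
  slab_weak_derivative mu1 id u g.
Proof.
have dE (phi : R -> R) t : 'D_1 phi t = derive1 phi t by rewrite derive1E.
split=> [[lu lg ug]|[su sg ug]]; split; try exact/slab_id_locally_integrable.
  by move=> phi /test1P/ug <-; apply: eq_Rintegral => t _; rewrite dE.
by move=> phi /test1P/ug <-; apply: eq_Rintegral => t _; rewrite dE.
Qed.

Lemma slab_weak_derivative_ae u u' g g' : ae_eq mu1 setT u u' ->
  slab_weak_derivative mu1 id u g -> slab_weak_derivative mu1 id u' g' ->
  ae_eq mu1 setT g g'.
Proof.
move=> uu' [su sg ug] [su' sg' ug'].
have mid : measurable_fun setT (@id R) by exact: measurable_id.
have sgg : slab_integrable mu1 id (fun t => g t + -1 * g' t).
  apply: slabD => //.
  apply: (@slab_mul_locally_bounded _ _ _ mu1 id mid (cst (-1))) => // M.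
  by exists 1 => x _; rewrite normrN1.
have : ae_eq mu1 setT (fun t => g t + -1 * g' t) (cst 0).
  apply: ae_eq0_line => //.
  move=> B mB bB; apply: (@slab_dubois_reymond _ _ R mu1 id mid _ sgg _ B mB bB).
  move=> phi tphi; have tphi' := test1_derive tphi.
  under eq_Rintegral do rewrite mulN1r mulrBl.
  rewrite RintegralB//; [|exact: (@slab_mul_test _ _ R mu1 id mid _ _ sg tphi)|exact: (@slab_mul_test _ _ R mu1 id mid _ _ sg' tphi)].
  apply/eqP; rewrite subr_eq0; apply/eqP/oppr_inj.
  rewrite -ug// -ug'//; apply: ae_eq_Rintegral.
  - by apply/measurable_EFinP; exact: measurable_int (@slab_mul_test _ _ R mu1 id mid _ _ su tphi').
  - by apply/measurable_EFinP; exact: measurable_int (@slab_mul_test _ _ R mu1 id mid _ _ su' tphi').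
  - by apply: filterS uu' => p /= + _ => ->.
by apply: filterS => p /= + _ => /(_ I)/eqP; rewrite mulN1r subr_eq0 => /eqP.
Qed.

Lemma wderiv1P u g : is_weak_derivative1 u g -> is_weak_derivative1 u (wderiv1 u).
Proof. by move=> H; apply: (@getPex _ [set g | is_weak_derivative1 u g]); exists g. Qed.

Lemma wderiv1_ae u g : is_weak_derivative1 u g -> ae_eq mu1 setT (wderiv1 u) g.
Proof.
move=> ug; have /is_weak_derivative1_slab H := wderiv1P ug.
have uu : ae_eq mu1 setT u u by exact: aeW.
exact: (slab_weak_derivative_ae uu H ((is_weak_derivative1_slab u g).1 ug)).
Qed.

End Line.

(** * Translation invariance in the x-direction *)

Section Translation.
Context {R : realType}.
Local Notation mu1 := (leb1 R).
Local Notation mu2 := (leb2 R).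

Definition shift_x (L : R) (p : R * R) : R * R := (p.1 + L, p.2).

Lemma measurable_shift (L : R) : measurable_fun setT (fun x : R => x + L).
Proof. by apply: measurable_funD. Qed.

Lemma measurable_shift_x (L : R) : measurable_fun setT (shift_x L).
Proof.
apply/measurable_fun_pairP; split => /=; last exact: measurable_snd.
by apply: measurable_funD => //; exact: measurable_fst.
Qed.

(** The image measure agrees with Lebesgue measure on half-open intervals, which characterise it. *)
Lemma lebesgue_shift (L : R) (A : set R) : measurable A ->
  mu1 ((fun x => x + L) @^-1` A) = mu1 A.
Proof.
move=> mA; apply/esym.
have ms := measurable_shift L.
have H := @lebesgue_measure_unique R (pushforward mu1 ((fun x : R => x + L) : measurableTypeR R -> measurableTypeR R)).
apply: (H ms) => // X.
move=> [[a b] _ <-] /=; rewrite /pushforward.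
rewrite (_ : _ @^-1` _ = `]a - L, b - L]%classic); last first.
  by apply/seteqP; split => x /=; rewrite !in_itv/= ltrBlDr lerBrDr.
rewrite !lebesgue_measure_itv/= !lte_fin ltrD2r; case: ifPn => // ab.
by rewrite -!EFinB; congr EFin; ring.
Qed.

(** The image measure has the right value on rectangles, and the product measure is the only one
    that does. *)
Lemma plane_shift (L : R) (A : set (R * R)) : measurable A ->
  mu2 (shift_x L @^-1` A) = mu2 A.
Proof.
move=> mA; apply/esym; have ms := measurable_shift_x L.
pose T2 := (measurableTypeR R * measurableTypeR R)%type.
have H := @product_measure_unique _ _ _ _ R mu1 mu1 (pushforward mu2 (shift_x L : T2 -> T2)).
apply: (H ms) => // X Y mX mY.
transitivity (mu2 (((fun x : R => x + L) @^-1` X) `*` Y)); first by [].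
rewrite product_measure1E//; first by congr (_ * _)%E; exact: lebesgue_shift.
by rewrite -[X in measurable X]setTI; exact: measurable_shift.
Qed.

Lemma plane_shift_ae (L : R) (P : R * R -> Prop) :
  {ae mu2, forall p, P p} -> {ae mu2, forall p, P (shift_x L p)}.
Proof.
move=> [N [mN N0 NP]]; exists (shift_x L @^-1` N); split.
- by rewrite -[X in measurable X]setTI; exact: measurable_shift_x.
- by rewrite plane_shift.
- by move=> p /= nP; apply: NP.
Qed.

Lemma plane_ae_imply (P Q : R * R -> Prop) : (forall p, P p -> Q p) ->
  {ae mu2, forall p, P p} -> {ae mu2, forall p, Q p}.
Proof.
move=> PQ [N [mN N0 NP]]; exists N; split => // p nQ; apply: NP => Pp.
exact/nQ/PQ.
Qed.

Lemma plane_integral_shift (L : R) (f : R * R -> R) :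
  mu2.-integrable setT (EFin \o f) ->
  mu2.-integrable setT (EFin \o (f \o shift_x L)) ->
  \int[mu2]_p f (shift_x L p) = \int[mu2]_p f p.
Proof.
move=> fi fsi; rewrite /Rintegral; congr fine.
pose T2 := (measurableTypeR R * measurableTypeR R)%type.
have ms : measurable_fun setT (shift_x L : T2 -> T2) by exact: measurable_shift_x.
have mf := measurable_int _ fi.
have := @integral_pushforward _ _ _ _ R (shift_x L : T2 -> T2) ms mu2 setT (EFin \o f) mf.
rewrite preimage_setT => /(_ fsi measurableT) <-.
apply: eq_measure_integral => A mA _; exact: plane_shift.
Qed.

Lemma plane_integrable_shift (L : R) (f : R * R -> R) :
  mu2.-integrable setT (EFin \o f) ->
  mu2.-integrable setT (EFin \o (f \o shift_x L)).
Proof.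
move=> /integrableP[mf fi].
pose T2 := (measurableTypeR R * measurableTypeR R)%type.
have ms : measurable_fun setT (shift_x L : T2 -> T2) by exact: measurable_shift_x.
apply/integrableP; split; first exact: (measurableT_comp mf ms).
have mg : measurable_fun setT (fun p : T2 => `|(f p)%:E|%E) by exact: measurableT_comp.
have := @ge0_integral_pushforward _ _ _ _ R (shift_x L : T2 -> T2) ms mu2 setT _ measurableT mg.
rewrite preimage_setT => /(_ (fun _ _ => abse_ge0 _)) <-.
rewrite (eq_measure_integral mu2)//.
by move=> A mA _; exact: plane_shift.
Qed.

End Translation.

Lemma sub_eq0 (V : zmodType) (x z : V) : z = x -> x - z = 0.
Proof. by move=> ->; rewrite subrr. Qed.

(** * The x-derivative of a periodic function over one period *)

Section PeriodicDerivative.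
Context {R : realType}.
Local Notation mu2 := (leb2 R).
Implicit Types u g : R * R -> R.

(** Shifting the step by 1 puts the origin into the limit set. The difference of two such limits is
    then exactly the half-open period [0, L), with no correction at its ends. *)
Lemma sstep_cvg1 (x : R) :
  (fun n : nat => sstep (n.+1%:R * x + 1)) @ \oo --> (\1_(`[0, +oo[%classic) x : R).
Proof.
rewrite indicE; have [x0|x0] := leP 0 x.
  rewrite mem_set /= ?in_itv/= ?x0//; apply: cvg_near_cst; near=> n.
  by apply: sstep1; rewrite lerDr mulr_ge0.
rewrite memNset /= ?in_itv/= ?andbT; last by apply/negP; rewrite -ltNge.
apply: cvg_near_cst; near=> n; apply: sstep0.
rewrite -lerBrDr sub0r -lerNr -mulrN -ler_pdivrMr ?oppr_gt0// div1r.
by rewrite (le_trans (y := n%:R)) ?ler_nat//; near: n; exact: nbhs_infty_ger.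
Unshelve. all: by end_near. Qed.

(* The test function is a difference of translates by [L] of a smooth step, so
   that its derivative integrates to zero against [L]-periodic functions. *)
Lemma periodic_dx_integral0 (L : R) u g (J : set R) : 0 < L ->
  x_periodic L u -> is_weak_derivative dir_x u g ->
  measurable J -> (exists M, J `<=` `]- M, M[%classic) ->
  \int[mu2]_p (g p * \1_J p.2 * \1_(`[0, L[%classic) p.1) = 0.
Proof.
move=> L0 uper ug mJ bJ.
have mfst : measurable_fun setT (@fst R R) by exact: measurable_fst.
have [su sg W] := strip_x ug mJ bJ.
pose chi (n : nat) x := sstep (n.+1%:R * x + 1) + - 1 * sstep (n.+1%:R * x + (1 - n.+1%:R * L)) : R.
have chiE n x : chi n x = sstep (n.+1%:R * x + 1) - sstep (n.+1%:R * (x - L) + 1).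
  by rewrite /chi mulN1r; congr (_ - sstep _); ring.
have Cchi n : Cinf (chi n).
  apply: CinfD; first exact/Cinf_comp_affine/Cinf_sstep.
  apply: (@CinfM _ (cst (-1))); first exact: Cinf_cst.
  exact/Cinf_comp_affine/Cinf_sstep.
have chi_supp n x : L + 1 <= `|x| -> chi n x = 0.
  move=> Lx; have n1 : 1 <= n.+1%:R :> R by rewrite ler1n.
  rewrite chiE; have [x0|x0] := ltP x 0.
    move: Lx; rewrite ltr0_norm// => Lx.
    by rewrite !sstep0 ?subr0//; nra.
  move: Lx; rewrite ger0_norm// => Lx.
  by rewrite !sstep1 ?subrr//; nra.
have tchi n : test1 (chi n) by split => //; exists (L + 1); exact: chi_supp.
have dchi n x : derive1 (chi n) x = n.+1%:R * derive1 sstep (n.+1%:R * x + 1)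
    - n.+1%:R * derive1 sstep (n.+1%:R * (x - L) + 1).
  have Cs b : Cinf (fun x : R => sstep (n.+1%:R * x + b)) by exact/Cinf_comp_affine/Cinf_sstep.
  have d1 := Cinf_is_derive x (Cs 1).
  have d2 := is_deriveZ (-1) (Cinf_is_derive x (Cs (1 - n.+1%:R * L))).
  have dd := is_deriveD d1 d2.
  rewrite derive1E (@derive_val _ _ _ _ _ _ _ dd) scale_mulE mulN1r.
  rewrite !derive1_comp_affine; [|exact: Cinf_sstep..].
  by have -> : n.+1%:R * x + (1 - n.+1%:R * L) = n.+1%:R * (x - L) + 1 by ring.
have chi_int n : \int[mu2]_p (g p * \1_J p.2 * chi n p.1) = 0.
  apply: oppr_inj; rewrite oppr0 -W//.
  (* The contribution of the left step to the derivative of [chi n]. By periodicity of [u], the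
     right step contributes the translate of [f] by [L], and the two integrals cancel. *)
  pose f p := u p * \1_J p.2 * (n.+1%:R * derive1 sstep (n.+1%:R * p.1 + 1)).
  have tf : test1 (fun x : R => n.+1%:R * derive1 sstep (n.+1%:R * x + 1)).
    split.
      apply: (@CinfM _ (cst _)); first exact: Cinf_cst.
      exact/Cinf_comp_affine/Cinf_derive1/Cinf_sstep.
    have n1 : 1 <= n.+1%:R :> R by rewrite ler1n.
    exists 2 => x x2; have [x0|x0] := ltP x 0.
      rewrite derive_sstep0 ?mulr0//; move: x2; rewrite ltr0_norm// => x2.
      nra.
    rewrite derive_sstep1 ?mulr0//; move: x2; rewrite ger0_norm// => x2.
    nra.
  have fi : mu2.-integrable setT (EFin \o f).
    exact: (@slab_mul_test _ _ R mu2 fst mfst _ _ su tf).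
  have fsi := plane_integrable_shift (- L) fi.
  have E : ae_eq mu2 setT (fun p => u p * \1_J p.2 * derive1 (chi n) p.1)
      (fun p => f p - f (shift_x (- L) p)).
    apply: plane_ae_imply (plane_shift_ae (- L) uper) => p /= up _.
    rewrite dchi /f /= mulrBr; congr (_ - _ * _ * _).
    by rewrite -up/= subrK -surjective_pairing.
  rewrite (@ae_eq_Rintegral _ _ R mu2 _ _ _ _ E).
  - rewrite (@RintegralB _ _ R mu2 setT f (f \o shift_x (- L)) measurableT fi fsi).
    exact: (sub_eq0 (plane_integral_shift fi fsi)).
  - have := @slab_mul_test _ _ R mu2 fst mfst _ _ su (test1_derive (tchi n)).
    by move/measurable_int/measurable_EFinP.
  - apply: measurable_funB.
      by apply/measurable_EFinP; exact: measurable_int fi.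
    by apply/measurable_EFinP; exact: measurable_int fsi.
apply: (@Rintegral_lim0 _ _ R mu2 (fun n p => g p * \1_J p.2 * chi n p.1) _
  (fun p => `|g p * \1_J p.2 * \1_[set z | `|z| <= L + 1] p.1|)).
- move=> n; apply: measurable_funM; first exact: sg.1.
  by apply: (measurable_comp1 mfst); exact: Cinf_measurable.
- move=> p; apply: cvgM; first exact: cvg_cst.
  rewrite (_ : \1_(`[0, L[%classic) p.1 = \1_(`[0, +oo[%classic) p.1 - \1_(`[0, +oo[%classic) (p.1 - L) :> R).
    rewrite (_ : (fun n => _) = fun n => sstep (n.+1%:R * p.1 + 1) - sstep (n.+1%:R * (p.1 - L) + 1)).
      by apply: cvgB; exact: sstep_cvg1.
    by apply/funext => n; exact: chiE.
  have in0 (x : R) : (x \in [set` `[0%R, +oo[]) = (0 <= x).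
    by apply/idP/idP; rewrite inE /= in_itv/= andbT.
  have inL (x : R) : (x \in [set` `[0%R, L[]) = (0 <= x < L).
    by apply/idP/idP; rewrite inE /= in_itv/=.
  rewrite !indicE !in0 inL subr_ge0 ltNge.
  case: (leP 0 p.1) => /= p0; case: (leP L p.1) => /= pL; rewrite ?subr0 ?subrr//.
  by have := lt_trans p0 (lt_le_trans L0 pL); rewrite ltxx.
- exact: integrable_norm (sg.2 _).
- move=> n p; rewrite normrM [leRHS]normrM ler_wpM2l// indicE.
  have [pL|pL] := leP `|p.1| (L + 1); last by rewrite chi_supp ?normr0//; exact: ltW.
  rewrite mem_set// normr1 chiE ler_norml.
  have := sstep_ge0 (n.+1%:R * p.1 + 1); have := sstep_le1 (n.+1%:R * p.1 + 1).
  have := sstep_ge0 (n.+1%:R * (p.1 - L) + 1); have := sstep_le1 (n.+1%:R * (p.1 - L) + 1).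
  by move=> *; apply/andP; split; lra.
- exact: chi_int.
Qed.

(** Serves for the two edges of the band, where the pointwise flux identities fail. *)
Lemma hline_null (c : R) : {ae mu2, forall p, p.2 <> c}.
Proof.
exists (setT `*` [set c]); split.
- exact: measurableX.
- rewrite product_measure1E// [X in (_ * X)%E](_ : _ = 0%E) ?mule0//.
  exact: lebesgue_measure_set1.
- by case=> x y /= /contrapT ->.
Qed.

End PeriodicDerivative.

(** * The exponential weight, the explicit profile and its flux *)

Section ExponentialWeight.
Context {R : realType}.
Local Notation mu1 := (leb1 R).

(** By symmetry only the positive half-line matters, and there the function is 1/k times the density
    of the exponential law. *)
Lemma integrable_expR_norm (k : R) : 0 < k ->
  mu1.-integrable setT (EFin \o (fun x : R => expR (- k * `|x|))).
Proof.
move=> k0.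
have cf : continuous (fun x : R => expR (- k * `|x|)).
  move=> x; apply: (@continuous_comp _ _ _ (fun x : R => - k * `|x|) expR).
    by apply: cvgM; [exact: cvg_cst|exact: norm_continuous].
  exact: continuous_expR.
have mf : measurable_fun setT (fun x : R => expR (- k * `|x|)) by exact: continuous_measurable_fun.
apply/integrableP; split; first exact/measurable_EFinP.
under eq_integral do rewrite /= ger0_norm ?expR_ge0//.
rewrite (@ge0_symfun_integralT R (fun x => expR (- k * `|x|))) //; last first.
  by move=> x /=; rewrite normrN.
rewrite lte_mul_pinfty//.
have [me ie] := integrableP _ _ _ (integrable_scale k^-1 (integrable_exponential_pdf k0)).
apply: le_lt_trans ie.
have mpos : measurable [set x : R | 0 <= x] by rewrite -set_itvcy.
apply: (@le_trans _ _ (\int[mu1]_(x in [set x : R | (0 <= x)%R]) `|(k^-1 * exponential_pdf k x)%:E|)%E).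
  apply: ge0_le_integral => //.
  - by apply/measurable_EFinP; exact: measurable_funTS.
  - by apply: measurableT_comp => //; exact: measurable_funTS.
  - move=> x /= x0; rewrite lee_fin exponential_pdfE// ger0_norm// mulrA mulVf ?mul1r ?gt_eqF//.
    by rewrite ger0_norm// expR_ge0.
by apply: ge0_subset_integral => //; apply: measurableT_comp.
Qed.

End ExponentialWeight.

Section Profile.
Context {R : realType}.
Variables (fl fr a : R).

(** The distance from [y] to the interval [fl, fr]. The coefficients 1 and -1 are spelled out to
    match [approximable_affine]. *)
Definition band_dist (y : R) : R := ramp (1 * y + - fr) + ramp (-1 * y + fl).
Definition band_dist' (y : R) : R :=
  1 * heaviside (1 * y + - fr) + -1 * heaviside (-1 * y + fl).

Definition weight (y : R) : R := expR (- (Num.sqrt a)^-1 * band_dist y + 0).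
Definition weight' (y : R) : R := - (Num.sqrt a)^-1 * weight y * band_dist' y.

(* Continuity of [a S' - 1_band] across the edges of the band forces this slope. *)
Definition slope : R := 2 / (Num.sqrt a * (2 * Num.sqrt a + (fr - fl))).

(** The bracket is the projection of [y] onto [fl, fr] minus the midpoint: affine on the band,
    constant on either side. Multiplied by [weight], which is 1 on the band, it gives the affine
    part and both exponential tails at once. *)
Definition ridge (y : R) : R :=
  slope * (ramp (1 * y + - fl) + -1 * ramp (1 * y + - fr) + - ((fr - fl) / 2)).
Definition ridge' (y : R) : R :=
  slope * (1 * heaviside (1 * y + - fl) + -1 * (1 * heaviside (1 * y + - fr))).

Definition profile (y : R) : R := ridge y * weight y.
Definition profile' (y : R) : R := ridge y * weight' y + weight y * ridge' y.

Lemma approximable_eq (F F' f f' : R -> R) : F =1 F' -> f =1 f' ->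
  approximable F f -> approximable F' f'.
Proof. by move=> /funext -> /funext ->. Qed.

Lemma derive1_cst0 (c x : R) : derive1 (cst c) x = 0.
Proof. by rewrite derive1_cst. Qed.

Lemma approximable_scale (c : R) F f : approximable F f ->
  approximable (fun x => c * F x) (fun x => c * f x).
Proof.
move=> FA; apply: approximable_eq (approximableM (approximable_Cinf (Cinf_cst c)) FA) => x //.
by rewrite derive1_cst0 mulr0 addr0.
Qed.

Lemma approximable_addc (c : R) F f : approximable F f ->
  approximable (fun x => F x + c) f.
Proof.
move=> FA; apply: approximable_eq (approximableD FA (approximable_Cinf (Cinf_cst c))) => x //.
by rewrite derive1_cst0 addr0.
Qed.

Lemma approximable_weight : approximable weight weight'.
Proof.
have DA : approximable band_dist band_dist'.
  apply: approximableD; first exact: (approximable_affine 1 (- fr) (@approximable_ramp R)).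
  exact: (approximable_affine (-1) fl (@approximable_ramp R)).
have CE := Cinf_comp_affine (- (Num.sqrt a)^-1) 0 (@Cinf_exp R).
apply: approximable_eq (approximable_comp CE DA) => // y.
rewrite derive1_comp_affine; last exact: Cinf_exp.
by rewrite derive1E (@derive_val _ _ _ _ _ _ _ (is_derive_expR _)).
Qed.

Lemma approximable_profile : approximable profile profile'.
Proof.
apply: approximableM; last exact: approximable_weight.
apply: approximable_scale; apply: approximable_addc; apply: approximableD.
  exact: (approximable_affine 1 (- fl) (@approximable_ramp R)).
apply: approximable_scale.
exact: (approximable_affine 1 (- fr) (@approximable_ramp R)).
Qed.

Hypothesis flr : fl < fr.
Hypothesis a0 : 0 < a.

Let sa := Num.sqrt a.
Let sa0 : 0 < sa. Proof. by rewrite sqrtr_gt0. Qed.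
Let sasa : sa * sa = a. Proof. by rewrite -expr2 sqr_sqrtr// ltW. Qed.
Let w := fr - fl.
Let w0 : 0 < w. Proof. by rewrite subr_gt0. Qed.
Let den0 : 0 < 2 * sa + w. Proof. by rewrite addr_gt0// mulr_gt0. Qed.

Lemma slope_gt0 : 0 < slope.
Proof. by rewrite divr_gt0// mulr_gt0. Qed.

Lemma ramp1 (x : R) : 0 <= x -> ramp x = x.
Proof.
rewrite le_eqVlt => /predU1P[<-|x0]; first by rewrite /ramp mul0r.
by rewrite /ramp heaviside1// mulr1.
Qed.

Lemma ramp0 (x : R) : x <= 0 -> ramp x = 0.
Proof. by move=> x0; rewrite /ramp heaviside0// mulr0. Qed.

Lemma heaviside_bool (x : R) : heaviside x = (0 < x)%R%:R.
Proof.
by have [x0|x0] := ltP 0 x; [rewrite heaviside1|rewrite heaviside0].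
Qed.

Lemma weight_gt0 y : 0 < weight y. Proof. exact: expR_gt0. Qed.

Lemma weight_band y : fl <= y <= fr -> weight y = 1.
Proof.
have flr' := flr.
move=> /andP[y1 y2]; rewrite /weight /band_dist !ramp0; try lra.
by rewrite !addr0 mulr0 expR0.
Qed.

Lemma weight'_le y : `|weight' y| <= sa^-1 * weight y.
Proof.
have W0 : 0 <= sa^-1 * weight y by rewrite mulr_ge0 ?invr_ge0 ?(ltW sa0) ?(ltW (weight_gt0 _)).
rewrite /weight' -/sa !mulNr normrN normrM (ger0_norm W0) ler_piMr//.
rewrite /band_dist' !heaviside_bool; case: ltP => h1; case: ltP => h2 /=.
- by rewrite !mulr1 subrr normr0.
- by rewrite mulr0 addr0 mulr1 normr1.
- by rewrite mulr0 add0r mulr1 normrN1.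
- by rewrite !mulr0 addr0 normr0.
Qed.

Lemma ridge_le y : `|ridge y| <= slope * (w / 2).
Proof.
have flr' := flr.
rewrite /ridge normrM (gtr0_norm slope_gt0) ler_pM2l ?slope_gt0// -/w.
have wE : w = fr - fl by [].
have [y1|y1] := leP y fl.
  rewrite !ramp0; try lra.
  by rewrite mulr0 !add0r normrN ger0_norm// divr_ge0// ltW.
have [y2|y2] := leP y fr.
  rewrite ramp1; last lra. rewrite ramp0; last lra.
  by rewrite ler_norml; apply/andP; split; lra.
rewrite !ramp1; try lra.
by rewrite ler_norml; apply/andP; split; lra.
Qed.

Lemma ridge'_le y : `|ridge' y| <= slope.
Proof.
have flr' := flr.
rewrite /ridge' normrM (gtr0_norm slope_gt0) ler_piMr ?(ltW slope_gt0)//.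
rewrite !heaviside_bool.
have [y1|y1] := ltP 0 (1 * y + - fl); have [y2|y2] := ltP 0 (1 * y + - fr) => /=.
- by rewrite !mulr1 subrr normr0.
- by rewrite !mulr0 addr0 mulr1 normr1.
- by lra.
- by rewrite !mulr0 addr0 normr0.
Qed.

Lemma profile_le y : `|profile y| <= slope * (w / 2) * weight y.
Proof.
by rewrite /profile normrM (gtr0_norm (weight_gt0 y)) ler_pM2r ?weight_gt0// ridge_le.
Qed.

Lemma profile'_le y : `|profile' y| <= (slope * (w / 2) * sa^-1 + slope) * weight y.
Proof.
rewrite /profile' (le_trans (ler_normD _ _))// mulrDl lerD//.
  by rewrite normrM -mulrA ler_pM// ?ridge_le ?weight'_le.
by rewrite normrM (gtr0_norm (weight_gt0 y)) mulrC ler_pM2r ?weight_gt0// ridge'_le.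
Qed.

Lemma profile'_band y : fl < y < fr -> profile' y = slope.
Proof.
have flr' := flr.
move=> /andP[y1 y2]; rewrite /profile' /weight' weight_band ?(ltW y1) ?(ltW y2)//.
rewrite /band_dist' /ridge' !heaviside_bool.
rewrite (_ : (0 < 1 * y + - fr) = false); last by apply/negbTE; rewrite -leNgt; lra.
rewrite (_ : (0 < -1 * y + fl) = false); last by apply/negbTE; rewrite -leNgt; lra.
rewrite (_ : (0 < 1 * y + - fl) = true); last lra.
by rewrite /=; ring.
Qed.

(** The constant of proportionality between the flux a S' - 1_band and the weight, read off inside
    the band, where the weight is 1. [kappaE] is its value read off outside; that the two agree is
    the defining property of [slope]. *)
Let kappa := a * slope - 1.

Let kappaE : kappa = - (sa * (slope * (w / 2))).
Proof.
rewrite /kappa /slope -/sa -/w -sasa.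
by field; rewrite !gt_eqF.
Qed.

(** Outside the band weight' is plus or minus weight / sqrt a and the ridge is constant, so both
    identities reduce to [kappaE]; inside, the weight is 1 and its derivative is 0. At the edges the
    chosen values of the derivatives break them. *)
Lemma flux_identities y : y <> fl -> y <> fr ->
  a * profile' y = kappa * weight y + \1_(`]fl, fr[%classic) y /\
  kappa * weight' y = profile y * \1_(~` `]fl, fr[%classic) y.
Proof.
have flr' := flr.
move=> /eqP yl /eqP yr.
have in_band : (y \in [set` `]fl, fr[]) = (fl < y < fr).
  by apply/idP/idP; rewrite inE /= in_itv/=.
rewrite !indicE in_setC in_band.
have [y1|y1|y1] := ltgtP y fl; last by rewrite y1 eqxx in yl.
  have e1 : weight' y = sa^-1 * weight y.
    rewrite /weight' -/sa /band_dist' !heaviside_bool.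
    rewrite (_ : (0 < 1 * y + - fr) = false); last by apply/negbTE; rewrite -leNgt; lra.
    by rewrite (_ : (0 < -1 * y + fl) = true) /=; [ring|lra].
  have e2 : ridge y = - (slope * (w / 2)).
    by rewrite /ridge !ramp0; [rewrite -/w; ring|lra..].
  have e3 : ridge' y = 0.
    rewrite /ridge' !heaviside_bool.
    rewrite (_ : (0 < 1 * y + - fr) = false); last by apply/negbTE; rewrite -leNgt; lra.
    rewrite (_ : (0 < 1 * y + - fl) = false); last by apply/negbTE; rewrite -leNgt; lra.
    by rewrite !mulr0 addr0 mulr0.
  rewrite /profile' /profile e1 e2 e3 kappaE -sasa /=.
  by split; field; rewrite gt_eqF.
have [y2|y2|y2] := ltgtP y fr; last by rewrite y2 eqxx in yr.
  rewrite /= profile'_band ?y1// weight_band ?(ltW y1) ?(ltW y2)//; split; first by rewrite /kappa; ring.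
  rewrite mulr0 /weight' /band_dist' !heaviside_bool.
  rewrite (_ : (0 < 1 * y + - fr) = false); last by apply/negbTE; rewrite -leNgt; lra.
  rewrite (_ : (0 < -1 * y + fl) = false); last by apply/negbTE; rewrite -leNgt; lra.
  by rewrite !mulr0 addr0 !mulr0.
have e1 : weight' y = - (sa^-1 * weight y).
  rewrite /weight' -/sa /band_dist' !heaviside_bool.
  rewrite (_ : (0 < -1 * y + fl) = false); last by apply/negbTE; rewrite -leNgt; lra.
  by rewrite (_ : (0 < 1 * y + - fr) = true) /=; [ring|lra].
have e2 : ridge y = slope * (w / 2).
  rewrite /ridge !ramp1; [|lra..].
  by rewrite /w; field.
have e3 : ridge' y = 0.
  rewrite /ridge' !heaviside_bool.
  rewrite (_ : (0 < 1 * y + - fr) = true); last lra.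
  rewrite (_ : (0 < 1 * y + - fl) = true); last lra.
  by rewrite /=; ring.
rewrite /profile' /profile e1 e2 e3 kappaE -sasa /=.
by split; field; rewrite gt_eqF.
Qed.

Section Identity.
Context d (T : measurableType d) (mu : {measure set T -> \bar R}).
Variable y : T -> R.
Hypothesis my : measurable_fun setT y.

(** The function weight u has weak derivative weight g + weight' u, with zero total integral. By
    [flux_identities], [kappa] times this derivative is, off the edges, the left integrand minus the
    right one. *)
Lemma profile_identity (u g : T -> R) :
  slab_weak_derivative mu y u g ->
  {ae mu, forall t, y t <> fl} -> {ae mu, forall t, y t <> fr} ->
  mu.-integrable setT (EFin \o (fun t => weight (y t) * u t)) ->
  mu.-integrable setT (EFin \o (fun t => weight (y t) * g t)) ->
  [/\ mu.-integrable setT (EFin \o (fun t => profile' (y t) * g t)),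
      mu.-integrable setT (EFin \o (fun t => profile (y t) * u t)),
      mu.-integrable setT (EFin \o (fun t => g t * \1_(`]fl, fr[%classic) (y t))) &
  a * \int[mu]_t (profile' (y t) * g t) +
  \int[mu]_t (profile (y t) * u t * \1_(~` `]fl, fr[%classic) (y t)) =
  \int[mu]_t (g t * \1_(`]fl, fr[%classic) (y t))].
Proof.
move=> ug yl yr iu ig.
have [mW mW'] := approximable_measurable approximable_weight.
have [mS mS'] := approximable_measurable approximable_profile.
have m_u : measurable_fun setT u by case: ug => -[].
have mg : measurable_fun setT g by case: ug => _ [].
have mband : measurable_fun setT (\1_(`]fl, fr[%classic) : R -> R) by exact: measurable_indic.
have mout : measurable_fun setT (\1_(~` `]fl, fr[%classic) : R -> R).
  by apply: measurable_indic; exact: measurableC.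
(* The profile, its derivative, weight' and the indicator of the band are all bounded by a constant
   times the weight, so the two assumed integrabilities imply every other one. *)
have dom (h v : T -> R) (H : R -> R) (C : R) : measurable_fun setT H -> measurable_fun setT v ->
    (forall x, `|H x| <= C * weight x) ->
    mu.-integrable setT (EFin \o (fun t => weight (y t) * v t)) ->
    mu.-integrable setT (EFin \o (fun t => H (y t) * v t)).
  move=> mH mv HC iv.
  apply: (integrable_bound _ (integrable_scale C iv)).
    by apply: measurable_funM => //; exact: measurable_comp1.
  move=> t; rewrite mulrA normrM [leRHS]normrM ler_wpM2r//.
  by rewrite (le_trans (HC _))// ler_norm.
have i1 := dom u g profile' _ mS' mg profile'_le ig.
have i2 := dom u u profile _ mS m_u profile_le iu.
have i3 := dom u u weight' _ mW' m_u weight'_le iu.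
have i4 : mu.-integrable setT (EFin \o (fun t => g t * \1_(`]fl, fr[%classic) (y t))).
  have : mu.-integrable setT (EFin \o (fun t => \1_(`]fl, fr[%classic) (y t) * g t)).
    apply: (dom u g _ 1) => // x; rewrite mul1r indicE; case: (boolP (_ \in _)) => xb.
      by rewrite normr1 weight_band//; move: xb; rewrite inE /= in_itv/= => /andP[/ltW -> /ltW ->].
    by rewrite normr0 ltW// weight_gt0.
  by apply: eq_integrable => // t _ /=; rewrite mulrC.
have i5 : mu.-integrable setT (EFin \o (fun t => profile (y t) * u t * \1_(~` `]fl, fr[%classic) (y t))).
  apply: integrable_mul_bounded i2; first exact: (measurable_comp1 my).
  by exists 1 => t; rewrite indicE; case: (_ \in _); rewrite ?normr1 ?normr0.
split => //.
have W := slab_weak_derivative_mul my approximable_weight ug.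
have iW : mu.-integrable setT (EFin \o (fun t => weight (y t) * g t + weight' (y t) * u t)).
  by have := integrableD measurableT ig i3; apply: eq_integrable.
have W0 := slab_weak_derivative_total my W iu iW.
apply/eqP; rewrite -subr_eq0 -RintegralZl// -RintegralD//; last exact: integrable_scale.
have i6 : mu.-integrable setT (EFin \o (fun t => a * (profile' (y t) * g t) +
    profile (y t) * u t * \1_(~` `]fl, fr[%classic) (y t))).
  by have := integrableD measurableT (integrable_scale a i1) i5; apply: eq_integrable.
rewrite -RintegralB//.
rewrite (_ : \int[mu]_t _ = \int[mu]_t (kappa * (weight (y t) * g t + weight' (y t) * u t))).
  by rewrite RintegralZl// W0 mulr0.
apply: ae_eq_Rintegral.
- apply: measurable_funB; first by apply/measurable_EFinP; exact: measurable_int i6.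
  by apply/measurable_EFinP; exact: measurable_int i4.
- by apply/measurable_EFinP; exact: measurable_int (integrable_scale kappa iW).
- apply: filterS2 yl yr => t tl tr _.
  have [f1 f2] := flux_identities tl tr.
  rewrite mulrA f1 mulrDr [kappa * (weight' _ * _)]mulrA f2; ring.
Qed.

End Identity.

(** The distance to the band is at least |y| - |fl| - |fr|, so the squared weight is dominated by a
    multiple of exp(-2 |y| / sqrt a). *)
Lemma weight_Lfun2 : weight \in Lfun (leb1 R) 2%:E.
Proof.
have [mW _] := approximable_measurable approximable_weight.
pose c := `|fl| + `|fr|.
have k0 : 0 < 2 * sa^-1 by rewrite mulr_gt0// invr_gt0.
have key (y : R) : weight y ^+ 2 <= expR (2 * sa^-1 * c) * expR (- (2 * sa^-1) * `|y|).
  rewrite -expRD /weight -/sa addr0 -expRM_natl ler_expR.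
  have D : `|y| - c <= band_dist y.
    rewrite /band_dist /c; have := ler_norm fl; have := ler_norm (- fl); have := ler_norm fr; have := ler_norm (- fr).
    rewrite !normrN => *; have := normr_ge0 fl; have := normr_ge0 fr => *.
    have r0 (x : R) : 0 <= ramp x.
      by have [x0|x0] := leP x 0; [rewrite ramp0|rewrite ramp1 ltW].
    have r1 (x : R) : x <= ramp x.
      by have [x0|x0] := leP x 0; [rewrite ramp0|rewrite ramp1 ?(ltW x0)].
    have := r0 (1 * y + - fr); have := r1 (1 * y + - fr).
    have := r0 (-1 * y + fl); have := r1 (-1 * y + fl).
    by case: (ger0P y) => *; lra.
  have -> : 2 * sa^-1 * c + - (2 * sa^-1) * `|y| = 2 * (- sa^-1 * (`|y| - c)) by ring.
  by rewrite ler_pM2l// !mulNr lerN2 ler_pM2l// invr_gt0.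
apply/Lfun2P; split => //.
apply: (integrable_bound _ (integrable_scale (expR (2 * sa^-1 * c)) (integrable_expR_norm k0))).
  exact: measurable_funX.
move=> y; rewrite [leLHS]ger0_norm ?sqr_ge0//.
exact: le_trans (key y) (ler_norm _).
Qed.

Lemma profile_Lfun2 : profile \in Lfun (leb1 R) 2%:E /\ profile' \in Lfun (leb1 R) 2%:E.
Proof.
have [mS mS'] := approximable_measurable approximable_profile.
have scaleW (C : R) : (fun y => C * weight y) \in Lfun (leb1 R) 2%:E.
  have /Lfun2P[mW iW] := weight_Lfun2; apply/Lfun2P; split; first exact: measurable_funM.
  have := integrable_scale (C ^+ 2) iW; apply: eq_integrable => // y _ /=.
  by rewrite exprMn.
split; [apply: (Lfun2_le _ _ (scaleW (slope * (w / 2))))|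
        apply: (Lfun2_le _ _ (scaleW (slope * (w / 2) * sa^-1 + slope)))] => // y;
  by rewrite (le_trans _ (ler_norm _))// ?profile_le ?profile'_le.
Qed.

End Profile.

(** * Energies, and the problem on the line *)

Lemma equationB (R : pzRingType) (c x y z w v : R) : c * x + z = v -> c * y + w = v ->
  c * (x - y) + (z - w) = 0.
Proof. by move=> <- E; apply/eqP; rewrite mulrBr addrACA -opprD E subrr. Qed.

Section Energy.
Context d (T : measurableType d) (R : realType) (mu : {measure set T -> \bar R}).

Lemma ae_eq0_ge0 (f : T -> R) : (forall t, 0 <= f t) ->
  mu.-integrable setT (EFin \o f) -> \int[mu]_t f t = 0 -> ae_eq mu setT f (cst 0).
Proof.
move=> fge0 fi f0.
have mf : measurable_fun setT (EFin \o f) by exact: measurable_int fi.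
have I0 : (\int[mu]_t `|(f t)%:E| = 0)%E.
  under eq_integral do rewrite gee0_abs ?lee_fin//.
  by rewrite -[LHS]fineK ?(integrable_fin_num _ fi)//; congr EFin.
have H := (ae_eq_integral_abs mu measurableT mf).1 I0.
by apply: filterS H => t /= + _ => /(_ I)[].
Qed.

Lemma two_energies (a : R) (f g : T -> R) : 0 < a ->
  (forall t, 0 <= f t) -> (forall t, 0 <= g t) ->
  mu.-integrable setT (EFin \o f) -> mu.-integrable setT (EFin \o g) ->
  a * \int[mu]_t f t + \int[mu]_t g t = 0 ->
  ae_eq mu setT f (cst 0) /\ ae_eq mu setT g (cst 0).
Proof.
move=> a0 fge0 gge0 fi gi E.
have f0 : 0 <= \int[mu]_t f t by exact: Rintegral_ge0.
have g0 : 0 <= \int[mu]_t g t by exact: Rintegral_ge0.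
have /eqP := E; rewrite paddr_eq0 ?mulr_ge0 ?(ltW a0)// mulf_eq0 gt_eqF//= => /andP[/eqP f00 /eqP g00].
by split; exact: ae_eq0_ge0.
Qed.

End Energy.

Section LineProblem.
Context {R : realType}.
Local Notation mu1 := (leb1 R).

Lemma test_integral_derive0 (phi : R -> R) : test1 phi ->
  \int[mu1]_t derive1 phi t = 0.
Proof.
move=> tphi; have [Cphi [M HM]] := tphi; have [_ [M' HM']] := test1_derive tphi.
(* Beyond [N] both [phi] and its derivative vanish: the derivative may be integrated over [-N, N]
   only, and [phi] is zero at both ends. *)
pose N := `|M| + `|M'| + 1.
have N0 : 0 < N by rewrite ltr_pwDr// addr_ge0.
have MN : M <= N by rewrite /N; have := ler_norm M; have := normr_ge0 M'; lra.
have M'N : M' <= N by rewrite /N; have := ler_norm M'; have := normr_ge0 M; lra.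
have -> : \int[mu1]_t derive1 phi t = \int[mu1]_(t in `[- N, N]) derive1 phi t.
  rewrite [RHS]Rintegral_mkcond; apply: eq_Rintegral => t _; rewrite patchE; case: ifPn => // tN.
  apply: HM'; rewrite leNgt; apply: contra tN => tM'; rewrite inE /= in_itv/= -ler_norml ltW//.
  exact: lt_le_trans tM' M'N.
have NN : - N < N by lra.
rewrite /Rintegral (@continuous_FTC2 _ _ phi)//.
- by rewrite (HM N) ?(HM (- N)) ?normrN ?(gtr0_norm N0)// -EFinB subrr.
- by apply: continuous_subspaceT => x; apply: Cinf_continuous; exact: Cinf_derive1.
- split.
  + by move=> x _; exact: Cinf_derivable.
  + by apply: cvg_at_right_filter; exact: Cinf_continuous.
  + by apply: cvg_at_left_filter; exact: Cinf_continuous.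
Qed.

Lemma slab_bounded (w : R -> R) : measurable_fun setT w ->
  (forall M, exists C, forall x, `|x| <= M -> `|w x| <= C) -> slab_integrable mu1 id w.
Proof.
move=> mw wB.
have s1 : slab_integrable mu1 id (cst 1 : R -> R).
  split => // M; have mM := @measurable_ball1 R M.
  have fM : (mu1 [set z : R | (`|z| <= M)%R] < +oo)%E.
    by apply: compact_finite_measure; exact: closed_ball_compact.
  by have := @indic_integrable _ _ R mu1 _ mM fM; apply: eq_integrable => // t _ /=; rewrite mul1r.
have := @slab_mul_locally_bounded _ _ R mu1 id (@measurable_id _ _ _) w (cst 1) mw wB s1.
by rewrite (_ : (fun t => w t * cst 1 t) = w); [|apply/funext => t /=; rewrite mulr1].
Qed.

(** The product rule applied to the constant 1, whose weak derivative is 0. *)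
Lemma approximable_weak_derivative (F f : R -> R) : approximable F f ->
  slab_weak_derivative mu1 id F f.
Proof.
move=> FA.
have W : slab_weak_derivative mu1 id (cst 1 : R -> R) (cst 0).
  split.
  - by apply: slab_bounded => // M; exists 1 => x _; rewrite normr1.
  - by apply: slab_bounded => // M; exists 0 => x _; rewrite normr0.
  - move=> phi tphi.
    under eq_Rintegral do rewrite mul1r.
    under [in RHS]eq_Rintegral do rewrite mul0r.
    by rewrite test_integral_derive0// Rintegral_cst//= mul0r oppr0.
have := @slab_weak_derivative_mul _ _ R mu1 id (@measurable_id _ _ _) F f _ _ FA W.
rewrite (_ : (fun t => F t * cst 1 t) = F); last by apply/funext => t /=; rewrite mulr1.
by rewrite (_ : (fun t => F t * cst 0 t + f t * cst 1 t) = f); [|apply/funext => t /=; rewrite mulr0 add0r mulr1].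
Qed.

Lemma H1_line_wderiv (u : R -> R) : H1_line u ->
  [/\ u \in Lfun mu1 2%:E, is_weak_derivative1 u (wderiv1 u) & wderiv1 u \in Lfun mu1 2%:E].
Proof.
move=> [u2 [g ug g2]]; split => //; first exact: wderiv1P ug.
apply: Lfun2_ae (wderiv1_ae ug) g2.
by have [_ [? _ _] _] := wderiv1P ug.
Qed.

Lemma is_weak_derivative1B (u v g h : R -> R) :
  is_weak_derivative1 u g -> is_weak_derivative1 v h ->
  is_weak_derivative1 (fun t => u t - v t) (fun t => g t - h t).
Proof.
move=> /is_weak_derivative1_slab[su sg ug] /is_weak_derivative1_slab[sv sh vh].
apply/is_weak_derivative1_slab.
have mid : measurable_fun setT (@id R) by exact: measurable_id.
have slabB w z : slab_integrable mu1 id w -> slab_integrable mu1 id z ->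
    slab_integrable mu1 id (fun t => w t - z t).
  move=> /slab_id_locally_integrable lw /slab_id_locally_integrable lz.
  by apply/slab_id_locally_integrable; exact: locally_integrableB.
split; [exact: slabB|exact: slabB|].
move=> phi tphi; have tphi' := test1_derive tphi.
have i1 := @slab_mul_test _ _ R mu1 id mid _ _ su tphi'.
have i2 := @slab_mul_test _ _ R mu1 id mid _ _ sv tphi'.
have i3 := @slab_mul_test _ _ R mu1 id mid _ _ sg tphi.
have i4 := @slab_mul_test _ _ R mu1 id mid _ _ sh tphi.
under eq_Rintegral do rewrite mulrBl.
under [in RHS]eq_Rintegral do rewrite mulrBl.
by rewrite RintegralB// RintegralB// ug// vh// opprB addrC opprK.
Qed.

Lemma H1_lineB (u v : R -> R) : H1_line u -> H1_line v -> H1_line (fun t => u t - v t).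
Proof.
move=> [u2 [g ug g2]] [v2 [h vh h2]]; split; first exact: Lfun2B.
by exists (fun t => g t - h t); [exact: is_weak_derivative1B|exact: Lfun2B].
Qed.

Lemma point_null (c : R) : {ae mu1, forall t, t <> c}.
Proof.
exists [set c]; split => //; first exact: lebesgue_measure_set1.
by move=> x /= /contrapT ->.
Qed.

Variables (fl fr a : R).
Hypothesis flr : fl < fr.
Hypothesis a0 : 0 < a.

Lemma H1_line_profile : H1_line (profile fl fr a).
Proof.
have [S2 S2'] := profile_Lfun2 flr a0; split => //.
exists (profile' fl fr a) => //; apply/is_weak_derivative1_slab.
exact/approximable_weak_derivative/approximable_profile.
Qed.

Lemma wderiv1_profile : ae_eq mu1 setT (wderiv1 (profile fl fr a)) (profile' fl fr a).
Proof.
apply: wderiv1_ae; apply/is_weak_derivative1_slab.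
exact/approximable_weak_derivative/approximable_profile.
Qed.

Lemma line_out (v w : R -> R) : v \in Lfun mu1 2%:E -> w \in Lfun mu1 2%:E ->
  \int[mu1]_t (v t * w t) - \int[mu1]_(t in `]fl, fr[) (v t * w t) =
  \int[mu1]_t (v t * w t * \1_(~` `]fl, fr[%classic) t).
Proof.
move=> v2 w2; have vw := Lfun2_mul v2 w2.
have mb : measurable (`]fl, fr[%classic : set R) by exact: measurable_itv.
by rewrite (@Rintegral_indicU _ _ R mu1 (fun t => v t * w t) _ mb vw) [X in _ - X]Rintegral_indic addrAC subrr add0r.
Qed.

Lemma profile_solves_ode : solves_ode fl fr a (profile fl fr a).
Proof.
split; first exact: H1_line_profile.
move=> u /H1_line_wderiv[u2 ug g2].
have [S2 S2'] := profile_Lfun2 flr a0; have W2 := weight_Lfun2 fl fr a0.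
rewrite line_out// [RHS]Rintegral_indic.
have wd := wderiv1_profile.
have mwd : measurable_fun setT (wderiv1 (profile fl fr a)).
  by have [_ [_ /wderiv1P[_ [? _ _] _] _]] := H1_line_profile.
(* The equation mentions the chosen derivative of the profile; it equals the explicit one almost
   everywhere. *)
have -> : \int[mu1]_t (wderiv1 (profile fl fr a) t * wderiv1 u t) =
    \int[mu1]_t (profile' fl fr a t * wderiv1 u t).
  apply: ae_eq_Rintegral.
  - by apply: measurable_funM => //; exact: Lfun2_measurable g2.
  - by apply: measurable_funM; [exact: Lfun2_measurable S2'|exact: Lfun2_measurable g2].
  - by apply: filterS wd => t /= + _ => ->.
have mid : measurable_fun setT (@id R) by exact: measurable_id.
have [_ _ _ E] := @profile_identity R fl fr a flr a0 _ _ mu1 id mid _ _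
  ((is_weak_derivative1_slab _ _).1 ug) (point_null fl) (point_null fr)
  (Lfun2_mul W2 u2) (Lfun2_mul W2 g2).
exact: E.
Qed.

Lemma ode_unique (S1 S2 : R -> R) : solves_ode fl fr a S1 -> solves_ode fl fr a S2 ->
  ae_eq mu1 setT S1 S2.
Proof.
move=> [H1 E1] [H2 E2].
have HD := H1_lineB H1 H2; have {}E1 := E1 _ HD; have {}E2 := E2 _ HD.
have [u2 ug g2] := H1_line_wderiv H1; have [v2 vh h2] := H1_line_wderiv H2.
have [d2 dk k2] := H1_line_wderiv HD.
have kE : ae_eq mu1 setT (wderiv1 (fun t => S1 t - S2 t)) (fun t => wderiv1 S1 t - wderiv1 S2 t).
  by apply: wderiv1_ae; exact: is_weak_derivative1B.
move: E1 E2; rewrite !line_out//.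
set k := wderiv1 (fun t => S1 t - S2 t) in dk k2 kE *.
set D := (fun t => S1 t - S2 t) in HD d2 dk *.
pose out : R -> R := \1_(~` `]fl, fr[%classic).
have mout : measurable_fun setT out by apply: measurable_indic; exact: measurableC.
have bout : exists C, forall t, `|out t| <= C.
  by exists 1 => t; rewrite /out indicE; case: (_ \in _); rewrite ?normr1 ?normr0.
move=> E1 E2.
(* Subtracting the two equations tested with [D] leaves the energy of [D]. The indicator may be
   squared because it takes the values 0 and 1, which puts the second term in the form of a
   square. *)
have E : a * \int[mu1]_t (k t ^+ 2) + \int[mu1]_t ((D t * out t) ^+ 2) = 0.
  have -> : \int[mu1]_t (k t ^+ 2) =
      \int[mu1]_t (wderiv1 S1 t * k t) - \int[mu1]_t (wderiv1 S2 t * k t).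
    rewrite -RintegralB//; [|exact: Lfun2_mul..].
    apply: ae_eq_Rintegral.
    - by apply: measurable_funX; exact: Lfun2_measurable k2.
    - by apply: measurable_funB; apply: measurable_funM;
        [exact: Lfun2_measurable g2|exact: Lfun2_measurable k2|exact: Lfun2_measurable h2|exact: Lfun2_measurable k2].
    - by apply: filterS kE => t /= + _ => ->//; rewrite -mulrBl expr2.
  have -> : \int[mu1]_t ((D t * out t) ^+ 2) =
      \int[mu1]_t (S1 t * D t * out t) - \int[mu1]_t (S2 t * D t * out t).
    rewrite -RintegralB//.
    - apply: eq_Rintegral => t _; rewrite exprMn -!mulrBl -/(D t) -expr2; congr (_ * _).
      by rewrite /out indicE; case: (_ \in _); rewrite ?expr1n ?expr0n.
    - by apply: integrable_mul_bounded => //; exact: Lfun2_mul.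
    - by apply: integrable_mul_bounded => //; exact: Lfun2_mul.
  exact: (equationB E1 E2).
have mD := Lfun2_measurable d2; have mk := Lfun2_measurable k2.
have [k0' out0'] : ae_eq mu1 setT (fun t => k t ^+ 2) (cst 0) /\
    ae_eq mu1 setT (fun t => (D t * out t) ^+ 2) (cst 0).
  apply: two_energies a0 _ _ _ _ E.
  - by move=> t; exact: sqr_ge0.
  - by move=> t; exact: sqr_ge0.
  - by have /Lfun2P[] := k2.
  - have /Lfun2P[_ iD] := d2.
    apply: integrable_bound iD _; first by apply: measurable_funX; exact: measurable_funM.
    move=> t; rewrite exprMn normrM ler_piMr//.
    by rewrite /out indicE; case: (_ \in _); rewrite ?expr1n ?expr0n ?normr1 ?normr0.
have k0 : ae_eq mu1 setT k (cst 0).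
  by apply: filterS k0' => t /= + _ => /(_ I)/eqP; rewrite sqrf_eq0 => /eqP.
have out0 : ae_eq mu1 setT (fun t => D t * out t) (cst 0).
  by apply: filterS out0' => t /= + _ => /(_ I)/eqP; rewrite sqrf_eq0 => /eqP.
have mid : measurable_fun setT (@id R) by exact: measurable_id.
have Dout : {ae mu1, forall t, ~ `]fl, fr[%classic (id t) -> D t = 0}.
  apply: filterS out0 => t /= H nt; have := H I; rewrite /out indicE mem_set//= mulr1.
  exact.
have dkS := (is_weak_derivative1_slab _ _).1 dk.
(* The energy says nothing about the size of [D] on the band; zero derivative together with
   vanishing outside excludes a nonzero constant there. *)
have Z := @slab_weak_derivative_zero _ _ R mu1 id mid fl fr _ _ dkS k0 Dout.
have : ae_eq mu1 setT D (cst 0).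
  by apply: ae_eq0_line => [|B mB _]; [case: dkS|exact: Z].
by apply: filterS => t /= + _ => /(_ I)/eqP; rewrite subr_eq0 => /eqP.
Qed.

End LineProblem.

(** * From the line to the plane: lifting, strips, periodic spaces *)

Section PeriodicStrip.
Context {R : realType}.
Local Notation mu1 := (leb1 R).
Local Notation mu2 := (leb2 R).
Implicit Types u w : R * R -> R.

Lemma loc2_of_bounded (w : R * R -> R) : measurable_fun setT w ->
  (exists C, forall p, `|w p| <= C) -> loc2 w.
Proof.
move=> mw wC; split => // M.
have iS := @indic_integrable _ _ R mu2 _ (square_measurable M) (square_finite M).
have := @integrable_mul_bounded _ _ R mu2 _ w mw wC iS.
by apply: eq_integrable => // p _ /=; rewrite mulrC.
Qed.

(** A real-valued integral equal to 0 could hide an infinite one; integrability of each slice rules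
    this out, so the inner extended integrals really vanish. *)
Lemma Rintegral0_fubini_y (h : R * R -> R) : mu2.-integrable setT (EFin \o h) ->
  (forall x, mu1.-integrable setT (EFin \o (fun y => h (x, y)))) ->
  (forall x, \int[mu1]_y h (x, y) = 0) -> \int[mu2]_p h p = 0.
Proof.
move=> ih ihx h0; rewrite /Rintegral -integral12_prod_meas1//.
rewrite integral0_eq// => x _; rewrite /fubini_F.
have := h0 x; rewrite /Rintegral => H.
rewrite -[LHS]fineK ?H//; exact: integrable_fin_num (ihx x).
Qed.

Lemma Rintegral0_fubini_x (h : R * R -> R) : mu2.-integrable setT (EFin \o h) ->
  (forall y, mu1.-integrable setT (EFin \o (fun x => h (x, y)))) ->
  (forall y, \int[mu1]_x h (x, y) = 0) -> \int[mu2]_p h p = 0.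
Proof.
move=> ih ihx h0; rewrite /Rintegral -integral21_prod_meas1//.
rewrite integral0_eq// => y _; rewrite /fubini_G.
have := h0 y; rewrite /Rintegral => H.
rewrite -[LHS]fineK ?H//; exact: integrable_fin_num (ihx y).
Qed.

Section Lift.
Variables (F f : R -> R).
Hypothesis FA : approximable F f.
Hypothesis FB : exists C, forall x, `|F x| <= C.
Hypothesis fB : exists C, forall x, `|f x| <= C.

Let mF : measurable_fun setT F. Proof. by have [] := approximable_measurable FA. Qed.
Let mf : measurable_fun setT f. Proof. by have [] := approximable_measurable FA. Qed.
Let lF : loc2 (fun p => F p.2).
Proof.
apply: loc2_of_bounded; first exact: (measurable_comp1 measurable_snd).
by have [C HC] := FB; exists C.
Qed.
Let lf : loc2 (fun p => f p.2).
Proof.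
apply: loc2_of_bounded; first exact: (measurable_comp1 measurable_snd).
by have [C HC] := fB; exists C.
Qed.

(** On each vertical line the slice of the test function is a test function, so the one-dimensional
    identity holds there; Fubini integrates it over x. *)
Lemma lift_dir_y : is_weak_derivative dir_y (fun p : R * R => F p.2) (fun p => f p.2).
Proof.
have [sF sf W] := approximable_weak_derivative FA.
split; [exact/L1_loc2|exact/L1_loc2|move=> psi tpsi].
have tD := test_deriveD tpsi dir_y.
have i1 := loc2_mul_test lF tD; have i2 := loc2_mul_test lf tpsi.
apply/eqP; rewrite -addr_eq0 -RintegralD//; apply/eqP.
have mid : measurable_fun setT (@id R) by exact: measurable_id.
apply: Rintegral0_fubini_y.
- by have := integrableD measurableT i1 i2; apply: eq_integrable.
- move=> x /=; have [tx dx] := test_slice_y tpsi x.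
  have j1 := @slab_mul_test _ _ R mu1 id mid _ _ sF (test1_derive tx).
  have j2 := @slab_mul_test _ _ R mu1 id mid _ _ sf tx.
  by have := integrableD measurableT j1 j2; rewrite dx; apply: eq_integrable.
- move=> x /=; have [tx dx] := test_slice_y tpsi x.
  have j1 := @slab_mul_test _ _ R mu1 id mid _ _ sF (test1_derive tx).
  have j2 := @slab_mul_test _ _ R mu1 id mid _ _ sf tx.
  have := W _ tx; rewrite dx in j1 * => E.
  by rewrite RintegralD// E addNr.
Qed.

(** On a horizontal line F(y) is a constant factor, and the x-derivative of a compactly supported
    slice integrates to zero. *)
Lemma lift_dir_x : is_weak_derivative dir_x (fun p : R * R => F p.2) (cst 0).
Proof.
split; [exact/L1_loc2| |move=> psi tpsi].
  by apply/L1_loc2/loc2_of_bounded => //; exists 0 => p; rewrite normr0.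
have tD := test_deriveD tpsi dir_x.
have i1 := loc2_mul_test lF tD.
under [in RHS]eq_Rintegral do rewrite mul0r.
rewrite [in RHS]Rintegral_cst// mul0r oppr0.
have base y : mu1.-integrable setT (EFin \o (fun x => 'D_dir_x psi (x, y))) /\
    \int[mu1]_x 'D_dir_x psi (x, y) = 0.
  have [ty dy] := test_slice_x tpsi y.
  split; last by have := test_integral_derive0 ty; rewrite dy.
  have mid : measurable_fun setT (@id R) by exact: measurable_id.
  have s1 : slab_integrable mu1 id (cst 1 : R -> R).
    by apply: slab_bounded => // M; exists 1 => x _; rewrite normr1.
  have := @slab_mul_test _ _ R mu1 id mid _ _ s1 (test1_derive ty); rewrite dy.
  by apply: eq_integrable => // x _ /=; rewrite mul1r.
apply: Rintegral0_fubini_x => // y /=; have [b1 b2] := base y.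
  exact: integrable_scale.
by rewrite RintegralZl// b2 mulr0.
Qed.

End Lift.

(** By Tonelli, the inner integral of the square is a constant times the indicator of [A], which has
    finite measure. *)
Lemma Lfun2_strip (h : R -> R) (A : set R) : h \in Lfun mu1 2%:E -> measurable A ->
  (mu1 A < +oo)%E -> (fun p => h p.2 * \1_A p.1) \in Lfun mu2 2%:E.
Proof.
move=> /Lfun2P[mh ih] mA fA.
have m1 : measurable_fun setT (fun p : R * R => h p.2 * \1_A p.1).
  apply: measurable_funM; first exact: (measurable_comp1 measurable_snd).
  by apply: (measurable_comp1 measurable_fst); exact: measurable_indic.
have m2 : measurable_fun setT (fun p : R * R => (h p.2 * \1_A p.1) ^+ 2) by exact: measurable_funX.
apply/Lfun2P; split => //.
apply/integrable12ltyP; first exact/measurable_EFinP.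
pose K := \int[mu1]_y (h y ^+ 2).
have KE : (\int[mu1]_y (h y ^+ 2)%:E = K%:E)%E.
  by rewrite /K /Rintegral fineK//; exact: integrable_fin_num ih.
have iA := integrable_scale K (@indic_integrable _ _ R mu1 _ mA fA).
have [_] := integrableP _ _ _ iA; apply: le_lt_trans.
rewrite le_eqVlt; apply/orP; left; apply/eqP; apply: eq_integral => x _ /=.
have K0 : 0 <= K by apply: Rintegral_ge0 => y _; exact: sqr_ge0.
rewrite ger0_norm ?mulr_ge0// indicE; case: (x \in A) => /=.
  rewrite mulr1 -KE; apply: eq_integral => y _.
  by rewrite mulr1 ger0_norm// sqr_ge0.
rewrite mulr0 integral0_eq// => y _.
by rewrite mulr0 expr0n /= normr0.
Qed.

Definition cell_x (L : R) : set R := `[0, L[%classic.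

Lemma cell_x_finite L : (mu1 (cell_x L) < +oo)%E.
Proof. by rewrite /cell_x lebesgue_measure_itv/=; case: ifPn => // _; rewrite -EFinB ltry. Qed.

Lemma cell_x_bounded L : exists M, cell_x L `<=` `]- M, M[%classic.
Proof.
exists (`|L| + 1) => x; rewrite /cell_x /= !in_itv/= => /andP[x0 xL].
by have := ler_norm L; have := normr_ge0 L => *; apply/andP; split; lra.
Qed.

Lemma measurable_cell_x L : measurable (cell_x L).
Proof. exact: measurable_itv. Qed.

Lemma indic_unit L p : \1_(unit_region L) p = \1_(cell_x L) p.1 :> R.
Proof.
by rewrite !indicE; congr ((_ : bool)%:R); apply/idP/idP; rewrite !inE /unit_region /= => // -[].
Qed.

Lemma L2_on_unitE L u : L2_on (unit_region L) u <->
  (fun p => u p * \1_(cell_x L) p.1) \in Lfun mu2 2%:E.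
Proof.
rewrite /L2_on patch_indic (_ : u \* _ = (fun p => u p * \1_(cell_x L) p.1))//.
by apply/funext => p /=; rewrite indic_unit.
Qed.

Lemma L2_loc_loc2 u : L2_loc u -> loc2 u.
Proof.
move=> u2; apply/L1_loc2 => K cK; have [M KM] := compact_subset_square cK.
apply: Lfun1_of_Lfun2_finite; [exact: compact_measurable2| |exact: u2].
apply: le_lt_trans (square_finite M); apply: le_measure => //; rewrite inE.
  exact: compact_measurable2.
exact: square_measurable.
Qed.

Lemma measurable_unit_region L : measurable (unit_region L : set (R * R)).
Proof. by apply: measurableX => //; exact: measurable_itv. Qed.

Lemma Lfun2_patch_ae (D : set (R * R)) (u w : R * R -> R) : measurable D ->
  measurable_fun setT u -> ae_eq mu2 setT u w -> L2_on D w -> L2_on D u.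
Proof.
move=> mD m_u uw; rewrite /L2_on !patch_indic; apply: Lfun2_ae.
  by apply: measurable_funM => //; exact: measurable_indic.
by apply: plane_ae_imply uw => p /= + _ => ->.
Qed.

(** Two weak derivatives of the same function agree almost everywhere, so the chosen one inherits
    the integrability of the one that [H1_per] provides. *)
Lemma H1_per_wderiv L u v : H1_per L u -> v \in [:: dir_x; dir_y] ->
  [/\ is_weak_derivative v u (wderiv v u), L2_loc (wderiv v u) &
      L2_on (unit_region L) (wderiv v u)].
Proof.
move=> [_ _ _ H] /H[g [ug g2 gu]]; have uw := wderivP ug.
have uu : ae_eq mu2 setT u u by exact: aeW.
have E := is_weak_derivative_ae uu uw ug.
have [_ /L1_loc2[mw _] _] := uw.
split => //; last by apply: Lfun2_patch_ae gu => //; exact: measurable_unit_region.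
by move=> K cK; apply: Lfun2_patch_ae (g2 _ cK) => //; exact: compact_measurable2.
Qed.

Lemma is_weak_derivativeB v u u' g g' : is_weak_derivative v u g ->
  is_weak_derivative v u' g' ->
  is_weak_derivative v (fun p => u p - u' p) (fun p => g p - g' p).
Proof.
move=> [/L1_loc2 lu /L1_loc2 lg ug] [/L1_loc2 lu' /L1_loc2 lg' ug'].
split; [by apply/L1_loc2; exact: loc2B..|move=> psi tpsi].
have tD := test_deriveD tpsi v.
under eq_Rintegral do rewrite mulrBl.
under [in RHS]eq_Rintegral do rewrite mulrBl.
rewrite RintegralB; [|exact: measurableT|exact: loc2_mul_test lu tD|exact: loc2_mul_test lu' tD].
rewrite RintegralB; [|exact: measurableT|exact: loc2_mul_test lg tpsi|exact: loc2_mul_test lg' tpsi].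
by rewrite ug// ug'// opprB addrC opprK.
Qed.

Lemma L2_onB D u w : L2_on D u -> L2_on D w -> L2_on D (fun p => u p - w p).
Proof.
rewrite /L2_on !patch_indic => u2 w2.
have E : (fun t => (u \* \1_D) t - (w \* \1_D) t) = (fun p => u p - w p) \* \1_D.
  by apply/funext => p /=; rewrite mulrBl.
rewrite -E; exact: Lfun2B.
Qed.

Lemma H1_perB L u w : H1_per L u -> H1_per L w -> H1_per L (fun p => u p - w p).
Proof.
move=> [up u2 uu Hu] [wp w2 wu Hw]; split.
- have [N [mN N0 NP]] := up; have [N' [mN' N0' NP']] := wp.
  exists (N `|` N'); split; first exact: measurableU.
    by rewrite null_set_setU.
  move=> p /= np; apply: contrapT => /not_orP[n1 n2]; apply: np.
  have -> : u (p.1 + L, p.2) = u p by apply: contrapT => h; apply: n1; exact: NP.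
  by have -> : w (p.1 + L, p.2) = w p by apply: contrapT => h; apply: n2; exact: NP'.
- by move=> K cK; apply: L2_onB; [exact: u2|exact: w2].
- exact: L2_onB.
- move=> v vd; have [g [g1 g2 g3]] := Hu v vd; have [h [h1 h2 h3]] := Hw v vd.
  exists (fun p => g p - h p); split; first exact: is_weak_derivativeB.
    by move=> K cK; apply: L2_onB; [exact: g2|exact: h2].
  exact: L2_onB.
Qed.

Lemma H1_per_lift L (F f : R -> R) : approximable F f ->
  (exists C, forall x, `|F x| <= C) -> (exists C, forall x, `|f x| <= C) ->
  F \in Lfun mu1 2%:E -> f \in Lfun mu1 2%:E -> H1_per L (fun p => F p.2).
Proof.
move=> FA FB fB F2 f2.
have unit2 h : h \in Lfun mu1 2%:E -> L2_on (unit_region L) (fun p => h p.2).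
  move=> h2; apply/L2_on_unitE; apply: Lfun2_strip => //; first exact: measurable_cell_x.
  exact: cell_x_finite.
have locl2 h : h \in Lfun mu1 2%:E -> L2_loc (fun p => h p.2).
  move=> h2 K cK; have [M KM] := compact_subset_square cK.
  have mB := @measurable_ball1 R M.
  have fB' : (mu1 [set z : R | (`|z| <= M)%R] < +oo)%E.
    by apply: compact_finite_measure; exact: closed_ball_compact.
  rewrite /L2_on patch_indic; apply: (Lfun2_le _ _ (Lfun2_strip h2 mB fB')).
    apply: measurable_funM; last by apply: measurable_indic; exact: compact_measurable2.
    by apply: (measurable_comp1 measurable_snd); exact: Lfun2_measurable h2.
  move=> p; rewrite normrM [leRHS]normrM ler_wpM2l// !indicE.
  case: (boolP (p \in K)) => [/set_mem/KM[p1 _]|_]; last by rewrite normr0.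
  by rewrite mem_set.
have zero2 : cst 0 \in Lfun mu1 2%:E by exact: Lfun2_0.
split; [by apply: aeW|exact: locl2|exact: unit2|].
move=> v; rewrite !inE => /orP[] /eqP ->.
  exists (cst 0); split; first exact: lift_dir_x FA FB.
    exact: (locl2 (cst 0)).
  exact: (unit2 (cst 0)).
exists (fun p => f p.2); split; [exact: lift_dir_y|exact: locl2|exact: unit2].
Qed.

End PeriodicStrip.

(** * The periodic problem on the plane: existence and uniqueness *)

Section PlaneProblem.
Context {R : realType}.
Local Notation mu1 := (leb1 R).
Local Notation mu2 := (leb2 R).
Implicit Types u w : R * R -> R.

Lemma plane_ae2 (P Q S : R * R -> Prop) : (forall p, P p -> Q p -> S p) ->
  {ae mu2, forall p, P p} -> {ae mu2, forall p, Q p} -> {ae mu2, forall p, S p}.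
Proof.
move=> PQS [N [mN N0 NP]] [N' [mN' N0' NP']]; exists (N `|` N'); split.
- exact: measurableU.
- by rewrite null_set_setU.
- move=> p nS; apply: contrapT => /not_orP[n1 n2]; apply: nS.
  by apply: PQS; apply: contrapT => h; [exact/n1/NP|exact/n2/NP'].
Qed.

Lemma plane_ae_and (P Q : R * R -> Prop) :
  {ae mu2, forall p, P p} -> {ae mu2, forall p, Q p} -> {ae mu2, forall p, P p /\ Q p}.
Proof. exact: plane_ae2. Qed.

Lemma approximable0 : approximable (cst 0 : R -> R) (cst 0).
Proof.
by apply: approximable_eq (approximable_Cinf (Cinf_cst 0)) => // x; rewrite derive1_cst.
Qed.

Lemma indic_idem (A : set R) (x : R) : \1_A x * \1_A x = \1_A x :> R.
Proof. by rewrite indicE; case: (_ \in _); rewrite ?mulr1 ?mulr0. Qed.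

Lemma mul_indic (A : set R) (x y z : R) : y * \1_A x * (z * \1_A x) = y * z * \1_A x.
Proof. by rewrite mulrACA indic_idem. Qed.

Lemma sum4_indic (A : set R) (x a b c d a' b' c' d' : R) :
  a * \1_A x * (a' * \1_A x) + b * \1_A x * (b' * \1_A x) +
  c * \1_A x * (c' * \1_A x) + d * \1_A x * (d' * \1_A x) =
  (a * a' + b * b' + c * c' + d * d') * \1_A x.
Proof. by rewrite !mul_indic -!mulrDl. Qed.

Lemma energyB (i x y z w x1 y1 z1 w1 x2 y2 z2 w2 : R) :
  x = x1 - x2 -> y = y1 - y2 -> z = z1 - z2 -> w = w1 - w2 ->
  (x * x + y * y + z * z + w * w) * i =
  (x1 * x + y1 * y + z1 * z + w1 * w) * i - (x2 * x + y2 * y + z2 * z + w2 * w) * i.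
Proof. by move=> -> -> -> ->; ring. Qed.

Lemma sum4_squares_eq0 (x y z w : R) :
  x * x + y * y + z * z + w * w = 0 -> y = 0 /\ w = 0.
Proof.
have ge0 t : 0 <= t * t :> R by rewrite -expr2 sqr_ge0.
move=> /eqP; rewrite !paddr_eq0 ?addr_ge0// !mulf_eq0 !orbb.
by move=> /andP[/andP[/andP[_ /eqP ->] _] /eqP ->].
Qed.

Lemma indic_band_cell (fl fr L : R) (p : R * R) :
  \1_(band_cell fl fr L) p = \1_(cell_x L) p.1 * \1_(`]fl, fr[%classic) p.2 :> R.
Proof. by rewrite !indicE -natrM mulnb in_setX. Qed.

Lemma indic_outside (fl fr L : R) (p : R * R) : \1_(unit_region L `\` band_cell fl fr L) p =
  \1_(cell_x L) p.1 * \1_(~` `]fl, fr[%classic) p.2 :> R.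
Proof.
rewrite !indicE in_setD in_setC /unit_region /band_cell !in_setX in_setT andbT.
rewrite -natrM mulnb -/(cell_x L); congr ((_ : bool)%:R).
by case: (p.1 \in cell_x L); case: (p.2 \in _).
Qed.

(** An equality of propositions, so that it rewrites both goals and hypotheses; with indicators all
    integrals range over the whole plane. *)
Lemma pde_indicators (fl fr a L : R) (f g h : R * R -> R) :
  (a * \int[mu2]_(p in unit_region L) f p +
    \int[mu2]_(p in unit_region L `\` band_cell fl fr L) g p =
    \int[mu2]_(p in band_cell fl fr L) h p) =
  (a * \int[mu2]_p (f p * \1_(unit_region L) p) +
    \int[mu2]_p (g p * \1_(unit_region L `\` band_cell fl fr L) p) =
    \int[mu2]_p (h p * \1_(band_cell fl fr L) p)).
Proof.
by rewrite -(Rintegral_indic mu2 (unit_region L)) -(Rintegral_indic mu2 (_ `\` _))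
  -(Rintegral_indic mu2 (band_cell fl fr L)).
Qed.

Lemma H1_per_loc2 L u : H1_per L u -> loc2 u.
Proof. by case=> _ /L2_loc_loc2. Qed.

Lemma H1_per_unit L u : H1_per L u ->
  (fun p => u p * \1_(cell_x L) p.1) \in Lfun mu2 2%:E.
Proof. by case=> _ _ /L2_on_unitE. Qed.

Lemma H1_per_wderiv_unit L u v : H1_per L u -> v \in [:: dir_x; dir_y] ->
  (fun p => wderiv v u p * \1_(cell_x L) p.1) \in Lfun mu2 2%:E.
Proof. by move=> Hu vd; have [_ _ /L2_on_unitE] := H1_per_wderiv Hu vd. Qed.

Lemma dir_x_in : (dir_x : R * R) \in [:: dir_x; dir_y].
Proof. by rewrite inE eqxx. Qed.

Lemma dir_y_in : (dir_y : R * R) \in [:: dir_x; dir_y].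
Proof. by rewrite !inE eqxx orbT. Qed.

Variables (fl fr a L : R).
Hypothesis flr : fl < fr.
Hypothesis a0 : 0 < a.
Hypothesis L0 : 0 < L.

Let A := cell_x L.
Let mA : measurable A. Proof. exact: measurable_cell_x. Qed.
Let bA : exists M, A `<=` `]- M, M[%classic. Proof. exact: cell_x_bounded. Qed.
Let I := (`]fl, fr[%classic : set R).
Let mI : measurable I. Proof. exact: measurable_itv. Qed.
Let bI : exists M, I `<=` `]- M, M[%classic.
Proof.
exists (`|fl| + `|fr|) => x; rewrite /I /= !in_itv/= => /andP[x1 x2].
have := ler_norm fr; have := ler_norm (- fl); have := normr_ge0 fl; have := normr_ge0 fr.
by rewrite normrN => *; apply/andP; split; lra.
Qed.

Definition band_solution : R * R -> R * R := fun p => (0, profile fl fr a p.2).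

Lemma profile_bounded : (exists C, forall x, `|profile fl fr a x| <= C) /\
  (exists C, forall x, `|profile' fl fr a x| <= C).
Proof.
have w1 x : weight fl fr a x <= 1.
  rewrite /weight addr0 -expR0 ler_expR mulNr oppr_le0 mulr_ge0 ?invr_ge0 ?sqrtr_ge0//.
  have r0 (z : R) : 0 <= ramp z.
    by have [z0|z0] := leP z 0; [rewrite ramp0|rewrite ramp1 ltW].
  by rewrite addr_ge0.
have m0 := ltW (slope_gt0 flr a0).
have h0 : 0 <= (fr - fl) / 2 by rewrite divr_ge0// subr_ge0 ltW.
split.
  exists (slope fl fr a * ((fr - fl) / 2)) => x; rewrite (le_trans (profile_le flr a0 x))//.
  by rewrite ler_piMr// mulr_ge0.
exists (slope fl fr a * ((fr - fl) / 2) * (Num.sqrt a)^-1 + slope fl fr a) => x.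
rewrite (le_trans (profile'_le flr a0 x))// ler_piMr// addr_ge0// mulr_ge0 ?invr_ge0 ?sqrtr_ge0//.
by rewrite mulr_ge0.
Qed.

Lemma H1_per_band_solution : H1_per_vec L band_solution.
Proof.
have [S2 S2'] := profile_Lfun2 flr a0; have [B B'] := profile_bounded.
split; last exact: (H1_per_lift L (approximable_profile fl fr a)).
apply: (H1_per_lift L approximable0); try exact: Lfun2_0.
  by exists 0 => x; rewrite normr0.
by exists 0 => x; rewrite normr0.
Qed.

Lemma band_solution_wderiv :
  [/\ is_weak_derivative dir_x (fst \o band_solution) (cst 0),
      is_weak_derivative dir_y (fst \o band_solution) (cst 0),
      is_weak_derivative dir_x (snd \o band_solution) (cst 0) &
      is_weak_derivative dir_y (snd \o band_solution) (fun p => profile' fl fr a p.2)].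
Proof.
have [B B'] := profile_bounded.
have B0 : exists C, forall x : R, `|cst 0 x : R| <= C by exists 0 => x; rewrite normr0.
split.
- exact: (lift_dir_x approximable0).
- exact: (lift_dir_y approximable0).
- exact: (lift_dir_x (approximable_profile fl fr a)).
- exact: (lift_dir_y (approximable_profile fl fr a)).
Qed.

Lemma frobenius_integrable s t : H1_per_vec L s -> H1_per_vec L t ->
  mu2.-integrable setT (EFin \o (fun p => frobenius_grad s t p * \1_(unit_region L) p)).
Proof.
move=> [s1 s2] [t1 t2].
have P u w v : H1_per L u -> H1_per L w -> v \in [:: dir_x; dir_y] ->
    mu2.-integrable setT (EFin \o (fun p => wderiv v u p * \1_A p.1 * (wderiv v w p * \1_A p.1))).
  by move=> Hu Hw vd; apply: Lfun2_mul; exact: H1_per_wderiv_unit.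
have i1 := P _ _ _ s1 t1 dir_x_in; have i2 := P _ _ _ s1 t1 dir_y_in.
have i3 := P _ _ _ s2 t2 dir_x_in; have i4 := P _ _ _ s2 t2 dir_y_in.
have := integrableD measurableT (integrableD measurableT (integrableD measurableT i1 i2) i3) i4.
apply: eq_integrable => // p _; congr EFin; rewrite indic_unit.
exact: (sum4_indic A p.1 (wderiv dir_x (fst \o s) p) (wderiv dir_y (fst \o s) p)
  (wderiv dir_x (snd \o s) p) (wderiv dir_y (snd \o s) p)
  (wderiv dir_x (fst \o t) p) (wderiv dir_y (fst \o t) p)
  (wderiv dir_x (snd \o t) p) (wderiv dir_y (snd \o t) p)).
Qed.

(** Only the second component of the test field and its y-derivative meet the gradient of the
    solution. Cut off to one period in x, they form a slab weak derivative, to which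
    [profile_identity] applies. *)
Lemma band_solution_solves : solves_pde fl fr a L band_solution.
Proof.
have H1 := H1_per_band_solution; split => // u [Hu1 Hu2].
have [D1 D2 D3 D4] := band_solution_wderiv.
have refl w : ae_eq mu2 setT w w by exact: aeW.
have E1 := wderiv_ae (refl _) D1 (ex_intro _ _ D1).
have E2 := wderiv_ae (refl _) D2 (ex_intro _ _ D2).
have E3 := wderiv_ae (refl _) D3 (ex_intro _ _ D3).
have E4 := wderiv_ae (refl _) D4 (ex_intro _ _ D4).
have [wx wx2 wxu] := H1_per_wderiv Hu1 dir_x_in.
have [wy wy2 wyu] := H1_per_wderiv Hu2 dir_y_in.
pose g1 := wderiv dir_x (fst \o u); pose g2 := wderiv dir_y (snd \o u).
have u22 := H1_per_unit Hu2; have g22 := H1_per_wderiv_unit Hu2 dir_y_in.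
have W2 := Lfun2_strip (weight_Lfun2 fl fr a0) mA (cell_x_finite L).
have intW w : (fun p => w p * \1_A p.1) \in Lfun mu2 2%:E ->
    mu2.-integrable setT (EFin \o (fun p => weight fl fr a p.2 * (w p * \1_A p.1))).
  move=> w2; have := Lfun2_mul W2 w2; apply: eq_integrable => // p _ /=.
  by rewrite mulrACA -mulrA indic_idem.
have [i1 i2 i3 Id] := @profile_identity R fl fr a flr a0 _ _ mu2 snd measurable_snd _ _
  (strip_y wy mA bA) (hline_null fl) (hline_null fr) (intW _ u22) (intW _ g22).
(* The remaining part of div u over the band is an x-derivative over one period, and integrates to
   zero. *)
have Px := periodic_dx_integral0 L0 (let: And4 x _ _ _ := Hu1 in x) wx mI bI.
have lg1 : loc2 g1 := L2_loc_loc2 wx2.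
have i4 : mu2.-integrable setT (EFin \o (fun p => g1 p * \1_I p.2 * \1_A p.1)).
  have [M HM] := bA; have [A1 A2] := indic_bounded_support HM; have [M' HM'] := bI.
  have [I1 I2] := indic_bounded_support HM'.
  have mInd : measurable_fun setT (\1_I : R -> R) by exact: measurable_indic.
  have mAnd : measurable_fun setT (\1_A : R -> R) by exact: measurable_indic.
  have := @slab_mul _ _ R mu2 fst (fun p => g1 p * \1_I p.2) (fun p => \1_A p.1)
     (slab_fst lg1 mInd I1 I2) (measurable_comp1 measurable_fst mAnd).
  by apply; [have [C HC] := A1; exists C|have [N HN] := A2; exists N => p; exact: HN].
rewrite pde_indicators.
have alg (x1 x2 x3 x4 y i : R) : (0 * x1 + 0 * x2 + 0 * x3 + y * x4) * i = y * (x4 * i).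
  by rewrite !mul0r !add0r mulrA.
have -> : \int[mu2]_p (frobenius_grad band_solution u p * \1_(unit_region L) p) =
    \int[mu2]_p (profile' fl fr a p.2 * (g2 p * \1_A p.1)).
  apply: ae_eq_Rintegral.
  - by apply/measurable_EFinP; exact: measurable_int (frobenius_integrable H1 (conj Hu1 Hu2)).
  - by apply/measurable_EFinP; exact: measurable_int i1.
  - apply: plane_ae2 (plane_ae_and E1 E2) (plane_ae_and E3 E4) => p [e1 e2] [e3 e4] _.
    rewrite indic_unit /frobenius_grad (e1 Logic.I) (e2 Logic.I) (e3 Logic.I) (e4 Logic.I).
    exact: (alg (wderiv dir_x (fst \o u) p) (wderiv dir_y (fst \o u) p)
      (wderiv dir_x (snd \o u) p) (g2 p) (profile' fl fr a p.2) (\1_A p.1)).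
have -> : \int[mu2]_p (dot (band_solution p) (u p) * \1_(unit_region L `\` band_cell fl fr L) p) =
    \int[mu2]_p (profile fl fr a p.2 * ((snd \o u) p * \1_A p.1) * \1_(~` I) p.2).
  apply: eq_Rintegral => p _; rewrite indic_outside /dot /band_solution /= mul0r add0r.
  by rewrite !mulrA.
rewrite Id.
have -> : \int[mu2]_p (divergence u p * \1_(band_cell fl fr L) p) =
    \int[mu2]_p (g1 p * \1_I p.2 * \1_A p.1 + g2 p * \1_A p.1 * \1_I p.2).
  apply: eq_Rintegral => p _; rewrite indic_band_cell /divergence -/g1 -/g2 -/A -/I.
  by ring.
by rewrite RintegralD// Px add0r.
Qed.

Lemma x_periodic_iter u (n : nat) : x_periodic L u ->
  {ae mu2, forall p, u (shift_x (n%:R * L) p) = u p} /\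
  {ae mu2, forall p, u (shift_x (- (n%:R * L)) p) = u p}.
Proof.
move=> up.
have H : {ae mu2, forall p, u (shift_x (n%:R * L) p) = u p}.
  elim: n => [|n IH].
    apply: aeW => p; congr u; rewrite /shift_x mul0r addr0; exact/esym/surjective_pairing.
  apply: plane_ae2 IH (plane_shift_ae (n%:R * L) up) => p <- <-; congr u.
  by rewrite /shift_x /=; congr pair; rewrite -addn1 natrD; ring.
(* The backward translation is the forward identity evaluated at the point translated back. *)
split => //; apply: plane_ae_imply (plane_shift_ae (- (n%:R * L)) H) => p <-; congr u.
by rewrite /shift_x /= subrK; case: p.
Qed.

(** Countably many translates of one period cover the plane, so the exceptional null sets may be
    united. *)
Lemma x_periodic_zero u : x_periodic L u ->
  ae_eq mu2 setT (fun p => u p * \1_A p.1) (cst 0) -> ae_eq mu2 setT u (cst 0).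
Proof.
move=> up u0.
have u0' : {ae mu2, forall p, A p.1 -> u p = 0}.
  apply: plane_ae_imply u0 => p /= H Ap; have := H Logic.I.
  by rewrite indicE mem_set// mulr1.
have Hp (n : nat) : {ae mu2, forall p, A (p.1 + n%:R * L) -> u p = 0}.
  have [H _] := x_periodic_iter n up.
  by apply: plane_ae2 H (plane_shift_ae (n%:R * L) u0') => p <-.
have Hm (n : nat) : {ae mu2, forall p, A (p.1 - n%:R * L) -> u p = 0}.
  have [_ H] := x_periodic_iter n up.
  by apply: plane_ae2 H (plane_shift_ae (- (n%:R * L)) u0') => p <-.
have := plane_ae2 _ (ae_foralln (mu := mu2) Hp) (ae_foralln (mu := mu2) Hm); apply.
move=> p up' um _.
(* The index of the period containing [p]. A nonnegative one calls for a backward translation, a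
   negative one for a forward translation. *)
pose k := Num.floor (p.1 / L).
have /andP[k1 k2] := floor_itv (p.1 / L); rewrite -/k in k1 k2.
have {}k1 : k%:~R * L <= p.1 by rewrite -ler_pdivlMr.
have {}k2 : p.1 < (k%:~R + 1) * L by rewrite -ltr_pdivrMr// (lt_le_trans k2)// intrD.
case: k k1 k2 => n k1 k2.
  by apply: (um n); rewrite /A /cell_x /= in_itv/=; move: k1 k2; rewrite -pmulrn => *; apply/andP; split; lra.
(* A negative integer is encoded as -(n+1), hence the successor. *)
apply: (up' n.+1); rewrite /A /cell_x /= in_itv/=; move: k1 k2.
by rewrite NegzE mulrNz -pmulrn => *; apply/andP; split; lra.
Qed.

(** For each measurable x-set [A'] the restriction of [u] to it, within one period, has zero
    y-derivative and vanishes outside the band; [slab_weak_derivative_zero] kills its integral over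
    every rectangle. *)
Lemma strip_zero u : H1_per L u ->
  ae_eq mu2 setT (fun p => wderiv dir_y u p * \1_A p.1) (cst 0) ->
  ae_eq mu2 setT (fun p => u p * \1_A p.1 * \1_(~` I) p.2) (cst 0) ->
  ae_eq mu2 setT u (cst 0).
Proof.
move=> Hu g0 uout; apply: x_periodic_zero; first by case: Hu.
have bind (B : set R) : exists C : R, forall x, `|\1_B x : R| <= C.
  by exists 1 => x; rewrite indicE; case: (_ \in _); rewrite ?normr1 ?normr0.
apply: ae_eq0_rectangles.
  apply: loc2_bounded_mul; first exact: H1_per_loc2 Hu.
    by apply: (measurable_comp1 measurable_fst); exact: measurable_indic.
  by have [C HC] := bind A; exists C.
move=> A' B' mA' mB' [M HM] _.
have [wy _ _] := H1_per_wderiv Hu dir_y_in.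
have mB : measurable (A `&` A') by exact: measurableI.
have bB : exists M, A `&` A' `<=` `]- M, M[%classic by exists M => x [_ /HM].
have E p : \1_(A `&` A') p = \1_A p * \1_A' p :> R by rewrite !indicE in_setI -natrM mulnb.
have W := strip_y wy mB bB.
have g0' : ae_eq mu2 setT (fun p => wderiv dir_y u p * \1_(A `&` A') p.1) (cst 0).
  by apply: plane_ae_imply g0 => p /= + _ => /(_ Logic.I) H; rewrite E mulrA H mul0r.
have uout' : {ae mu2, forall p, ~ `]fl, fr[%classic p.2 -> u p * \1_(A `&` A') p.1 = 0}.
  apply: plane_ae_imply uout => p /= + np => /(_ Logic.I).
  by rewrite [\1_(~` I) _]indicE mem_set//= mulr1 E mulrA => ->; rewrite mul0r.
have := @slab_weak_derivative_zero _ _ R mu2 snd measurable_snd fl fr _ _ W g0' uout' B' mB'.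
move=> <-; apply: eq_Rintegral => p _.
by rewrite E !mulrA.
Qed.

Lemma dot_integrable s t : H1_per_vec L s -> H1_per_vec L t ->
  mu2.-integrable setT (EFin \o (fun p => dot (s p) (t p) *
    \1_(unit_region L `\` band_cell fl fr L) p)).
Proof.
move=> [s1 s2] [t1 t2].
have i1 := Lfun2_mul (H1_per_unit s1) (H1_per_unit t1).
have i2 := Lfun2_mul (H1_per_unit s2) (H1_per_unit t2).
have mO : measurable_fun setT (fun p : R * R => \1_(~` I) p.2 : R).
  by apply: (measurable_comp1 measurable_snd); apply: measurable_indic; exact: measurableC.
have bO : exists C, forall p : R * R, `|\1_(~` I) p.2 : R| <= C.
  by exists 1 => p; rewrite indicE; case: (_ \in _); rewrite ?normr1 ?normr0.
have := @integrable_mul_bounded _ _ R mu2 _ _ mO bO (integrableD measurableT i1 i2).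
apply: eq_integrable => // p _; rewrite /= indic_outside; congr EFin.
by rewrite /dot !mul_indic -mulrDl -mulrA.
Qed.

(** The zero-order term sees only the complement of the band. Inside, the vanishing y-derivative
    carries the value zero over from outside through [strip_zero], one component at a time. *)
Lemma pde_unique s t : solves_pde fl fr a L s -> solves_pde fl fr a L t ->
  ae_eq mu2 setT s t.
Proof.
move=> [Hs Es] [Ht Et].
pose D p := ((s p).1 - (t p).1, (s p).2 - (t p).2).
have HD : H1_per_vec L D by split; apply: H1_perB; [case: Hs|case: Ht|case: Hs|case: Ht].
have {}Es := Es _ HD; have {}Et := Et _ HD.
rewrite pde_indicators in Es; rewrite pde_indicators in Et.
have gradB (u w : R * R -> R) v : H1_per L u -> H1_per L w -> v \in [:: dir_x; dir_y] ->
    {ae mu2, forall p, wderiv v (fun p => u p - w p) p = wderiv v u p - wderiv v w p}.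
  move=> Hu Hw vd; have [wu _ _] := H1_per_wderiv Hu vd; have [ww _ _] := H1_per_wderiv Hw vd.
  have refl (z : R * R -> R) : ae_eq mu2 setT z z by exact: aeW.
  have wB := is_weak_derivativeB wu ww.
  have E := wderiv_ae (refl _) wB (ex_intro _ _ wB).
  by apply: (plane_ae_imply _ E) => p H; exact: H Logic.I.
have [s1 s2] := Hs; have [t1 t2] := Ht; have [D1 D2] := HD.
have e1 := gradB _ _ _ s1 t1 dir_x_in; have e2 := gradB _ _ _ s1 t1 dir_y_in.
have e3 := gradB _ _ _ s2 t2 dir_x_in; have e4 := gradB _ _ _ s2 t2 dir_y_in.
have iD := frobenius_integrable HD HD.
have isD := frobenius_integrable Hs HD; have itD := frobenius_integrable Ht HD.
have jD := dot_integrable HD HD.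
have jsD := dot_integrable Hs HD; have jtD := dot_integrable Ht HD.
have E : a * \int[mu2]_p (frobenius_grad D D p * \1_(unit_region L) p) +
    \int[mu2]_p (dot (D p) (D p) * \1_(unit_region L `\` band_cell fl fr L) p) = 0.
  have -> : \int[mu2]_p (frobenius_grad D D p * \1_(unit_region L) p) =
      \int[mu2]_p (frobenius_grad s D p * \1_(unit_region L) p) -
      \int[mu2]_p (frobenius_grad t D p * \1_(unit_region L) p).
    rewrite -RintegralB//; apply: ae_eq_Rintegral.
    - by apply/measurable_EFinP; exact: measurable_int iD.
    - by apply: measurable_funB; apply/measurable_EFinP; [exact: measurable_int isD|exact: measurable_int itD].
    - apply: plane_ae2 (plane_ae_and e1 e2) (plane_ae_and e3 e4) => p [f1 f2] [f3 f4] _.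
      exact: (energyB (\1_(unit_region L) p) f1 f2 f3 f4).
  have -> : \int[mu2]_p (dot (D p) (D p) * \1_(unit_region L `\` band_cell fl fr L) p) =
      \int[mu2]_p (dot (s p) (D p) * \1_(unit_region L `\` band_cell fl fr L) p) -
      \int[mu2]_p (dot (t p) (D p) * \1_(unit_region L `\` band_cell fl fr L) p).
    rewrite -RintegralB//; apply: eq_Rintegral => p _; rewrite -mulrBl; congr (_ * _).
    by rewrite /dot /D /=; ring.
  exact: (equationB Es Et).
have ge0 x : 0 <= x * x :> R by rewrite -expr2 sqr_ge0.
have [f0 h0] : ae_eq mu2 setT (fun p => frobenius_grad D D p * \1_(unit_region L) p) (cst 0) /\
    ae_eq mu2 setT (fun p => dot (D p) (D p) * \1_(unit_region L `\` band_cell fl fr L) p) (cst 0).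
  apply: two_energies a0 _ _ iD jD E.
  - by move=> p; rewrite mulr_ge0// /frobenius_grad !addr_ge0.
  - by move=> p; rewrite mulr_ge0// /dot !addr_ge0.
have sq0 x : x * x = 0 -> x = 0 :> R by move=> /eqP; rewrite mulf_eq0 orbb => /eqP.
have fE p : frobenius_grad D D p * \1_(unit_region L) p = 0 ->
    wderiv dir_y (fst \o D) p * \1_A p.1 = 0 /\ wderiv dir_y (snd \o D) p * \1_A p.1 = 0.
  rewrite indic_unit indicE; case: (_ \in _); last by rewrite !mulr0.
  by rewrite !mulr1; exact: sum4_squares_eq0.
have hE p : dot (D p) (D p) * \1_(unit_region L `\` band_cell fl fr L) p = 0 ->
    (D p).1 * \1_A p.1 * \1_(~` I) p.2 = 0 /\ (D p).2 * \1_A p.1 * \1_(~` I) p.2 = 0.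
  rewrite indic_outside -/A -/I -!mulrA.
  case: (eqVneq (\1_A p.1 * \1_(~` I) p.2 : R) 0) => [->|n0]; first by rewrite !mulr0.
  move=> /eqP; rewrite mulf_eq0 (negbTE n0) orbF /dot paddr_eq0// => /andP[/eqP/sq0 -> /eqP/sq0 ->].
  by rewrite !mul0r.
have z1 : ae_eq mu2 setT (fst \o D) (cst 0).
  apply: strip_zero D1 _ _.
    by apply: plane_ae_imply f0 => p /(_ Logic.I) /fE[].
  by apply: plane_ae_imply h0 => p /(_ Logic.I) /hE[].
have z2 : ae_eq mu2 setT (snd \o D) (cst 0).
  apply: strip_zero D2 _ _.
    by apply: plane_ae_imply f0 => p /(_ Logic.I) /fE[].
  by apply: plane_ae_imply h0 => p /(_ Logic.I) /hE[].
apply: plane_ae2 z1 z2 => p /(_ Logic.I)/= d1 /(_ Logic.I)/= d2 _.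
rewrite [s p]surjective_pairing [t p]surjective_pairing; congr pair.
  by apply/eqP; rewrite -subr_eq0 d1.
by apply/eqP; rewrite -subr_eq0 d2.
Qed.

Lemma solution_divergence s : solves_pde fl fr a L s ->
  {ae mu2, forall p, band fl fr p -> divergence s p = slope fl fr a}.
Proof.
move=> Hs; have U := pde_unique Hs band_solution_solves.
have [[s1 s2] _] := Hs.
have [w1 _ _] := H1_per_wderiv s1 dir_x_in; have [w2 _ _] := H1_per_wderiv s2 dir_y_in.
have [D1 _ _ D4] := band_solution_wderiv.
have U1 : ae_eq mu2 setT (fst \o s) (fst \o band_solution).
  by apply: plane_ae_imply U => p /= + _ => /(_ Logic.I) ->.
have U2 : ae_eq mu2 setT (snd \o s) (snd \o band_solution).
  by apply: plane_ae_imply U => p /= + _ => /(_ Logic.I) ->.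
apply: plane_ae2 (wderiv_ae U1 D1 (ex_intro _ _ w1)) (wderiv_ae U2 D4 (ex_intro _ _ w2)).
move=> p /(_ Logic.I) e1 /(_ Logic.I) e2 [_ /=]; rewrite in_itv/= => pb.
by rewrite /divergence e1 e2 /= add0r profile'_band.
Qed.

End PlaneProblem.

(** * Thickness of the band, and the theorem *)

Section Thickness.
Context {R : realType}.
Variables (fl fr : R).
Hypothesis flr : fl < fr.

(** The top and bottom points of a disc inside the band bound its diameter by the width. As the band
    is open, this bound is a supremum that no closed disc attains, so it is approached up to [e]. *)
Lemma band_thickness p : band fl fr p -> thickness (band fl fr) p = (fr - fl)%:E.
Proof.
have flr' := flr.
case=> _ /=; rewrite in_itv/= => /andP[p1 p2].
apply/eqP; rewrite eq_le; apply/andP; split.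
  apply: ge_ereal_sup => _ [c [r [r0 _ sub ->]]]; rewrite lee_fin.
  have [_] : band fl fr (c.1, c.2 + r).
    by apply: sub; rewrite /closed_disc /= subrr expr0n add0r addrAC subrr add0r.
  have [_] : band fl fr (c.1, c.2 - r).
    by apply: sub; rewrite /closed_disc /= subrr expr0n add0r addrAC subrr add0r sqrrN.
  by rewrite /= !in_itv/= => /andP[q1 q2] /andP[q3 q4]; lra.
apply/lee_addgt0Pr => e e0.
pose m := (fl + fr) / 2; pose w := (fr - fl) / 2.
(* The centre lies on the midline above or below [p]. The three lower bounds on the radius make the
   disc contain [p], keep the radius positive, and bring the diameter within [e] of the width; each
   is below the half-width [w]. *)
pose r := Num.max `|p.2 - m| (Num.max (w / 2) (w - e / 2)).
have pm : `|p.2 - m| < w by rewrite ltr_norml /m /w; apply/andP; split; lra.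
have rw : r < w by rewrite !gt_max pm /w /=; apply/andP; split; lra.
have r0 : 0 < r by rewrite !lt_max; apply/orP; right; apply/orP; left; rewrite /w; lra.
have rp : `|p.2 - m| <= r by rewrite le_max lexx.
have re : w - e / 2 <= r by rewrite !le_max lexx !orbT.
apply: (@le_trans _ _ ((2 * r)%:E + e%:E)%E).
  by rewrite -EFinD lee_fin; rewrite /w in re; lra.
rewrite leeD2r//; apply: ereal_sup_ubound; exists (p.1, m), r; split => //.
  rewrite /closed_disc /= subrr expr0n add0r -real_normK ?num_real//.
  by rewrite lerXn2r ?nnegrE// ltW.
move=> q; rewrite /closed_disc /= => qr; split => //=.
have : `|q.2 - m| <= r.
  rewrite -(@ler_pXn2r _ 2) ?nnegrE ?normr_ge0 ?(ltW r0)// real_normK ?num_real//.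
  by apply: le_trans qr; rewrite lerDr sqr_ge0.
by rewrite in_itv/= ler_norml => /andP[q1 q2]; rewrite /w /m in rw q1 q2; apply/andP; split; lra.
Qed.

Lemma pde_thickness_slope (a : R) s p : 0 < a -> divergence s p = slope fl fr a ->
  pde_thickness a s p = fr - fl + 2 * Num.sqrt a.
Proof.
move=> a0 ds; rewrite /pde_thickness ds /slope.
have sa0 : 0 < Num.sqrt a by rewrite sqrtr_gt0.
have d0 : 0 < 2 * Num.sqrt a + (fr - fl) by rewrite addr_gt0 ?mulr_gt0// subr_gt0.
by field; rewrite !gt_eqF.
Qed.

End Thickness.

Theorem theorem4p1 (R : realType) (fl fr : R) (flr : fl < fr) :
  [/\
      forall a L : R, 0 < a -> 0 < L ->
        exists2 s, solves_pde fl fr a L s &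
          forall t, solves_pde fl fr a L t -> ae_eq (leb2 R) setT t s,
      forall a : R, 0 < a ->
        exists S : R -> R,
          [/\ solves_ode fl fr a S,
              forall S', solves_ode fl fr a S' -> ae_eq (leb1 R) setT S' S &
              forall (L : R) s, 0 < L -> solves_pde fl fr a L s ->
                ae_eq (leb2 R) setT s (fun p => (0, S p.2))],
      forall (a L : R) s, 0 < a -> 0 < L -> solves_pde fl fr a L s ->
        exists c : R,
          {ae (leb2 R), forall p, band fl fr p -> divergence s p = c},
      (* convergence to the thickness, in the L^oo sense on the band: the divergence is
         only determined almost everywhere *)
      (forall p, band fl fr p -> thickness (band fl fr) p = (fr - fl)%:E) /\
      (forall L eps : R, 0 < L -> 0 < eps ->
        \forall a \near 0^'+, forall s, solves_pde fl fr a L s ->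
          {ae (leb2 R), forall p, band fl fr p ->
            (`|(pde_thickness a s p)%:E - thickness (band fl fr) p|
               < eps%:E)%E}) &
      forall (a L : R) s, 0 < a -> 0 < L -> solves_pde fl fr a L s ->
        {ae (leb2 R), forall p, band fl fr p ->
          (pde_thickness a s p)%:E =
            (thickness (band fl fr) p + (2 * Num.sqrt a)%:E)%E}].
Proof.
(* The exact formula is proved first: the convergence follows from it, since the error is exactly 2
   sqrt a. *)
have main (a L : R) s : 0 < a -> 0 < L -> solves_pde fl fr a L s ->
    {ae (leb2 R), forall p, band fl fr p ->
      (pde_thickness a s p)%:E = (thickness (band fl fr) p + (2 * Num.sqrt a)%:E)%E}.
  move=> a0 L0 /(solution_divergence flr a0 L0); apply: plane_ae_imply => p ds bp.
  by rewrite (pde_thickness_slope flr a0 (ds bp)) band_thickness.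
split.
- move=> a L a0 L0; exists (band_solution fl fr a); first exact: band_solution_solves.
  by move=> t Ht; apply: pde_unique Ht _ => //; exact: band_solution_solves.
- move=> a a0; exists (profile fl fr a); split.
  + exact: profile_solves_ode.
  + by move=> S' HS'; apply: ode_unique HS' _ => //; exact: profile_solves_ode.
  + by move=> L s L0 Hs; apply: pde_unique Hs _ => //; exact: band_solution_solves.
- move=> a L s a0 L0 Hs; exists (slope fl fr a).
  exact: solution_divergence Hs.
- split=> [p|L eps L0 eps0]; first exact: band_thickness.
  near=> a => s Hs.
  have a0 : 0 < a by near: a; exact: nbhs_right_gt.
  (* Equivalent to a < (eps / 2)^2, which holds for [a] close to 0. *)
  have aeps : 2 * Num.sqrt a < eps.
    rewrite mulrC -ltr_pdivlMr// -[ltRHS]ger0_norm ?divr_ge0 ?ltW// -sqrtr_sqr.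
    rewrite ltr_sqrt ?exprn_gt0 ?divr_gt0//.
    by near: a; apply: nbhs_right_lt; rewrite exprn_gt0// divr_gt0.
  apply: plane_ae_imply (main a L s a0 L0 Hs) => p H bp.
  rewrite (H bp) band_thickness//= lte_fin addrAC subrr add0r.
  by rewrite ger0_norm// mulr_ge0// sqrtr_ge0.
- exact: main.
Unshelve. all: by end_near. Qed.
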